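(* Let $f(z)=\sum_{n\ge0} a_n z^{-n}\in\mathbb{C}[[z^{-1}]]$ be a Gevrey-1 formal series with Borel transform $\widetilde f(\zeta)=\sum_{n\ge1} \frac{a_n\zeta^{n-1}}{(n-1)!}$. Assume that $\widetilde f$ extends holomorphically to the open set $\Delta$ and that there exist $A>0$, $B>0$ with $|\widetilde f(\zeta)|\le A e^{B|\zeta|}$ for all $\zeta\in\Delta$. For $n\ge0$ put $$b_n=\frac{1}{n!}\sum_{k=1}^{n+1}(-1)^{n-k+1}\mathfrak{s}(n,k-1)\,a_k .$$ Then for every integer $N\ge0$ and every $z\in\mathbb{C}$ with $\Re(z)>B$, $$\Big|\mathrm{S}_0f(z)-\Big(a_0+\sum_{n=0}^{N}\frac{\Gamma(z)\Gamma(n+1)b_n}{\Gamma(z+n+1)}\Big)\Big|\le R_1(A,B,N,z),$$ where $$R_1(A,B,N,z)=\frac{A}{B^B}\,\frac{(N+B+1)^{N+B+1}}{(N+1)^N}\,\left|\frac{\Gamma(z)\Gamma(N+1)}{\Gamma(z+N+1)(\Re(z)-B)}\right|.$$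
   Context: $\Delta$ denotes the image of the open disc $D(1,1)=\{s:|s-1|<1\}$ under the biholomorphism $s\mapsto -\ln s$ (principal logarithm); it satisfies $\{\zeta: d(\zeta,\mathbb{R}^+)<\ln 2\}\subset\Delta\subset\{\zeta:d(\zeta,\mathbb{R}^+)<\pi/2\}$. A series $\sum a_n z^{-n}$ is Gevrey-1 if $|a_n|\le C K^n n!$ for some constants $C,K$. The Borel sum is $\mathrm{S}_0 f(z)=a_0+\int_0^{+\infty}\widetilde f(\zeta)e^{-z\zeta}\,d\zeta$, holomorphic for $\Re(z)>B$. The Stirling numbers of the first kind $\mathfrak{s}(n,k)$ are defined by $\prod_{k=0}^{n-1}(x-k)=\sum_{k=0}^n\mathfrak{s}(n,k)x^k$ (with $\mathfrak{s}(0,0)=1$). *)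

(* Defs.v *)
From mathcomp Require Import all_boot all_algebra.
From mathcomp Require Import Rstruct.
From Stdlib Require Import Reals ClassicalEpsilon Factorial.
From Coquelicot Require Import Coquelicot.

Set Implicit Arguments.
Unset Strict Implicit.

Section Stirling.
Local Open Scope ring_scope.
Definition stirling1 (n k : nat) : int :=
  (\prod_(i < n) ('X - (Posz i)%:P) : {poly int})`_k.

Definition stirling1R (n k : nat) : R := (stirling1 n k)%:~R.
End Stirling.

Open Scope R_scope.
Open Scope C_scope.

Definition Cexp (z : C) : C :=
  (exp (Re z) * cos (Im z), exp (Re z) * sin (Im z))%R.

(* principal argument in (-pi, pi] (0 for s = 0) *)
Definition Carg (s : C) : R :=
  if Rlt_dec 0 (Re s) then atan (Im s / Re s)
  else if Rlt_dec (Re s) 0 then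
    (if Rle_dec 0 (Im s) then atan (Im s / Re s) + PI else atan (Im s / Re s) - PI)%R
  else if Rlt_dec 0 (Im s) then (PI / 2)%R
  else if Rlt_dec (Im s) 0 then (- (PI / 2))%R else 0%R.

Definition Clog (s : C) : C := (ln (Cmod s), Carg s).

Definition DeltaDom (zeta : C) : Prop :=
  exists s : C, Cmod (s - 1) < 1 /\ zeta = - Clog s.

Definition CInt_0_inf (f : R -> C) : C :=
  epsilon (inhabits (0 : C))
    (fun I : C => is_RInt_gen (V := C_R_NormedModule) f (at_right 0) (Rbar_locally p_infty) I).

Definition CGamma (z : C) : C :=
  CInt_0_inf (fun t : R => Cexp ((z - 1) * RtoC (ln t)) * RtoC (exp (- t))).

Definition gevrey1 (a : nat -> C) : Prop :=
  exists Cst K : R, forall n : nat, Cmod (a n) <= Cst * K ^ n * INR (Factorial.fact n).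

Definition borel_coef (a : nat -> C) (n : nat) : C := a (S n) / RtoC (INR (Factorial.fact n)).

(* Borel sum S_0 f(z) = a_0 + int_0^oo F(zeta) e^(-z zeta) dzeta,
   where F is the holomorphic extension of the Borel transform *)
Definition borel_sum (a : nat -> C) (F : C -> C) (z : C) : C :=
  a 0%nat + CInt_0_inf (fun t : R => F (RtoC t) * Cexp (- z * RtoC t)).

Definition bcoef (a : nat -> C) (n : nat) : C :=
  / RtoC (INR (Factorial.fact n)) *
  sum_n_m (G := C_AbelianMonoid)
    (fun k : nat => RtoC ((-1) ^ (n + 1 - k) * stirling1R n (k - 1)) * a k) 1 (n + 1).

Definition R1_bound (A B : R) (N : nat) (z : C) : R :=
  A / Rpower B B * Rpower (INR N + B + 1) (INR N + B + 1) / (INR N + 1) ^ N *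
  Cmod (CGamma z * CGamma (RtoC (INR N + 1)) /
        (CGamma (z + RtoC (INR N + 1)) * RtoC (Re z - B))).

(* Main.v *)
From mathcomp Require all_boot all_algebra Rstruct.
Require Import Defs.
From Stdlib Require Import Reals Lra Lia Classical ClassicalEpsilon.
From Coquelicot Require Import Coquelicot.
Open Scope R_scope.
Open Scope C_scope.

(** Put [f u = F (- log (1 - u))], which is holomorphic on the unit disc, and let [g_n] be the
    [n]-th derivative of [f] along [(-1, 1)]. The substitution [u = 1 - e^-t] turns the Borel
    integral into [J_0], where [J_n] is the Laplace transform at [z] of
    [G_n t = e^(-n t) g_n (1 - e^-t)]. Since [G_n' = G_(n+1) - n G_n], integration by parts gives
    [(z + n) J_n = g_n 0 + J_(n+1)]; iterating produces the factorial series, because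
    [g_n 0 = n! b_n] (chain rule and the Stirling recurrence) and
    [Gamma (z + n + 1) = z (z + 1) ... (z + n) Gamma z], plus the remainder
    [J_(N+1) / (z ... (z + N))]. For [c = 1 - e^-t], Cauchy's estimate for [v |-> f (c + (1 - c) v)]
    on [|v| = r], together with [|log (1 - v)| <= - log (1 - |v|)], yields
    [|G_n t| <= n! A e^(B t) (1 - r)^(-B) r^(-n)], and [r = (N + 1) / (N + 1 + B)] is optimal.
    Since the derivative of [F] is not assumed continuous, Cauchy's theory rests on Goursat's
    lemma, applied to [w |-> k (e^w)] on rectangles of height [2 pi]. *)

(** * Complex differentiability *)

(** [CInt_0_inf] is a choice operator and the terms of the series are divided by values of [CGamma].
    Every integral must therefore be shown to converge before anything is known of its value, and
    [CGamma] must be shown not to vanish on the right half-plane before its factors cancel. Cauchy's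
    theory is kept to circles centered at 0: in the coordinate [u = e^w] they are vertical segments,
    and Goursat's lemma on rectangles suffices. Higher complex derivatives never appear. The Taylor
    series of a function on the disc is split into two real power series on [(-1, 1)], and a
    sequence of successive derivatives along an interval is determined by its first member. This
    uniqueness compares the expansion of [f] at 0 with the one at [c], and also with the Stirling
    formula. The disc of center [c] and radius [1 - c] is the largest about [c] inside the unit
    disc, and on it [1 - u] factors as [(1 - c) (1 - v)], which separates the growth in [t] from the
    Cauchy radius. The radius [r] minimizes [r^-(N+1) (1 - r)^-B]: there
    [(N + 1) / r = B / (1 - r)]. *)

Notation CU := (AbsRing_UniformSpace C_AbsRing).

Definition Cnear (z : C) (P : C -> Prop) : Prop := locally (T := CU) z P.

Definition Ccont (f : C -> C) (z : C) : Prop := continuous (T := CU) (U := CU) f z.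

(* Carathéodory's form of [f'(z) = l], which makes product, chain and inverse rules algebraic. *)
Definition Cdiff (f : C -> C) (z l : C) : Prop :=
  exists q : C -> C, q z = l /\ Ccont q z /\
    Cnear z (fun w => f w = f z + q w * (w - z)).

Lemma Ccont_eps (f : C -> C) (z : C) :
  Ccont f z <-> forall eps : R, 0 < eps -> exists d : R, 0 < d /\
    forall w, Cmod (w - z) < d -> Cmod (f w - f z) < eps.
Proof.
  split.
  - intros H eps He.
    destruct (proj1 (filterlim_locally (U := CU) _ _) H (mkposreal _ He)) as [d Hd].
    exists d; split; [apply cond_pos|]. intros w Hw. apply (Hd w Hw).
  - intros H. apply (filterlim_locally (U := CU)). intros eps.
    destruct (H eps (cond_pos eps)) as [d [Hd Hw]].
    exists (mkposreal _ Hd). intros w Hb. apply Hw, Hb.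
Qed.

Lemma Cnear_forall (z : C) (P : C -> Prop) : (forall w, P w) -> Cnear z P.
Proof. apply (filter_forall (F := locally (T := CU) z)). Qed.

Lemma Cnear_imp (z : C) (P Q : C -> Prop) :
  (forall w, P w -> Q w) -> Cnear z P -> Cnear z Q.
Proof. apply (filter_imp (F := locally (T := CU) z)). Qed.

Lemma Cnear_and (z : C) (P Q : C -> Prop) :
  Cnear z P -> Cnear z Q -> Cnear z (fun w => P w /\ Q w).
Proof. apply (filter_and (F := locally (T := CU) z)). Qed.

Lemma Cnear_intro (z : C) (d : R) (P : C -> Prop) :
  0 < d -> (forall w, Cmod (w - z) < d -> P w) -> Cnear z P.
Proof. intros Hd H. exists (mkposreal _ Hd). intros w Hw. apply H, Hw. Qed.

Lemma Cnear_elim (z : C) (P : C -> Prop) :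
  Cnear z P -> exists d, 0 < d /\ forall w, Cmod (w - z) < d -> P w.
Proof. intros [d Hd]. exists d; split; [apply cond_pos|]. intros w Hw; apply Hd, Hw. Qed.

Lemma Ccont_const (c z : C) : Ccont (fun _ => c) z.
Proof. apply (continuous_const (U := CU) (V := CU)). Qed.

Lemma Ccont_id (z : C) : Ccont (fun w => w) z.
Proof. apply (continuous_id (U := CU)). Qed.

Lemma Ccont_plus (f g : C -> C) (z : C) :
  Ccont f z -> Ccont g z -> Ccont (fun w => f w + g w) z.
Proof.
  apply (continuous_plus (U := CU) (V := AbsRing_NormedModule C_AbsRing)).
Qed.

Lemma Ccont_mult (f g : C -> C) (z : C) :
  Ccont f z -> Ccont g z -> Ccont (fun w => f w * g w) z.
Proof. apply (continuous_mult (U := CU) (K := C_AbsRing)). Qed.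

Lemma Ccont_comp (f g : C -> C) (z : C) :
  Ccont f z -> Ccont g (f z) -> Ccont (fun w => g (f w)) z.
Proof. apply (continuous_comp (U := CU) (V := CU) (W := CU)). Qed.

Lemma Ccont_ext_loc (f g : C -> C) (z : C) :
  Cnear z (fun w => f w = g w) -> Ccont f z -> Ccont g z.
Proof.
  intros H Hf. apply (continuous_ext_loc (T := CU) (U := CU) g f); assumption.
Qed.

Lemma Cnear_cont (f : C -> C) (z : C) (P : C -> Prop) :
  Ccont f z -> Cnear (f z) P -> Cnear z (fun w => P (f w)).
Proof. intros H; apply H. Qed.

Lemma Cmod_sym (x y : C) : Cmod (x - y) = Cmod (y - x).
Proof. rewrite <- Cmod_opp. f_equal; ring. Qed.

Lemma Cmod_triangle_rev (x y : C) : Cmod x - Cmod y <= Cmod (x - y).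
Proof.
  generalize (Cmod_triangle (x - y) y). replace (x - y + y) with x by ring. lra.
Qed.

Lemma Cnear_neq (z c : C) : z <> c -> Cnear z (fun w => w <> c).
Proof.
  intros H. apply (Cnear_intro _ (Cmod (z - c))).
  - apply Cmod_gt_0. intros E. apply H. replace z with (z - c + c) by ring.
    rewrite E; ring.
  - intros w Hw E. subst. rewrite Cmod_sym in Hw. lra.
Qed.

Lemma Ccont_inv (z : C) : z <> 0 -> Ccont Cinv z.
Proof.
  intros Hz. apply Ccont_eps. intros eps He.
  assert (Hm := proj1 (Cmod_gt_0 z) Hz).
  set (m := Cmod z) in *.
  exists (Rmin (m / 2) (eps * (m * m / 2))). split.
  { apply Rmin_glb_lt; [lra|]. apply Rmult_lt_0_compat; nra. }
  intros w Hw.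
  assert (H1 : Cmod (w - z) < m / 2) by (eapply Rlt_le_trans; [exact Hw|apply Rmin_l]).
  assert (H2 : Cmod (w - z) < eps * (m * m / 2)) by (eapply Rlt_le_trans; [exact Hw|apply Rmin_r]).
  assert (H3 : m / 2 < Cmod w).
  { generalize (Cmod_triangle_rev z w). rewrite Cmod_sym. unfold m in *. lra. }
  assert (Hw0 : w <> 0) by (apply Cmod_gt_0; lra).
  replace (/ w - / z) with ((z - w) / (w * z)) by (field; auto).
  rewrite Cmod_div by (apply Cmult_neq_0; auto).
  rewrite Cmod_mult, Cmod_sym. fold m.
  apply (Rmult_lt_reg_r (Cmod w * m)); [nra|].
  unfold Rdiv. rewrite Rmult_assoc, Rinv_l by nra. rewrite Rmult_1_r.
  eapply Rlt_le_trans; [exact H2|]. apply Rmult_le_compat_l; [lra|]. nra.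
Qed.

Lemma Cdiff_cont (f : C -> C) (z l : C) : Cdiff f z l -> Ccont f z.
Proof.
  intros (q & _ & Hq & Hf).
  apply (Ccont_ext_loc (fun w => f z + q w * (w - z))).
  - apply Cnear_imp with (2 := Hf). intros w Hw. now rewrite Hw.
  - apply Ccont_plus; [apply Ccont_const|]. apply Ccont_mult; [assumption|].
    apply (Ccont_plus (fun w => w)); [apply Ccont_id|apply Ccont_const].
Qed.

Lemma Cdiff_const (c z : C) : Cdiff (fun _ => c) z 0.
Proof.
  exists (fun _ => 0). split; [reflexivity|]. split; [apply Ccont_const|].
  apply Cnear_forall. intros w; ring.
Qed.

Lemma Cdiff_id (z : C) : Cdiff (fun w => w) z 1.
Proof.
  exists (fun _ => 1). split; [reflexivity|]. split; [apply Ccont_const|].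
  apply Cnear_forall. intros w; ring.
Qed.

Lemma Cdiff_plus (f g : C -> C) (z l m : C) :
  Cdiff f z l -> Cdiff g z m -> Cdiff (fun w => f w + g w) z (l + m).
Proof.
  intros (q & Hl & Hq & Hf) (p & Hm & Hp & Hg).
  exists (fun w => q w + p w). split; [congruence|]. split; [now apply Ccont_plus|].
  generalize (Cnear_and _ _ _ Hf Hg). apply Cnear_imp. intros w [E1 E2].
  rewrite E1, E2. ring.
Qed.

Lemma Cdiff_mult (f g : C -> C) (z l m : C) :
  Cdiff f z l -> Cdiff g z m -> Cdiff (fun w => f w * g w) z (l * g z + f z * m).
Proof.
  intros Hf Hg. assert (Hgc := Cdiff_cont _ _ _ Hg).
  destruct Hf as (q & Hl & Hq & Hf). destruct Hg as (p & Hm & Hp & Hg).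
  exists (fun w => q w * g w + f z * p w). split; [congruence|].
  split.
  - apply Ccont_plus; apply Ccont_mult; auto. apply Ccont_const.
  - generalize (Cnear_and _ _ _ Hf Hg). apply Cnear_imp. intros w [E1 E2].
    rewrite E1, E2. ring.
Qed.

Lemma Cdiff_comp (f g : C -> C) (z l m : C) :
  Cdiff f z l -> Cdiff g (f z) m -> Cdiff (fun w => g (f w)) z (m * l).
Proof.
  intros Hf Hg. assert (Hfc := Cdiff_cont _ _ _ Hf).
  destruct Hf as (q & Hl & Hq & Hf). destruct Hg as (p & Hm & Hp & Hg).
  exists (fun w => p (f w) * q w). split; [congruence|].
  split.
  - apply Ccont_mult; auto. now apply (Ccont_comp f p).
  - generalize (Cnear_and _ _ _ Hf (Cnear_cont _ _ _ Hfc Hg)). apply Cnear_imp.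
    intros w [E1 E2]. rewrite E2. rewrite E1 at 2. ring.
Qed.

Lemma Cdiff_inv (z : C) : z <> 0 -> Cdiff Cinv z (- (/ z * / z)).
Proof.
  intros Hz. exists (fun w => - / z * / w). split; [ring|]. split.
  - apply Ccont_mult; [apply Ccont_const|now apply Ccont_inv].
  - apply Cnear_imp with (2 := Cnear_neq _ _ Hz). intros w Hw. field; auto.
Qed.

Lemma Cdiff_ext_loc (f g : C -> C) (z l : C) :
  Cnear z (fun w => f w = g w) -> Cdiff f z l -> Cdiff g z l.
Proof.
  intros H (q & Hl & Hq & Hf). exists q. split; [assumption|]. split; [assumption|].
  assert (E : f z = g z) by now apply (locally_singleton (T := CU) z (fun w : C => f w = g w)) in H.
  generalize (Cnear_and _ _ _ H Hf). apply Cnear_imp. intros w [E1 E2]. congruence.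
Qed.

Lemma Cdiff_eps (f : C -> C) (z l : C) :
  (forall eps, 0 < eps -> exists d, 0 < d /\ forall w, Cmod (w - z) < d ->
    Cmod (f w - f z - l * (w - z)) <= eps * Cmod (w - z)) -> Cdiff f z l.
Proof.
  intros H.
  (* The difference quotient, completed at [z] by the derivative; the estimate says exactly that it
     is continuous there. *)
  pose (q := fun w => if Ceq_dec w z then l else (f w - f z) / (w - z)).
  assert (Hqz : q z = l) by (unfold q; destruct (Ceq_dec z z); congruence).
  exists q. split; [exact Hqz|]. split.
  - apply Ccont_eps. intros eps He. destruct (H (eps / 2)%R) as [d [Hd Hw]]; [lra|].
    exists d. split; [assumption|]. intros w Hwd. specialize (Hw w Hwd).
    rewrite Hqz. unfold q. destruct (Ceq_dec w z) as [E|E].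
    + replace (l - l) with (RtoC 0) by ring. now rewrite Cmod_0.
    + assert (E0 : w - z <> 0).
      { intros E1. apply E. replace w with (w - z + z) by ring. rewrite E1; ring. }
      replace ((f w - f z) / (w - z) - l) with ((f w - f z - l * (w - z)) / (w - z))
        by (field; assumption).
      rewrite Cmod_div by assumption. assert (H0 := proj1 (Cmod_gt_0 _) E0).
      apply (Rmult_lt_reg_r (Cmod (w - z))); [assumption|].
      unfold Rdiv. rewrite Rmult_assoc, Rinv_l by lra. nra.
  - apply Cnear_forall. intros w. unfold q. destruct (Ceq_dec w z) as [E|E].
    + rewrite E; ring.
    + field. intros E1. apply E. replace w with (w - z + z) by ring. rewrite E1; ring.
Qed.

Lemma Cdiff_ex_derive (f : C -> C) (z : C) :
  ex_derive (K := C_AbsRing) (V := C_NormedModule) f z -> exists l, Cdiff f z l.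
Proof.
  intros [l [_ Hl]]. exists l. apply Cdiff_eps. intros eps He.
  specialize (Hl z (fun P HP => HP) (mkposreal _ He)).
  destruct Hl as [d Hd]. exists d. split; [apply cond_pos|].
  intros w Hw. specialize (Hd w Hw).
  replace (f w - f z - l * (w - z)) with (f w - f z - (w - z) * l) by ring.
  exact Hd.
Qed.

Lemma Cdiff_eq (f : C -> C) (z l m : C) : Cdiff f z l -> l = m -> Cdiff f z m.
Proof. intros H E; now subst. Qed.

(** * Complex exponential and logarithm *)

Lemma Cmod_le_abs (z : C) : Cmod z <= Rabs (Re z) + Rabs (Im z).
Proof.
  assert (H := Cmod2_alt z). assert (H0 := Cmod_ge_0 z).
  assert (H1 := Rabs_pos (Re z)). assert (H2 := Rabs_pos (Im z)).
  rewrite <- (pow2_abs (Re z)), <- (pow2_abs (Im z)) in H. nra.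
Qed.

Lemma Rabs_Im_le_Cmod (z : C) : Rabs (Im z) <= Cmod z.
Proof. eapply Rle_trans; [apply Rmax_r|apply (Rmax_Cmod z)]. Qed.

Lemma Cexp_plus (z w : C) : Cexp (z + w) = Cexp z * Cexp w.
Proof.
  destruct z as [a b], w as [c d]. unfold Cexp, Cmult; cbn.
  rewrite exp_plus, cos_plus, sin_plus. f_equal; ring.
Qed.

Lemma Cexp_0 : Cexp 0 = 1.
Proof. unfold Cexp; cbn. rewrite exp_0, cos_0, sin_0. unfold RtoC. f_equal; ring. Qed.

Lemma Cexp_RtoC (x : R) : Cexp (RtoC x) = RtoC (exp x).
Proof. unfold Cexp, RtoC; cbn. rewrite cos_0, sin_0. f_equal; ring. Qed.

Lemma Cmod_Cexp (z : C) : Cmod (Cexp z) = exp (Re z).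
Proof.
  assert (H := Cmod2_alt (Cexp z)). assert (H0 := Cmod_ge_0 (Cexp z)).
  assert (H1 := exp_pos (Re z)). assert (H2 := sin2_cos2 (Im z)).
  unfold Rsqr in H2. cbn in H.
  assert (E : (Cmod (Cexp z) * Cmod (Cexp z) = exp (Re z) * exp (Re z))%R).
  { transitivity (exp (Re z) * exp (Re z) * (sin (Im z) * sin (Im z) + cos (Im z) * cos (Im z)))%R.
    - destruct z; cbn in *; nra.
    - rewrite H2; ring. }
  nra.
Qed.

Lemma Cexp_neq_0 (z : C) : Cexp z <> 0.
Proof. apply Cmod_gt_0. rewrite Cmod_Cexp. apply exp_pos. Qed.

Lemma is_derive_eps (f : R -> R) (x l : R) : is_derive f x l ->
  forall eps, 0 < eps -> exists d, 0 < d /\ forall h, Rabs h < d ->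
    Rabs (f (x + h) - f x - l * h)%R <= eps * Rabs h.
Proof.
  intros [_ Hl] eps He. specialize (Hl x (fun P HP => HP) (mkposreal _ He)).
  destruct Hl as [d Hd]. exists d; split; [apply cond_pos|]. intros h Hh.
  assert (Hb : ball x d (x + h)%R).
  { change (Rabs (x + h - x) < d)%R. now replace (x + h - x)%R with h by ring. }
  specialize (Hd _ Hb). cbn in Hd.
  change (Rabs (f (x + h) - f x - (x + h - x) * l)%R <= eps * Rabs (x + h - x)%R) in Hd.
  replace (x + h - x)%R with h in Hd by ring. now rewrite (Rmult_comm l).
Qed.

Lemma Cdiff_Cexp_0 : Cdiff Cexp 0 1.
Proof.
  apply Cdiff_eps. intros eps0 He0.
  (* The errors [A1] to [A4] below add up to [7 * eps * m], so a tenth of [eps0] is enough; the cap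
     1 keeps [|x|] below 1/2, hence [exp x] below 3. *)
  set (eps := Rmin 1 (eps0 / 10)).
  assert (He : 0 < eps) by (apply Rmin_glb_lt; lra).
  assert (He1 : eps <= 1) by apply Rmin_l.
  assert (He2 : eps <= eps0 / 10) by apply Rmin_r.
  destruct (is_derive_eps exp 0 1 ltac:(auto_derive; [trivial|rewrite exp_0; ring]) eps He) as [d1 [Hd1 H1]].
  destruct (is_derive_eps cos 0 0 ltac:(auto_derive; [trivial|rewrite sin_0; ring]) eps He) as [d2 [Hd2 H2]].
  destruct (is_derive_eps sin 0 1 ltac:(auto_derive; [trivial|rewrite cos_0; ring]) eps He) as [d3 [Hd3 H3]].
  exists (Rmin (Rmin (eps / 2) d1) (Rmin d2 d3)). split; [repeat apply Rmin_glb_lt; lra|].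
  intros w Hw. replace (w - 0) with w in * by ring.
  assert (Hx := re_le_Cmod w). assert (Hy := Rabs_Im_le_Cmod w).
  assert (Hw1 : Cmod w < eps / 2) by (eapply Rlt_le_trans; [exact Hw|]; eapply Rle_trans; [apply Rmin_l|apply Rmin_l]).
  assert (Hw2 : Cmod w < d1) by (eapply Rlt_le_trans; [exact Hw|]; eapply Rle_trans; [apply Rmin_l|apply Rmin_r]).
  assert (Hw3 : Cmod w < d2) by (eapply Rlt_le_trans; [exact Hw|]; eapply Rle_trans; [apply Rmin_r|apply Rmin_l]).
  assert (Hw4 : Cmod w < d3) by (eapply Rlt_le_trans; [exact Hw|]; eapply Rle_trans; [apply Rmin_r|apply Rmin_r]).
  destruct w as [x y]. cbn [Re Im fst snd] in *.
  specialize (H1 x ltac:(lra)). specialize (H2 y ltac:(lra)). specialize (H3 y ltac:(lra)).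
  rewrite Rplus_0_l, exp_0, Rmult_1_l in H1. rewrite Rplus_0_l, cos_0 in H2.
  rewrite Rplus_0_l, sin_0, Rmult_1_l in H3.
  replace (cos y - 1 - 0 * y)%R with (cos y - 1)%R in H2 by ring.
  replace (sin y - 0 - y)%R with (sin y - y)%R in H3 by ring.
  assert (Hc := COS_bound y).
  rewrite Cexp_0. eapply Rle_trans; [apply Cmod_le_abs|].
  unfold Cexp, Cmult, Cminus, Cplus, Copp, RtoC. cbn [Re Im fst snd].
  set (m := Cmod (x, y)) in *.
  replace (exp x * cos y + - (1) + - (1 * x - 0 * y))%R
    with ((exp x - 1 - x) * cos y + (1 + x) * (cos y - 1))%R by ring.
  replace (exp x * sin y + - 0 + - (1 * y + 0 * x))%R
    with (exp x * (sin y - y) + (exp x - 1 - x + x) * y)%R by ring.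
  assert (Ex : Rabs (exp x) <= 3).
  { replace (exp x) with (exp x - 1 - x + (1 + x))%R by ring.
    eapply Rle_trans; [apply Rabs_triang|].
    assert (Rabs (1 + x) <= 1 + Rabs x)%R by (eapply Rle_trans; [apply Rabs_triang|rewrite Rabs_R1; lra]).
    assert (0 <= Rabs x) by apply Rabs_pos. nra. }
  assert (A1 : Rabs ((exp x - 1 - x) * cos y) <= eps * m).
  { rewrite Rabs_mult. assert (Rabs (cos y) <= 1) by (apply Rabs_le; lra).
    assert (H5 := Rabs_pos (exp x - 1 - x)). assert (H6 := Rabs_pos (cos y)). nra. }
  assert (A2 : Rabs ((1 + x) * (cos y - 1)) <= 2 * (eps * m)).
  { rewrite Rabs_mult.
    assert (Rabs (1 + x) <= 2) by (eapply Rle_trans; [apply Rabs_triang|rewrite Rabs_R1; lra]).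
    assert (H5 := Rabs_pos (cos y - 1)). assert (H6 := Rabs_pos (1 + x)). nra. }
  assert (A3 : Rabs (exp x * (sin y - y)) <= 3 * (eps * m)).
  { rewrite Rabs_mult. assert (H5 := Rabs_pos (sin y - y)). assert (H6 := Rabs_pos (exp x)). nra. }
  assert (A4 : Rabs ((exp x - 1 - x + x) * y) <= eps * m).
  { rewrite Rabs_mult. assert (H5 := Rabs_pos y). assert (H7 := Rabs_pos x).
    assert (Rabs (exp x - 1 - x + x) <= eps).
    { eapply Rle_trans; [apply Rabs_triang|]. nra. }
    assert (H6 := Rabs_pos (exp x - 1 - x + x)). nra. }
  eapply Rle_trans; [apply Rplus_le_compat; apply Rabs_triang|].
  assert (0 <= m) by apply Cmod_ge_0. nra.
Qed.

(** The addition formula carries the derivative at 0 to [z]. *)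
Lemma Cdiff_Cexp (z : C) : Cdiff Cexp z (Cexp z).
Proof.
  apply Cdiff_ext_loc with (fun w => Cexp z * Cexp (w - z)).
  { apply Cnear_forall. intros w. rewrite <- Cexp_plus. f_equal; ring. }
  eapply Cdiff_eq.
  - apply (Cdiff_mult (fun _ => Cexp z)); [apply Cdiff_const|].
    apply (Cdiff_comp (fun w => w - z) Cexp).
    + apply (Cdiff_plus (fun w => w) (fun _ => - z)); [apply Cdiff_id|apply Cdiff_const].
    + replace (z - z) with (RtoC 0) by ring. apply Cdiff_Cexp_0.
  - ring.
Qed.

(** The right half-plane is where the logarithm is used: it contains [1 - u] for every [u] in the
    unit disc. *)
Lemma Carg_pos (s : C) : 0 < Re s -> Carg s = atan (Im s / Re s).
Proof. intros Hs. unfold Carg. now destruct (Rlt_dec 0 (Re s)). Qed.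

Lemma Cexp_Clog (s : C) : 0 < Re s -> Cexp (Clog s) = s.
Proof.
  intros Hs. destruct s as [x y]. unfold Cexp, Clog. rewrite Carg_pos by assumption.
  cbn [Re Im fst snd] in *.
  assert (Hm : 0 < Cmod (x, y)).
  { assert (H := re_le_Cmod (x, y)). cbn in H. rewrite Rabs_pos_eq in H; lra. }
  rewrite exp_ln by assumption. rewrite cos_atan, sin_atan.
  assert (E : (sqrt (1 + (y / x)²) = Cmod (x, y) / x)%R).
  { unfold Cmod. cbn [fst snd]. replace (x ^ 2 + y ^ 2)%R with (x ^ 2 * (1 + (y / x)²))%R.
    - rewrite sqrt_mult; [|nra|]; [|assert (0 <= (y / x)²) by apply Rle_0_sqr; lra].
      rewrite sqrt_pow2 by lra. field; lra.
    - unfold Rsqr. field; lra. }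
  rewrite E. f_equal; field; lra.
Qed.

Lemma Ccont_pair (a b : C -> R) (z : C) :
  continuous (T := C_UniformSpace) (U := R_UniformSpace) a z ->
  continuous (T := C_UniformSpace) (U := R_UniformSpace) b z ->
  Ccont (fun w => (a w, b w)) z.
Proof.
  intros Ha Hb. apply Ccont_eps. intros eps He.
  assert (He2 : (0 < eps / 2)%R) by lra.
  assert (Ha' := proj1 (filterlim_locally (U := R_UniformSpace) _ _) Ha (mkposreal _ He2)).
  assert (Hb' := proj1 (filterlim_locally (U := R_UniformSpace) _ _) Hb (mkposreal _ He2)).
  assert (H := filter_and _ _ Ha' Hb').
  (* Passes from neighborhoods of the product structure to those of the modulus. *)
  apply locally_C in H. apply Cnear_elim in H. destruct H as [d [Hd H]].
  exists d. split; [assumption|]. intros w Hw. destruct (H w Hw) as [H1 H2].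
  change (Rabs (a w - a z) < eps / 2)%R in H1. change (Rabs (b w - b z) < eps / 2)%R in H2.
  eapply Rle_lt_trans; [apply Cmod_le_abs|]. cbn in *. unfold Rminus in *. lra.
Qed.

Lemma Ccont_Clog (s : C) : 0 < Re s -> Ccont Clog s.
Proof.
  intros Hs.
  (* Near [s] the logarithm is rewritten without square root or case distinction, so that each
     coordinate is a composition of continuous functions. *)
  apply Ccont_ext_loc with (fun w => ((/ 2 * ln (Re w * Re w + Im w * Im w))%R, atan (Im w / Re w))).
  - apply (Cnear_intro _ (Re s)); [assumption|]. intros [x y] Hw.
    assert (H := re_le_Cmod ((x, y) - s)).
    assert (Hx : 0 < x).
    { destruct s as [u v]. cbn in *. apply Rabs_le_between in H. lra. }
    unfold Clog. rewrite Carg_pos by assumption. cbn [Re Im fst snd].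
    f_equal. unfold Cmod. cbn [fst snd]. replace (x ^ 2 + y ^ 2)%R with (x * x + y * y)%R by ring.
    rewrite <- Rpower_sqrt by nra. unfold Rpower. now rewrite ln_exp.
  - assert (Hf : continuous (T := C_UniformSpace) (U := R_UniformSpace) Re s)
      by apply (continuous_fst (U := R_UniformSpace) (V := R_UniformSpace)).
    assert (Hg : continuous (T := C_UniformSpace) (U := R_UniformSpace) Im s)
      by apply (continuous_snd (U := R_UniformSpace) (V := R_UniformSpace)).
    apply Ccont_pair.
    + apply (continuous_comp (V := R_UniformSpace) (W := R_UniformSpace)
        (fun w : C_UniformSpace => (Re w * Re w + Im w * Im w)%R) (fun t => (/ 2 * ln t)%R)).
      * apply (continuous_plus (K := R_AbsRing) (V := R_NormedModule));
          apply (continuous_mult (K := R_AbsRing)); assumption.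
      * apply (ex_derive_continuous (V := R_NormedModule)). auto_derive. cbn. nra.
    + apply (continuous_comp (V := R_UniformSpace) (W := R_UniformSpace)
        (fun w : C_UniformSpace => (Im w / Re w)%R) atan).
      * apply (continuous_mult (K := R_AbsRing)); [assumption|].
        apply (continuous_comp (V := R_UniformSpace) (W := R_UniformSpace) Re Rinv); [assumption|].
        apply (ex_derive_continuous (V := R_NormedModule)). auto_derive. lra.
      * apply (ex_derive_continuous (V := R_NormedModule)). auto_derive. trivial.
Qed.

(* Inverse function rule in Carathéodory's form: invert the difference quotient of [Cexp]. *)
Lemma Cdiff_Clog (s : C) : 0 < Re s -> Cdiff Clog s (/ s).
Proof.
  intros Hs. assert (Hc := Ccont_Clog s Hs).
  destruct (Cdiff_Cexp (Clog s)) as (q & Hl & Hq & He).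
  rewrite Cexp_Clog in Hl by assumption.
  assert (Hs0 : s <> 0).
  { intros E. rewrite E in Hs. cbn in Hs. lra. }
  assert (Hqc : Ccont (fun w => q (Clog w)) s) by now apply (Ccont_comp Clog q).
  exists (fun w => / q (Clog w)). split; [now rewrite Hl|]. split.
  - apply (Ccont_comp (fun w => q (Clog w)) Cinv); [assumption|]. apply Ccont_inv. now rewrite Hl.
  - assert (N1 : Cnear s (fun w => q (Clog w) <> 0)).
    { apply (Cnear_cont _ _ (fun u => u <> 0) Hqc). apply Cnear_neq. now rewrite Hl. }
    assert (N2 : Cnear s (fun w => 0 < Re w)).
    { apply (Cnear_intro _ (Re s)); [assumption|]. intros w Hw.
      assert (H := re_le_Cmod (w - s)). destruct w, s; cbn in *. apply Rabs_le_between in H. lra. }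
    generalize (Cnear_and _ _ _ N2 (Cnear_and _ _ _ N1 (Cnear_cont _ _ _ Hc He))).
    apply Cnear_imp. intros w (H1 & H2 & H3).
    rewrite !Cexp_Clog in H3 by assumption. rewrite H3 at 3. field; assumption.
Qed.

(** * Complex-valued integrals and the lemma of Goursat *)

Definition Rcont (f : R -> C) (x : R) : Prop :=
  continuous (T := R_UniformSpace) (U := C_UniformSpace) f x.

Definition is_CInt (f : R -> C) (a b : R) (l : C) : Prop :=
  is_RInt (V := C_R_NormedModule) f a b l.

Definition CInt (f : R -> C) (a b : R) : C := RInt (V := C_R_CompleteNormedModule) f a b.

Lemma Rcont_eps (f : R -> C) (x : R) :
  (forall eps, 0 < eps -> exists d, 0 < d /\
    forall y, Rabs (y - x) < d -> Cmod (f y - f x) < eps) -> Rcont f x.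
Proof.
  intros H. apply (filterlim_locally (U := C_UniformSpace)). intros eps.
  destruct (H eps (cond_pos eps)) as [d [Hd Hy]].
  exists (mkposreal _ Hd). intros y Hb. apply C_NormedModule_mixin_compat1.
  apply Hy, Hb.
Qed.

Lemma Rcont_elim (f : R -> C) (x : R) : Rcont f x -> forall eps, 0 < eps ->
  exists d, 0 < d /\ forall y, Rabs (y - x) < d -> Cmod (f y - f x) < eps.
Proof.
  intros H eps He.
  assert (Hb : locally (T := C_UniformSpace) (f x) (fun w => Cmod (w - f x) < eps)).
  { apply locally_C. now apply (Cnear_intro _ eps). }
  destruct (H _ Hb) as [d Hd]. exists d. split; [apply cond_pos|]. intros y Hy. apply Hd, Hy.
Qed.

Lemma Rcont_of_Ccont (f : C -> C) (g : R -> C) (x : R) :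
  (forall y, Cmod (g y - g x) <= Rabs (y - x)) -> Ccont f (g x) -> Rcont (fun t => f (g t)) x.
Proof.
  intros Hg Hf. apply Rcont_eps. intros eps He.
  destruct (proj1 (Ccont_eps f (g x)) Hf eps He) as [d [Hd Hw]].
  exists d. split; [assumption|]. intros y Hy. apply Hw.
  eapply Rle_lt_trans; [apply Hg|assumption].
Qed.

Lemma Rcont_vertical (f : C -> C) (x y : R) : Ccont f (x, y) -> Rcont (fun t => f (x, t)) y.
Proof.
  apply (Rcont_of_Ccont f (fun t => (x, t))). intros t.
  eapply Rle_trans; [apply Cmod_le_abs|]. cbn.
  replace (x + - x)%R with 0%R by ring. rewrite Rabs_R0. unfold Rminus; lra.
Qed.

Lemma Rcont_horizontal (f : C -> C) (x y : R) : Ccont f (x, y) -> Rcont (fun t => f (t, y)) x.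
Proof.
  apply (Rcont_of_Ccont f (fun t => (t, y))). intros t.
  eapply Rle_trans; [apply Cmod_le_abs|]. cbn.
  replace (y + - y)%R with 0%R by ring. rewrite Rabs_R0. unfold Rminus; lra.
Qed.

Lemma Rcont_const (c : C) (x : R) : Rcont (fun _ => c) x.
Proof. apply (continuous_const (U := R_UniformSpace) (V := C_UniformSpace)). Qed.

Lemma Rcont_minus (f g : R -> C) (x : R) :
  Rcont f x -> Rcont g x -> Rcont (fun t => f t - g t) x.
Proof.
  apply (continuous_minus (U := R_UniformSpace) (K := R_AbsRing) (V := C_R_NormedModule)).
Qed.

Lemma Rcont_plus (f g : R -> C) (x : R) :
  Rcont f x -> Rcont g x -> Rcont (fun t => f t + g t) x.
Proof.
  apply (continuous_plus (U := R_UniformSpace) (K := R_AbsRing) (V := C_R_NormedModule)).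
Qed.

Lemma Rcont_components (f : R -> C) (x : R) :
  Rcont f x <-> continuous (fun t => Re (f t)) x /\ continuous (fun t => Im (f t)) x.
Proof.
  split.
  - intros H. split.
    + apply (continuous_comp f (fst : C_UniformSpace -> R_UniformSpace)); [exact H|].
      apply (continuous_fst (U := R_UniformSpace) (V := R_UniformSpace)).
    + apply (continuous_comp f (snd : C_UniformSpace -> R_UniformSpace)); [exact H|].
      apply (continuous_snd (U := R_UniformSpace) (V := R_UniformSpace)).
  - intros [H1 H2]. apply Rcont_eps. intros eps He. assert (He2 : (0 < eps / 2)%R) by lra.
    assert (H1' := proj1 (filterlim_locally (U := R_UniformSpace) _ _) H1 (mkposreal _ He2)).
    assert (H2' := proj1 (filterlim_locally (U := R_UniformSpace) _ _) H2 (mkposreal _ He2)).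
    destruct (filter_and _ _ H1' H2') as [d Hd].
    exists d. split; [apply cond_pos|]. intros y Hy. destruct (Hd y Hy) as [A1 A2].
    change (Rabs (Re (f y) - Re (f x)) < eps / 2)%R in A1.
    change (Rabs (Im (f y) - Im (f x)) < eps / 2)%R in A2.
    eapply Rle_lt_trans; [apply Cmod_le_abs|]. cbn in *. unfold Re, Im, Rminus in *. lra.
Qed.

Lemma Rcont_mult (f g : R -> C) (x : R) :
  Rcont f x -> Rcont g x -> Rcont (fun t => f t * g t) x.
Proof.
  intros Hf Hg. apply Rcont_components in Hf, Hg. destruct Hf as [F1 F2], Hg as [G1 G2].
  apply Rcont_components. unfold Cmult, Re, Im in *; cbn. split.
  - apply (continuous_minus (K := R_AbsRing) (V := R_NormedModule));
      apply (continuous_mult (K := R_AbsRing)); assumption.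
  - apply (continuous_plus (K := R_AbsRing) (V := R_NormedModule));
      apply (continuous_mult (K := R_AbsRing)); assumption.
Qed.

Lemma is_CInt_unique (f : R -> C) (a b : R) (l : C) : is_CInt f a b l -> CInt f a b = l.
Proof. apply (is_RInt_unique (V := C_R_CompleteNormedModule)). Qed.

Lemma CInt_correct (f : R -> C) (a b : R) :
  a <= b -> (forall x, a <= x <= b -> Rcont f x) -> is_CInt f a b (CInt f a b).
Proof.
  intros Hab H. apply (RInt_correct (V := C_R_CompleteNormedModule)).
  apply (ex_RInt_continuous (V := C_R_CompleteNormedModule)). intros x.
  rewrite Rmin_left, Rmax_right by assumption. apply H.
Qed.

Lemma is_CInt_plus (f g : R -> C) (a b : R) (l m : C) :
  is_CInt f a b l -> is_CInt g a b m -> is_CInt (fun t => f t + g t) a b (l + m).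
Proof. apply (is_RInt_plus (V := C_R_NormedModule)). Qed.

Lemma is_CInt_minus (f g : R -> C) (a b : R) (l m : C) :
  is_CInt f a b l -> is_CInt g a b m -> is_CInt (fun t => f t - g t) a b (l - m).
Proof. apply (is_RInt_minus (V := C_R_NormedModule)). Qed.

Lemma is_CInt_const (c : C) (a b : R) : is_CInt (fun _ => c) a b (RtoC (b - a) * c).
Proof.
  replace (RtoC (b - a) * c) with (scal (V := C_R_NormedModule) (b - a)%R c).
  - apply (is_RInt_const (V := C_R_NormedModule)).
  - destruct c as [u v]. apply injective_projections; cbn;
      unfold scal; cbn; unfold mult; cbn; ring.
Qed.

Lemma is_CInt_Chasles (f : R -> C) (a b c : R) (l m : C) :
  is_CInt f a b l -> is_CInt f b c m -> is_CInt f a c (l + m).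
Proof. apply (is_RInt_Chasles (V := C_R_NormedModule)). Qed.

Lemma is_CInt_ext (f g : R -> C) (a b : R) (l : C) :
  a <= b -> (forall x, a < x < b -> f x = g x) -> is_CInt f a b l -> is_CInt g a b l.
Proof.
  intros Hab H. apply (is_RInt_ext (V := C_R_NormedModule)). intros x.
  rewrite Rmin_left, Rmax_right by assumption. apply H.
Qed.

Lemma is_CInt_components (f : R -> C) (a b : R) (l : C) :
  is_CInt f a b l <-> is_RInt (fun t => Re (f t)) a b (Re l) /\
                      is_RInt (fun t => Im (f t)) a b (Im l).
Proof.
  split.
  - intros H. split.
    + apply (is_RInt_fct_extend_fst (U := R_NormedModule) (V := R_NormedModule) f a b l H).
    + apply (is_RInt_fct_extend_snd (U := R_NormedModule) (V := R_NormedModule) f a b l H).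
  - intros [H1 H2]. rewrite (surjective_pairing l).
    apply (is_RInt_fct_extend_pair (U := R_NormedModule) (V := R_NormedModule) f a b _ _ H1 H2).
Qed.

(** [C_R_NormedModule] has only real scalars, so a complex factor is treated on real and imaginary
    parts. *)
Lemma is_CInt_Cmult (f : R -> C) (a b : R) (c l : C) :
  is_CInt f a b l -> is_CInt (fun t => c * f t) a b (c * l).
Proof.
  intros H. apply is_CInt_components in H. destruct H as [H1 H2].
  apply is_CInt_components. unfold Cmult, Re, Im in *; cbn. split.
  - apply (is_RInt_minus (V := R_NormedModule));
      apply (is_RInt_scal (V := R_NormedModule)); assumption.
  - apply (is_RInt_plus (V := R_NormedModule));
      apply (is_RInt_scal (V := R_NormedModule)); assumption.
Qed.

Lemma Cmod_C_R_norm (z : C) : norm (V := C_R_NormedModule) z = Cmod z.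
Proof. symmetry. apply Cmod_norm. Qed.

Lemma is_CInt_bound (f : R -> C) (a b K : R) (l : C) :
  a <= b -> (forall x, a <= x <= b -> Cmod (f x) <= K) -> is_CInt f a b l ->
  Cmod l <= K * (b - a).
Proof.
  intros Hab HK H. rewrite <- Cmod_C_R_norm, Rmult_comm.
  apply (norm_RInt_le_const (V := C_R_NormedModule) f a b); auto.
  intros x Hx. rewrite Cmod_C_R_norm. auto.
Qed.

Lemma CInt_near_const (f : R -> C) (a b K : R) (c : C) :
  a <= b -> (forall x, a <= x <= b -> Rcont f x) ->
  (forall x, a <= x <= b -> Cmod (f x - c) <= K) ->
  Cmod (CInt f a b - RtoC (b - a) * c) <= K * (b - a).
Proof.
  intros Hab Hf HK. apply (is_CInt_bound (fun x => f x - c) a b); auto.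
  apply is_CInt_minus; [now apply CInt_correct|apply is_CInt_const].
Qed.

(** The counterclockwise boundary integral. Opposite sides share one integrand, which is constant
    when [h] is affine. *)
Definition rect_int (h : C -> C) (x x' y y' : R) : C :=
  CInt (fun t => h (t, y) - h (t, y')) x x' + Ci * CInt (fun t => h (x', t) - h (x, t)) y y'.

Lemma nested_intervals (lo hi : nat -> R) :
  (forall n, lo n <= lo (S n)) -> (forall n, hi (S n) <= hi n) -> (forall n, lo n <= hi n) ->
  exists X, forall n, lo n <= X <= hi n.
Proof.
  intros Hlo Hhi Hlh.
  assert (M1 : forall n k, lo n <= lo (n + k)%nat).
  { intros n k. induction k; [rewrite Nat.add_0_r; lra|].
    rewrite Nat.add_succ_r. specialize (Hlo (n + k)%nat). lra. }
  assert (M2 : forall n k, hi (n + k)%nat <= hi n).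
  { intros n k. induction k; [rewrite Nat.add_0_r; lra|].
    rewrite Nat.add_succ_r. specialize (Hhi (n + k)%nat). lra. }
  assert (M : forall n m, lo n <= hi m).
  { intros n m. apply Rle_trans with (lo (n + m)%nat); [apply M1|].
    apply Rle_trans with (hi (n + m)%nat); [apply Hlh|]. rewrite Nat.add_comm. apply M2. }
  destruct (completeness (fun x => exists n, x = lo n)) as [X [H1 H2]].
  - exists (hi O). intros x [n ->]. apply M.
  - now exists (lo O), O.
  - exists X. intros n. split; [apply H1; now exists n|].
    apply H2. intros x [m ->]. apply M.
Qed.

(** * Goursat's lemma on a vertical strip *)

Section Goursat.

Variables (h : C -> C) (al be : R).
Hypothesis h_diff : forall w : C, al < Re w < be -> exists l, Cdiff h w l.

Lemma strip_cont (x y : R) : al < x < be -> Ccont h (x, y).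
Proof. intros H. destruct (h_diff (x, y) H) as [l Hl]. now apply Cdiff_cont in Hl. Qed.

Lemma is_CInt_horizontal (x x' y y' : R) : al < x -> x <= x' -> x' < be ->
  is_CInt (fun t => h (t, y) - h (t, y')) x x' (CInt (fun t => h (t, y) - h (t, y')) x x').
Proof.
  intros H1 H2 H3. apply CInt_correct; [assumption|]. intros t Ht.
  apply Rcont_minus; apply Rcont_horizontal; apply strip_cont; lra.
Qed.

Lemma is_CInt_vertical (x x' y y' : R) : al < x < be -> al < x' < be -> y <= y' ->
  is_CInt (fun t => h (x', t) - h (x, t)) y y' (CInt (fun t => h (x', t) - h (x, t)) y y').
Proof.
  intros H1 H2 H3. apply CInt_correct; [assumption|]. intros t Ht.
  apply Rcont_minus; apply Rcont_vertical; apply strip_cont; lra.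
Qed.

Lemma rect_int_split_x (x m x' y y' : R) : al < x -> x <= m -> m <= x' -> x' < be -> y <= y' ->
  rect_int h x x' y y' = rect_int h x m y y' + rect_int h m x' y y'.
Proof.
  intros. unfold rect_int.
  rewrite (is_CInt_unique (fun t => h (t, y) - h (t, y')) x x' _
    (is_CInt_Chasles _ _ _ _ _ _ (is_CInt_horizontal x m y y' ltac:(lra) ltac:(lra) ltac:(lra))
       (is_CInt_horizontal m x' y y' ltac:(lra) ltac:(lra) ltac:(lra)))).
  rewrite (is_CInt_unique (fun t => h (x', t) - h (x, t)) y y'
    (CInt (fun t => h (m, t) - h (x, t)) y y' + CInt (fun t => h (x', t) - h (m, t)) y y')).
  - ring.
  - apply is_CInt_ext with (fun t => (h (m, t) - h (x, t)) + (h (x', t) - h (m, t)));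
      [assumption|intros; ring|].
    apply is_CInt_plus; apply is_CInt_vertical; lra.
Qed.

Lemma rect_int_split_y (x x' y m y' : R) : al < x -> x <= x' -> x' < be -> y <= m -> m <= y' ->
  rect_int h x x' y y' = rect_int h x x' y m + rect_int h x x' m y'.
Proof.
  intros. unfold rect_int.
  rewrite (is_CInt_unique (fun t => h (x', t) - h (x, t)) y y' _
    (is_CInt_Chasles _ _ _ _ _ _ (is_CInt_vertical x x' y m ltac:(lra) ltac:(lra) ltac:(lra))
       (is_CInt_vertical x x' m y' ltac:(lra) ltac:(lra) ltac:(lra)))).
  rewrite (is_CInt_unique (fun t => h (t, y) - h (t, y')) x x'
    (CInt (fun t => h (t, y) - h (t, m)) x x' + CInt (fun t => h (t, m) - h (t, y')) x x')).
  - ring.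
  - apply is_CInt_ext with (fun t => (h (t, y) - h (t, m)) + (h (t, m) - h (t, y')));
      [assumption|intros; ring|].
    apply is_CInt_plus; apply is_CInt_horizontal; lra.
Qed.

(** The affine part [h p + l * (w - p)] has zero boundary integral. The rest is at most [eps / 2]
    times the distance to [p], which is at most the sum [D] of the two side lengths. *)
Lemma rect_int_small (p l : C) : Cdiff h p l -> forall eps, 0 < eps -> exists d, 0 < d /\
  forall x x' y y', al < x -> x' < be -> x <= Re p <= x' -> y <= Im p <= y' ->
    (x' - x) + (y' - y) < d ->
    Cmod (rect_int h x x' y y') <= eps * ((x' - x) + (y' - y)) ^ 2.
Proof.
  intros (q & Hl & Hq & Hh) eps He.
  destruct (proj1 (Ccont_eps q p) Hq (eps / 2)%R ltac:(lra)) as [d1 [Hd1 H1]].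
  apply Cnear_elim in Hh. destruct Hh as [d2 [Hd2 H2]].
  exists (Rmin d1 d2). split; [now apply Rmin_glb_lt|].
  intros x x' y y' Hx Hx' Px Py HD. set (D := ((x' - x) + (y' - y))%R) in *.
  assert (HD1 : D < d1) by (eapply Rlt_le_trans; [exact HD|apply Rmin_l]).
  assert (HD2 : D < d2) by (eapply Rlt_le_trans; [exact HD|apply Rmin_r]).
  assert (He' : forall u v, x <= u <= x' -> y <= v <= y' ->
    Cmod (h (u, v) - h p - l * ((u, v) - p)) <= eps / 2 * D).
  { intros u v Hu Hv.
    assert (Hw : Cmod ((u, v) - p) <= D).
    { eapply Rle_trans; [apply Cmod_le_abs|]. destruct p as [px py]; cbn in *.
      unfold D. apply Rplus_le_compat; apply Rabs_le; lra. }
    rewrite (H2 (u, v)) by lra.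
    replace (h p + q (u, v) * ((u, v) - p) - h p - l * ((u, v) - p))
      with ((q (u, v) - q p) * ((u, v) - p)) by (rewrite Hl; ring).
    rewrite Cmod_mult. specialize (H1 (u, v) ltac:(lra)).
    apply Rmult_le_compat; try apply Cmod_ge_0; lra. }
  (* Values of the two paired integrands on the affine part; their contributions [(x' - x) * c1] and
     [Ci * (y' - y) * c2] cancel. *)
  set (c1 := l * ((0, y - y')%R : C)). set (c2 := l * RtoC (x' - x)).
  assert (B1 : Cmod (CInt (fun t => h (t, y) - h (t, y')) x x' - RtoC (x' - x) * c1) <= eps * D * (x' - x)).
  { apply CInt_near_const; [lra| |].
    - intros t Ht. apply Rcont_minus; apply Rcont_horizontal; apply strip_cont; lra.
    - intros t Ht.
      replace (h (t, y) - h (t, y') - c1) with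
        ((h (t, y) - h p - l * ((t, y) - p)) - (h (t, y') - h p - l * ((t, y') - p))).
      + eapply Rle_trans; [apply Cmod_triangle|]. rewrite Cmod_opp.
        assert (A1 := He' t y ltac:(lra) ltac:(lra)). assert (A2 := He' t y' ltac:(lra) ltac:(lra)). lra.
      + unfold c1. replace ((0, y - y')%R : C) with (((t, y) : C) - (t, y')).
        * ring.
        * unfold Cminus, Cplus, Copp; cbn. f_equal; ring. }
  assert (B2 : Cmod (CInt (fun t => h (x', t) - h (x, t)) y y' - RtoC (y' - y) * c2) <= eps * D * (y' - y)).
  { apply CInt_near_const; [lra| |].
    - intros t Ht. apply Rcont_minus; apply Rcont_vertical; apply strip_cont; lra.
    - intros t Ht.
      replace (h (x', t) - h (x, t) - c2) with
        ((h (x', t) - h p - l * ((x', t) - p)) - (h (x, t) - h p - l * ((x, t) - p))).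
      + eapply Rle_trans; [apply Cmod_triangle|]. rewrite Cmod_opp.
        assert (A1 := He' x' t ltac:(lra) ltac:(lra)). assert (A2 := He' x t ltac:(lra) ltac:(lra)). lra.
      + unfold c2. replace (RtoC (x' - x)) with (((x', t) : C) - (x, t)).
        * ring.
        * unfold Cminus, Cplus, Copp, RtoC; cbn. f_equal; ring. }
  unfold rect_int.
  set (I1 := CInt (fun t => h (t, y) - h (t, y')) x x') in *.
  set (I2 := CInt (fun t => h (x', t) - h (x, t)) y y') in *.
  replace (I1 + Ci * I2) with ((I1 - RtoC (x' - x) * c1) + Ci * (I2 - RtoC (y' - y) * c2)).
  - eapply Rle_trans; [apply Cmod_triangle|]. rewrite Cmod_mult, Cmod_Ci.
    replace (eps * D ^ 2)%R with (eps * D * (x' - x) + eps * D * (y' - y))%R by (unfold D; ring).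
    lra.
  - unfold c1, c2. replace ((0, y - y')%R : C) with (- Ci * RtoC (y' - y)).
    + ring.
    + unfold Ci, Cmult, Copp, RtoC; cbn. f_equal; ring.
Qed.

Theorem Goursat_rectangle (x0 y0 L M : R) : al < x0 -> x0 + L < be -> 0 < L -> 0 < M ->
  rect_int h x0 (x0 + L) y0 (y0 + M) = 0.
Proof.
  intros Hx0 HL0 HL HM.
  destruct (Ceq_dec (rect_int h x0 (x0 + L) y0 (y0 + M)) 0) as [E|E]; [assumption|exfalso].
  (* Half the modulus, so that the initial rectangle satisfies the strict inequality in [bad]. *)
  apply Cmod_gt_0 in E. set (e := (Cmod (rect_int h x0 (x0 + L) y0 (y0 + M)) / 2)%R).
  assert (He : 0 < e) by (unfold e; lra).
  set (s := fun n : nat => ((/ 2) ^ n)%R).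
  assert (Hs : forall n, 0 < s n) by (intros n; apply pow_lt; lra).
  assert (HsS : forall n, (s (S n) = s n / 2)%R) by (intros n; unfold s; cbn; field).
  (* A rectangle of generation [n] is recorded by its lower left corner, its sides being [s n * L]
     and [s n * M]. The conditions on the abscissa keep it inside the strip. *)
  pose (bad := fun (n : nat) (p : R * R) =>
    x0 <= fst p /\ (fst p + s n * L <= x0 + L)%R /\
    e * s n ^ 2 < Cmod (rect_int h (fst p) (fst p + s n * L) (snd p) (snd p + s n * M))).
  assert (step : forall n p, bad n p -> exists p', bad (S n) p' /\
    fst p <= fst p' /\ (fst p' + s (S n) * L <= fst p + s n * L)%R /\
    snd p <= snd p' /\ (snd p' + s (S n) * M <= snd p + s n * M)%R).
  { intros n [x y] (H1 & H2 & H3). cbn [fst snd] in *.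
    specialize (Hs n). specialize (HsS n). set (t := s n) in *.
    assert (0 < t * L) by nra. assert (0 < t * M) by nra.
    assert (Q : exists x' y', (x' = x \/ x' = x + t / 2 * L)%R /\ (y' = y \/ y' = y + t / 2 * M)%R /\
      e * (t / 2) ^ 2 < Cmod (rect_int h x' (x' + t / 2 * L) y' (y' + t / 2 * M))).
    (* Four quarters with integrals at most [e * (t / 2)^2] would add up to at most [e * t^2],
       contradicting badness. *)
    { apply NNPP. intros Hn.
      assert (Hq : forall x' y', (x' = x \/ x' = x + t / 2 * L)%R -> (y' = y \/ y' = y + t / 2 * M)%R ->
        Cmod (rect_int h x' (x' + t / 2 * L) y' (y' + t / 2 * M)) <= e * (t / 2) ^ 2).
      { intros x' y' Hx' Hy'. apply Rnot_lt_le. intros Hlt. apply Hn. exists x', y'. auto. }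
      rewrite (rect_int_split_x x (x + t / 2 * L)%R) in H3 by lra.
      rewrite (rect_int_split_y x _ y (y + t / 2 * M)%R) in H3 by lra.
      rewrite (rect_int_split_y _ (x + t * L) y (y + t / 2 * M)%R) in H3 by lra.
      assert (Q1 := Hq x y ltac:(auto) ltac:(auto)).
      assert (Q2 := Hq (x + t / 2 * L)%R y ltac:(auto) ltac:(auto)).
      assert (Q3 := Hq x (y + t / 2 * M)%R ltac:(auto) ltac:(auto)).
      assert (Q4 := Hq (x + t / 2 * L)%R (y + t / 2 * M)%R ltac:(auto) ltac:(auto)).
      replace (x + t / 2 * L + t / 2 * L)%R with (x + t * L)%R in * by field.
      replace (y + t / 2 * M + t / 2 * M)%R with (y + t * M)%R in * by field.
      eapply Rlt_not_le; [exact H3|].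
      eapply Rle_trans; [apply Cmod_triangle|].
      eapply Rle_trans; [apply Rplus_le_compat; apply Cmod_triangle|]. lra. }
    destruct Q as (x' & y' & Hx' & Hy' & Hb). exists (x', y').
    unfold bad. cbn [fst snd]. rewrite HsS. fold t.
    repeat split; try assumption; destruct Hx' as [-> | ->]; destruct Hy' as [-> | ->]; lra. }
  assert (init : bad O (x0, y0)).
  { unfold bad, s. cbn [fst snd pow]. rewrite !Rmult_1_l, !Rmult_1_r.
    repeat split; try lra. unfold e. lra. }
  (* Dependent choice: each corner travels with the proof of its badness, from which the next one is
     chosen. *)
  pose (next := fun n (p : {p | bad n p}) =>
    let r := constructive_indefinite_description _ (step n (proj1_sig p) (proj2_sig p)) in
    exist (bad (S n)) (proj1_sig r) (proj1 (proj2_sig r))).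
  pose (u := nat_rect (fun n => {p | bad n p}) (exist _ (x0, y0) init) next).
  pose (c := fun n => proj1_sig (u n)).
  assert (Hbad : forall n, bad n (c n)) by (intros n; apply (proj2_sig (u n))).
  assert (Hc : forall n, fst (c n) <= fst (c (S n)) /\
    (fst (c (S n)) + s (S n) * L <= fst (c n) + s n * L)%R /\
    snd (c n) <= snd (c (S n)) /\ (snd (c (S n)) + s (S n) * M <= snd (c n) + s n * M)%R).
  { intros n. unfold c. cbn [u nat_rect]. unfold next at 1 2 3 4. cbn [proj1_sig].
    exact (proj2 (proj2_sig (constructive_indefinite_description _
      (step n (proj1_sig (u n)) (proj2_sig (u n)))))). }
  destruct (nested_intervals (fun n => fst (c n)) (fun n => (fst (c n) + s n * L)%R)) as [X HX].
  { apply Hc. } { apply Hc. } { intros n. specialize (Hs n). nra. }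
  destruct (nested_intervals (fun n => snd (c n)) (fun n => (snd (c n) + s n * M)%R)) as [Y HY].
  { apply Hc. } { apply Hc. } { intros n. specialize (Hs n). nra. }
  assert (HXr : al < X < be).
  { specialize (HX O). destruct (Hbad O) as (A1 & A2 & _). lra. }
  destruct (h_diff (X, Y) HXr) as [l Hl].
  (* With this tolerance the bound for generation [n] is exactly [e * s n ^ 2], the lower bound in
     [bad]. *)
  destruct (rect_int_small _ _ Hl (e / (L + M) ^ 2)%R) as [d [Hd HQ]].
  { apply Rdiv_lt_0_compat; [assumption|]. apply pow_lt; lra. }
  destruct (pow_lt_1_zero (/ 2) ltac:(rewrite Rabs_pos_eq; lra) (d / (L + M))%R) as [n Hn].
  { apply Rdiv_lt_0_compat; lra. }
  specialize (Hn n (le_n n)). fold (s n) in Hn. specialize (Hs n).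
  rewrite Rabs_pos_eq in Hn by lra.
  destruct (Hbad n) as (A1 & A2 & A3). specialize (HX n). specialize (HY n).
  specialize (HQ (fst (c n)) (fst (c n) + s n * L)%R (snd (c n)) (snd (c n) + s n * M)%R
    ltac:(lra) ltac:(lra) HX HY).
  replace (fst (c n) + s n * L - fst (c n) + (snd (c n) + s n * M - snd (c n)))%R
    with (s n * (L + M))%R in HQ by ring.
  assert (s n * (L + M) < d)%R.
  { apply (Rmult_lt_reg_r (/ (L + M))); [apply Rinv_0_lt_compat; lra|].
    rewrite Rmult_assoc, Rinv_r by lra. unfold Rdiv in Hn. lra. }
  specialize (HQ ltac:(assumption)).
  replace (e / (L + M) ^ 2 * (s n * (L + M)) ^ 2)%R with (e * s n ^ 2)%R in HQ by (field; lra).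
  lra.
Qed.

(* The horizontal sides of the rectangle cancel by periodicity. *)
Corollary vertical_mean_constant (x x' M : R) : al < x < be -> al < x' < be -> 0 < M ->
  (forall t, h (t, M) = h (t, 0%R)) ->
  CInt (fun t => h (x, t)) 0 M = CInt (fun t => h (x', t)) 0 M.
Proof.
  intros Hx Hx' HM Hper.
  assert (K : forall u v, al < u < be -> al < v < be -> u < v ->
    CInt (fun t => h (u, t)) 0 M = CInt (fun t => h (v, t)) 0 M).
  { intros u v Hu Hv Huv.
    assert (E := Goursat_rectangle u 0 (v - u) M ltac:(lra) ltac:(lra) ltac:(lra) ltac:(lra)).
    replace (u + (v - u))%R with v in E by ring. rewrite Rplus_0_l in E. unfold rect_int in E.
    rewrite (is_CInt_unique (fun t => h (t, 0%R) - h (t, M)) u v 0) in E.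
    - rewrite (is_CInt_unique (fun t => h (v, t) - h (u, t)) 0 M
        (CInt (fun t => h (v, t)) 0 M - CInt (fun t => h (u, t)) 0 M)) in E.
      + set (a := CInt (fun t => h (u, t)) 0 M) in *. set (b := CInt (fun t => h (v, t)) 0 M) in *.
        assert (E' : Ci * (b - a) = 0) by (rewrite <- E; ring).
        assert (Hi : Ci <> 0) by (apply Cmod_gt_0; rewrite Cmod_Ci; lra).
        replace a with (b - / Ci * (Ci * (b - a))) by (field; assumption).
        rewrite E'. ring.
      + apply is_CInt_minus; apply CInt_correct; try lra; intros t Ht;
          apply Rcont_vertical; apply strip_cont; lra.
    - apply is_CInt_ext with (fun _ => 0); [lra| |].
      + intros t _. rewrite Hper. ring.
      + assert (H0 := is_CInt_const 0 u v).
        now replace (RtoC (v - u) * 0) with (RtoC 0) in H0 by ring. }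
  destruct (Rtotal_order x x') as [H|[H|H]].
  - now apply K.
  - now subst.
  - symmetry. now apply K.
Qed.

End Goursat.

(** * Cauchy theory on the unit disc *)

(** The circle has radius [exp x] and the measure is the angle. This is the contour integral of
    [k u / (i u)], which is why Cauchy's kernel appears below as [u / (u - v)]. *)
Definition circle_int (k : C -> C) (x : R) : C := CInt (fun t => k (Cexp (x, t))) 0 (2 * PI).

Lemma Rcont_circle (k : C -> C) (x t : R) :
  Ccont k (Cexp (x, t)) -> Rcont (fun t => k (Cexp (x, t))) t.
Proof.
  intros H. apply (Rcont_vertical (fun w => k (Cexp w))).
  apply (Ccont_comp Cexp k); [|assumption]. eapply Cdiff_cont, Cdiff_Cexp.
Qed.

Lemma is_CInt_circle (k : C -> C) (x : R) :
  (forall u, Cmod u = exp x -> Ccont k u) ->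
  is_CInt (fun t => k (Cexp (x, t))) 0 (2 * PI) (circle_int k x).
Proof.
  intros H. assert (HP := PI_RGT_0). apply CInt_correct; [lra|]. intros t _.
  apply Rcont_circle, H. now rewrite Cmod_Cexp.
Qed.

Lemma circle_int_near_const (k : C -> C) (x K : R) (c : C) :
  (forall u, Cmod u = exp x -> Ccont k u) ->
  (forall u, Cmod u = exp x -> Cmod (k u - c) <= K) ->
  Cmod (circle_int k x - RtoC (2 * PI) * c) <= K * (2 * PI).
Proof.
  intros Hk HK. assert (HP := PI_RGT_0).
  replace (2 * PI)%R with (2 * PI - 0)%R at 1 2 by ring.
  apply CInt_near_const; [lra| |].
  - intros t _. apply Rcont_circle, Hk. now rewrite Cmod_Cexp.
  - intros t _. apply HK. now rewrite Cmod_Cexp.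
Qed.

Lemma circle_int_ext (k m : C -> C) (x : R) :
  (forall u, Cmod u = exp x -> k u = m u) -> circle_int k x = circle_int m x.
Proof.
  intros H. apply (RInt_ext (V := C_R_CompleteNormedModule)). intros t _.
  apply H. now rewrite Cmod_Cexp.
Qed.

Lemma circle_int_plus (k m : C -> C) (x : R) :
  (forall u, Cmod u = exp x -> Ccont k u) -> (forall u, Cmod u = exp x -> Ccont m u) ->
  circle_int (fun u => k u + m u) x = circle_int k x + circle_int m x.
Proof.
  intros Hk Hm. apply is_CInt_unique. apply is_CInt_plus; now apply is_CInt_circle.
Qed.

Lemma circle_int_Cmult (c : C) (k : C -> C) (x : R) :
  (forall u, Cmod u = exp x -> Ccont k u) ->
  circle_int (fun u => c * k u) x = c * circle_int k x.
Proof. intros Hk. apply is_CInt_unique. apply is_CInt_Cmult; now apply is_CInt_circle. Qed.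

Lemma circle_int_constant (k : C -> C) (al be x x' : R) :
  (forall u, exp al < Cmod u < exp be -> exists l, Cdiff k u l) ->
  al < x < be -> al < x' < be -> circle_int k x = circle_int k x'.
Proof.
  intros Hk Hx Hx'. assert (HP := PI_RGT_0).
  apply (vertical_mean_constant (fun w => k (Cexp w)) al be); try assumption; [|lra|].
  - intros w Hw. destruct (Hk (Cexp w)) as [l Hl].
    + rewrite Cmod_Cexp. split; apply exp_increasing; lra.
    + eexists. apply (Cdiff_comp Cexp k); [apply Cdiff_Cexp|exact Hl].
  - intros t. unfold Cexp; cbn [Re Im fst snd]. now rewrite cos_2PI, sin_2PI, cos_0, sin_0.
Qed.

Lemma Ceq_of_Cmod_le (a b : C) (K : R) :
  (forall eps, 0 < eps -> Cmod (a - b) <= K * eps) -> a = b.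
Proof.
  intros H. apply Ceq_minus, Cmod_eq_0. apply Rle_antisym; [|apply Cmod_ge_0].
  (* The instance [eps = 1] forces [K] to be positive if [a] and [b] differ, so that [2 * K] may be
     divided by. *)
  apply Rnot_lt_le. intros Hlt. assert (H1 := H 1%R ltac:(lra)).
  assert (HK : 0 < K) by lra.
  assert (H2 := H (Cmod (a - b) / (2 * K))%R ltac:(apply Rdiv_lt_0_compat; lra)).
  replace (K * (Cmod (a - b) / (2 * K)))%R with (Cmod (a - b) / 2)%R in H2 by (field; lra).
  lra.
Qed.

(** The integral does not depend on the radius, and on small circles continuity at 0 brings it close
    to that of the constant [k 0]. *)
Lemma circle_int_center (k : C -> C) (be x : R) :
  (forall u, 0 < Cmod u < exp be -> exists l, Cdiff k u l) -> Ccont k 0 -> x < be ->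
  circle_int k x = RtoC (2 * PI) * k 0.
Proof.
  intros Hk H0 Hx. apply Ceq_of_Cmod_le with (2 * PI)%R. intros eps He.
  destruct (proj1 (Ccont_eps k 0) H0 eps He) as [d [Hd Hw]].
  set (y := Rmin x (ln (d / 2))).
  assert (Hy1 : y <= x) by apply Rmin_l.
  assert (Hy2 : exp y < d).
  { apply Rle_lt_trans with (exp (ln (d / 2))).
    - assert (H : y <= ln (d / 2)) by apply Rmin_r.
      destruct H as [H|H]; [left; now apply exp_increasing|rewrite H; lra].
    - rewrite exp_ln; lra. }
  rewrite (circle_int_constant k (y - 1) be x y); [|intros u [Hu1 Hu2]|lra|lra].
  - rewrite (Rmult_comm (2 * PI) eps). apply circle_int_near_const.
    + intros u Hu. destruct (Hk u) as [l Hl]; [|now apply Cdiff_cont in Hl].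
      rewrite Hu. split; [apply exp_pos|apply exp_increasing; lra].
    + intros u Hu. left. apply Hw. replace (u - 0) with u by ring. now rewrite Hu.
  - apply Hk. split; [|assumption]. eapply Rlt_trans; [apply exp_pos|exact Hu1].
Qed.

(* Uniform continuity across the segment, from the Lebesgue number of a cover. *)
Lemma Ccont_uniform_vertical (h : C -> C) (x0 a b : R) :
  (forall t, a <= t <= b -> Ccont h (x0, t)) ->
  forall eps, 0 < eps -> exists d, 0 < d /\
    forall x t, Rabs (x - x0) < d -> a <= t <= b -> Cmod (h (x, t) - h (x0, t)) < eps.
Proof.
  intros Hh eps He.
  assert (HD : forall t, exists d, 0 < d /\ (a <= t <= b -> forall x s,
    Rabs (x - x0) < d -> Rabs (s - t) < d -> Cmod (h (x, s) - h (x0, t)) < eps / 2)).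
  (* Outside [[a, b]] the claim is vacuous and the radius 1 is a default. *)
  { intros t. destruct (Rle_dec a t) as [Ha|Ha]; [destruct (Rle_dec t b) as [Hb|Hb]|];
      try (exists 1%R; split; [lra|]; intros; lra).
    destruct (proj1 (Ccont_eps h (x0, t)) (Hh t (conj Ha Hb)) (eps / 2)%R ltac:(lra)) as [d [Hd Hw]].
    exists (d / 2)%R. split; [lra|]. intros _ x s Hx Hs. apply Hw.
    eapply Rle_lt_trans; [apply Cmod_le_abs|]. cbn. unfold Rminus in *. lra. }
  pose (dl := fun t => let r := constructive_indefinite_description _ (HD t) in
    mkposreal (proj1_sig r) (proj1 (proj2_sig r))).
  assert (Hdl : forall t, a <= t <= b -> forall x s,
    Rabs (x - x0) < dl t -> Rabs (s - t) < dl t -> Cmod (h (x, s) - h (x0, t)) < eps / 2).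
  { intros t. exact (proj2 (proj2_sig (constructive_indefinite_description _ (HD t)))). }
  (* The center [s] of the covering interval comes under a double negation, hence the argument by
     contradiction. Both values are then compared with [h (x0, s)]. *)
  destruct (compactness_value_1d a b dl) as [d Hd].
  exists d. split; [apply cond_pos|]. intros x t Hx Ht. apply NNPP. intros Hn.
  apply (Hd t Ht). intros (s & Hs & H1 & H2). apply Hn.
  assert (A1 := Hdl s Hs x t ltac:(lra) H1).
  assert (A2 := Hdl s Hs x0 t ltac:(rewrite Rminus_diag, Rabs_R0; apply cond_pos) H1).
  replace (h (x, t) - h (x0, t)) with ((h (x, t) - h (x0, s)) - (h (x0, t) - h (x0, s))) by ring.
  eapply Rle_lt_trans; [apply Cmod_triangle|]. rewrite Cmod_opp. lra.
Qed.

Lemma circle_int_continuous (k : C -> C) (x0 be : R) : x0 < be ->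
  (forall u, Cmod u < exp be -> Ccont k u) ->
  forall eps, 0 < eps -> exists d, 0 < d /\ forall x, Rabs (x - x0) < d -> x < be ->
    Cmod (circle_int k x - circle_int k x0) <= eps * (2 * PI).
Proof.
  intros Hx0 Hk eps He. assert (HP := PI_RGT_0).
  destruct (Ccont_uniform_vertical (fun w => k (Cexp w)) x0 0 (2 * PI)) with (eps := eps) as [d [Hd Hw]].
  - intros t _. apply (Ccont_comp Cexp k); [eapply Cdiff_cont, Cdiff_Cexp|].
    apply Hk. rewrite Cmod_Cexp. now apply exp_increasing.
  - assumption.
  - exists d. split; [assumption|]. intros x Hx Hxb.
    replace (2 * PI)%R with (2 * PI - 0)%R by ring.
    apply is_CInt_bound with (fun t => k (Cexp (x, t)) - k (Cexp (x0, t))); [lra| |].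
    + intros t Ht. left. now apply Hw.
    + apply is_CInt_minus; apply is_CInt_circle; intros u Hu; apply Hk; rewrite Hu;
        apply exp_increasing; assumption.
Qed.

(* A singularity of [k] at [v] is harmless when [k] is continuous there: the circle integrals
   are constant on either side of [|u| = |v|] and continuous across. *)
Lemma circle_int_removable (k : C -> C) (v : C) (be x : R) :
  (forall u, 0 < Cmod u < exp be -> u <> v -> exists l, Cdiff k u l) ->
  (forall u, Cmod u < exp be -> Ccont k u) -> 0 < Cmod v -> ln (Cmod v) < x < be ->
  circle_int k x = RtoC (2 * PI) * k 0.
Proof.
  intros Hk Hc Hv Hx. set (x0 := ln (Cmod v)) in *.
  assert (Ev : exp x0 = Cmod v) by now apply exp_ln.
  assert (L : forall y, y < x0 -> circle_int k y = RtoC (2 * PI) * k 0).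
  { intros y Hy. apply circle_int_center with x0; [|apply Hc; rewrite Cmod_0; apply exp_pos|assumption].
    intros u Hu. apply Hk; [|intros E; subst u; lra].
    split; [lra|]. eapply Rlt_trans; [apply Hu|apply exp_increasing; lra]. }
  assert (Rr : forall y, x0 < y < be -> circle_int k x = circle_int k y).
  { intros y Hy. apply circle_int_constant with x0 be; try lra.
    intros u Hu. apply Hk; [|intros E; subst u; lra]. split; [|lra].
    eapply Rlt_trans; [apply exp_pos|apply Hu]. }
  apply Ceq_of_Cmod_le with (2 * PI * 2)%R. intros eps He.
  destruct (circle_int_continuous k x0 be ltac:(lra) Hc eps He) as [d [Hd Hw]].
  set (y1 := (x0 - d / 2)%R). set (y2 := Rmin (x0 + d / 2) ((x0 + be) / 2)).
  assert (B1 : y2 <= x0 + d / 2) by apply Rmin_l.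
  assert (B2 : y2 <= (x0 + be) / 2) by apply Rmin_r.
  assert (B3 : x0 < y2) by (apply Rmin_glb_lt; lra).
  rewrite (Rr y2) by lra. rewrite <- (L y1) by (unfold y1; lra).
  assert (A1 := Hw y1 ltac:(unfold y1; rewrite Rabs_left; lra) ltac:(unfold y1; lra)).
  assert (A2 := Hw y2 ltac:(rewrite Rabs_pos_eq; lra) ltac:(lra)).
  replace (circle_int k y2 - circle_int k y1) with
    ((circle_int k y2 - circle_int k x0) - (circle_int k y1 - circle_int k x0)) by ring.
  eapply Rle_trans; [apply Cmod_triangle|]. rewrite Cmod_opp. lra.
Qed.

Lemma Cdiff_sub_const (v u : C) : Cdiff (fun w => w - v) u 1.
Proof.
  eapply Cdiff_eq; [apply (Cdiff_plus (fun w => w) (fun _ => - v));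
    [apply Cdiff_id|apply Cdiff_const]|ring].
Qed.

Lemma Cdiff_kernel (v u : C) : u <> v -> exists l, Cdiff (fun w => w / (w - v)) u l.
Proof.
  intros Huv. eexists. apply (Cdiff_mult (fun w => w)); [apply Cdiff_id|].
  apply (Cdiff_comp (fun w => w - v) Cinv); [apply Cdiff_sub_const|].
  apply Cdiff_inv. intros E. apply Huv. now apply Ceq_minus.
Qed.

Lemma neq_of_Cmod_lt (u v : C) : Cmod v < Cmod u -> u <> v.
Proof. intros H E. subst. lra. Qed.

(* The kernel tends to 1 at infinity, and its circle integral does not depend on the radius. *)
Lemma circle_int_kernel (v : C) (x : R) : 0 < Cmod v -> ln (Cmod v) < x ->
  circle_int (fun u => u / (u - v)) x = RtoC (2 * PI).
Proof.
  intros Hv Hx. set (m := Cmod v) in *.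
  apply Ceq_of_Cmod_le with (2 * PI)%R. intros eps He.
  set (y := Rmax x (ln (m + m / eps))).
  assert (Hy1 : x <= y) by apply Rmax_l.
  assert (Hme : 0 < m / eps) by now apply Rdiv_lt_0_compat.
  assert (Hy2 : m + m / eps <= exp y).
  { rewrite <- (exp_ln (m + m / eps)) by lra.
    assert (H : ln (m + m / eps) <= y) by apply Rmax_r.
    destruct H as [H|H]; [left; now apply exp_increasing|rewrite H; lra]. }
  assert (Em : exp (ln m) = m) by now apply exp_ln.
  rewrite (circle_int_constant _ (ln m) (y + 1) x y); [|intros u [Hu1 Hu2]|lra|lra].
  - rewrite (Rmult_comm (2 * PI)). replace (RtoC (2 * PI)) with (RtoC (2 * PI) * 1) by ring.
    apply circle_int_near_const; intros u Hu.
    + destruct (Cdiff_kernel v u) as [l Hl]; [|now apply Cdiff_cont in Hl].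
      apply neq_of_Cmod_lt. fold m. lra.
    + assert (Huv : u - v <> 0).
      { intros E. apply Ceq_minus in E. revert E. apply neq_of_Cmod_lt. fold m. lra. }
      replace (u / (u - v) - 1) with (v / (u - v)) by (field; assumption).
      rewrite Cmod_div by assumption. fold m.
      assert (H := Cmod_triangle_rev u v). fold m in H. rewrite Hu in H.
      apply (Rmult_le_reg_r (Cmod (u - v))); [lra|].
      unfold Rdiv. rewrite Rmult_assoc, Rinv_l by lra.
      replace (m * 1)%R with (eps * (m / eps))%R by (field; lra).
      apply Rmult_le_compat_l; lra.
  - apply Cdiff_kernel. apply neq_of_Cmod_lt. fold m. lra.
Qed.

Lemma Rcont_bounded (g : R -> C) (a b : R) : a <= b ->
  (forall t, a <= t <= b -> Rcont g t) -> exists M, forall t, a <= t <= b -> Cmod (g t) <= M.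
Proof.
  intros Hab Hg.
  destruct (continuity_ab_maj (fun t => Cmod (g t)) a b Hab) as [t0 [Ht0 _]].
  - intros t Ht. apply continuity_pt_filterlim.
    apply (continuous_ext (T := R_UniformSpace) (U := R_UniformSpace)
      (fun t => norm (V := C_R_NormedModule) (g t))); [intros; apply Cmod_C_R_norm|].
    apply (continuous_comp (V := C_UniformSpace) g (norm (V := C_R_NormedModule))); [now apply Hg|].
    apply (filterlim_norm (V := C_R_NormedModule)).
  - exists (Cmod (g t0)). exact Ht0.
Qed.

Lemma Csum_Sn (a : nat -> C) (n : nat) :
  sum_n (G := C_AbelianMonoid) a (S n) = sum_n (G := C_AbelianMonoid) a n + a (S n).
Proof. apply (sum_Sn (G := C_AbelianMonoid)). Qed.

Lemma two_PI_neq_0 : RtoC (2 * PI) <> 0.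
Proof. intros E. assert (H := PI_RGT_0). injection E. lra. Qed.

Lemma Cdiff_pow_inv (n : nat) (u : C) : u <> 0 -> exists l, Cdiff (fun w => (/ w) ^ n) u l.
Proof.
  intros Hu. induction n as [|n [l Hl]]; cbn.
  - eexists. apply Cdiff_const.
  - eexists. apply (Cdiff_mult Cinv); [now apply Cdiff_inv|exact Hl].
Qed.

Lemma exp_lt_1 (x : R) : x < 0 -> exp x < 1.
Proof. intros H. rewrite <- exp_0. now apply exp_increasing. Qed.

Lemma Cmod_pow_inv (u : C) (n : nat) : u <> 0 -> Cmod ((/ u) ^ n) = (/ Cmod u ^ n)%R.
Proof. intros Hu. now rewrite Cmod_pow, Cmod_inv, pow_inv. Qed.

(** Geometric sum in [v / u] with its exact remainder, so that no limit has to be exchanged with an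
    integral. *)
Lemma kernel_expansion (u v : C) (n : nat) : u <> 0 -> u <> v ->
  u / (u - v) = sum_n (fun i => v ^ i * (/ u) ^ i) n + (v * / u) ^ S n * (u / (u - v)).
Proof.
  intros Hu Huv. assert (H : u - v <> 0) by (intros E; apply Huv; now apply Ceq_minus).
  induction n as [|n IH].
  - rewrite sum_O. cbn. field. auto.
  - rewrite Csum_Sn. rewrite IH at 1.
    rewrite <- Cpow_mult_l. change ((v * / u) ^ S (S n)) with (v * / u * (v * / u) ^ S n).
    generalize ((v * / u) ^ S n). intros P.
    replace (u / (u - v)) with (1 + v * / u * (u / (u - v))) at 1 by (field; auto).
    ring.
Qed.

(** * Cauchy's formula, Cauchy's estimate and the Taylor expansion *)

Section Cauchy.

Variable f : C -> C.
Hypothesis f_diff : forall u, Cmod u < 1 -> exists l, Cdiff f u l.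

Lemma disc_cont (u : C) : Cmod u < 1 -> Ccont f u.
Proof. intros Hu. destruct (f_diff u Hu) as [l Hl]. now apply Cdiff_cont in Hl. Qed.

(** Read on the circle of radius [exp (-1)]; every radius below 1 gives the same value. *)
Definition taylor_coef (n : nat) : C :=
  / RtoC (2 * PI) * circle_int (fun u => f u * (/ u) ^ n) (-1).

Lemma taylor_coef_circle (n : nat) (x : R) : x < 0 ->
  circle_int (fun u => f u * (/ u) ^ n) x = RtoC (2 * PI) * taylor_coef n.
Proof.
  intros Hx. unfold taylor_coef. rewrite Cmult_assoc, Cinv_r by apply two_PI_neq_0.
  rewrite Cmult_1_l. apply circle_int_constant with (Rmin x (-1) - 1)%R 0%R.
  - intros u [Hu1 Hu2]. rewrite exp_0 in Hu2. destruct (f_diff u Hu2) as [l Hl].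
    destruct (Cdiff_pow_inv n u) as [m Hm].
    { apply Cmod_gt_0. eapply Rlt_trans; [apply exp_pos|exact Hu1]. }
    eexists. apply Cdiff_mult; [exact Hl|exact Hm].
  - assert (H := Rmin_l x (-1)). lra.
  - assert (H := Rmin_r x (-1)). lra.
Qed.

Theorem Cauchy_estimate (n : nat) (r M : R) : 0 < r < 1 ->
  (forall u, Cmod u = r -> Cmod (f u) <= M) -> Cmod (taylor_coef n) * r ^ n <= M.
Proof.
  intros Hr HM. assert (HP := PI_RGT_0). assert (Er : exp (ln r) = r) by (apply exp_ln; lra).
  assert (Hx : ln r < 0) by (rewrite <- ln_1; apply ln_increasing; lra).
  assert (Hrn : 0 < r ^ n) by (apply pow_lt; lra).
  assert (H : Cmod (circle_int (fun u => f u * (/ u) ^ n) (ln r) - RtoC (2 * PI) * 0)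
    <= M / r ^ n * (2 * PI)).
  { apply circle_int_near_const; intros u Hu; rewrite Er in Hu.
    - assert (Hu0 : u <> 0) by (apply Cmod_gt_0; lra).
      apply Ccont_mult; [apply disc_cont; lra|].
      destruct (Cdiff_pow_inv n u Hu0) as [m Hm]. now apply Cdiff_cont in Hm.
    - assert (Hu0 : u <> 0) by (apply Cmod_gt_0; lra).
      replace (f u * (/ u) ^ n - 0) with (f u * (/ u) ^ n) by ring.
      rewrite Cmod_mult, Cmod_pow_inv, Hu by assumption.
      apply Rmult_le_compat_r; [left; now apply Rinv_0_lt_compat|]. now apply HM. }
  rewrite taylor_coef_circle in H by assumption.
  replace (RtoC (2 * PI) * taylor_coef n - RtoC (2 * PI) * 0)
    with (RtoC (2 * PI) * taylor_coef n) in H by ring.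
  rewrite Cmod_mult, Cmod_R, Rabs_pos_eq in H by lra.
  apply (Rmult_le_reg_l (2 * PI)); [lra|].
  apply (Rmult_le_compat_r (r ^ n)) in H; [|lra].
  replace (M / r ^ n * (2 * PI) * r ^ n)%R with (2 * PI * M)%R in H by (field; lra). lra.
Qed.

(** Subtracting [f v] leaves a removable singularity at [v] and a factor [u] that vanishes at 0, so
    the difference integrates to 0; the kernel accounts for the rest. *)
Lemma Cauchy_formula (v : C) (x : R) : 0 < Cmod v -> ln (Cmod v) < x < 0 ->
  circle_int (fun u => f u * (u / (u - v))) x = RtoC (2 * PI) * f v.
Proof.
  intros Hv Hx. assert (Ev : exp (ln (Cmod v)) = Cmod v) by now apply exp_ln.
  assert (Hv1 : Cmod v < 1) by (rewrite <- Ev; apply exp_lt_1; lra).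
  assert (Hvx : Cmod v < exp x) by (rewrite <- Ev; apply exp_increasing; lra).
  assert (Hx1 := exp_lt_1 x ltac:(lra)).
  destruct (f_diff v Hv1) as [l (q & Hl & Hq & Hf)].
  (* The value [l * v] is the limit of the quotient at [v]. *)
  pose (k := fun u => if Ceq_dec u v then l * v else (f u - f v) * (u / (u - v))).
  assert (Kd : forall u, Cmod u < 1 -> u <> v -> exists m, Cdiff k u m).
  { intros u Hu Huv. destruct (f_diff u Hu) as [m1 H1]. destruct (Cdiff_kernel v u Huv) as [m2 H2].
    eexists. apply Cdiff_ext_loc with (fun u => (f u - f v) * (u / (u - v))).
    - apply Cnear_imp with (2 := Cnear_neq _ _ Huv). intros w Hw. unfold k.
      destruct (Ceq_dec w v); [contradiction|reflexivity].
    - apply Cdiff_mult; [|exact H2].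
      apply (Cdiff_plus f (fun _ => - f v)); [exact H1|apply Cdiff_const]. }
  assert (Kc : forall u, Cmod u < 1 -> Ccont k u).
  { intros u Hu. destruct (Ceq_dec u v) as [->|Huv].
    (* Carathéodory's quotient [q] at [v] gives [k] without division, including at [v] itself. *)
    - apply Ccont_ext_loc with (fun u => q u * u).
      + apply Cnear_imp with (2 := Hf). intros w Hw. unfold k.
        destruct (Ceq_dec w v) as [->|E]; [now rewrite Hl|].
        rewrite Hw. field. intros E1. apply E. now apply Ceq_minus.
      + apply Ccont_mult; [assumption|apply Ccont_id].
    - destruct (Kd u Hu Huv) as [m Hm]. now apply Cdiff_cont in Hm. }
  assert (Hk : circle_int k x = RtoC (2 * PI) * k 0).
  { apply circle_int_removable with v 0%R; rewrite ?exp_0; auto. intros u Hu. now apply Kd. }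
  assert (Hk0 : k 0 = 0).
  { unfold k. destruct (Ceq_dec 0 v) as [E|E]; [rewrite <- E; ring|].
    unfold Cdiv. rewrite Cmult_0_l. ring. }
  rewrite Hk0, Cmult_0_r in Hk.
  assert (Hker : forall u, Cmod u = exp x -> Ccont (fun u => u / (u - v)) u).
  { intros u Hu. destruct (Cdiff_kernel v u) as [m Hm]; [apply neq_of_Cmod_lt; lra|].
    now apply Cdiff_cont in Hm. }
  rewrite (circle_int_ext _ (fun u => k u + f v * (u / (u - v)))).
  - rewrite circle_int_plus, Hk, circle_int_Cmult, circle_int_kernel; try assumption; try lra.
    + ring.
    + intros u Hu. apply Kc. lra.
    + intros u Hu. apply Ccont_mult; [apply Ccont_const|now apply Hker].
  - intros u Hu. unfold k. destruct (Ceq_dec u v) as [E|E]; [subst u; lra|]. ring.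
Qed.

Lemma circle_int_taylor_sum (v : C) (x : R) (n : nat) : x < 0 ->
  circle_int (fun u => f u * sum_n (fun i => v ^ i * (/ u) ^ i) n) x
  = RtoC (2 * PI) * sum_n (fun i => taylor_coef i * v ^ i) n.
Proof.
  intros Hx. assert (Hx1 := exp_lt_1 x Hx). assert (Hx2 := exp_pos x).
  assert (Hc : forall i u, Cmod u = exp x -> Ccont (fun u => f u * (/ u) ^ i) u).
  { intros i u Hu. apply Ccont_mult; [apply disc_cont; lra|].
    destruct (Cdiff_pow_inv i u) as [m Hm]; [apply Cmod_gt_0; lra|]. now apply Cdiff_cont in Hm. }
  (* Continuity is proved along with the value because additivity of the integral asks for it at
     each step. *)
  assert (K : forall n, (forall u, Cmod u = exp x ->
      Ccont (fun u => f u * sum_n (fun i => v ^ i * (/ u) ^ i) n) u) /\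
    circle_int (fun u => f u * sum_n (fun i => v ^ i * (/ u) ^ i) n) x
    = RtoC (2 * PI) * sum_n (fun i => taylor_coef i * v ^ i) n); [clear n|apply K].
  induction n as [|n [IH1 IH2]].
  - assert (E : forall u, v ^ 0 * (f u * (/ u) ^ 0) = f u * sum_n (fun i => v ^ i * (/ u) ^ i) 0).
    { intros u. rewrite sum_O. ring. }
    split.
    + intros u Hu. eapply Ccont_ext_loc; [apply Cnear_forall, E|].
      apply Ccont_mult; [apply Ccont_const|now apply Hc].
    + rewrite <- (circle_int_ext _ _ _ (fun u _ => E u)).
      rewrite circle_int_Cmult by apply Hc.
      rewrite taylor_coef_circle, sum_O by assumption. ring.
  - assert (E : forall u, f u * sum_n (fun i => v ^ i * (/ u) ^ i) n + v ^ S n * (f u * (/ u) ^ S n)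
      = f u * sum_n (fun i => v ^ i * (/ u) ^ i) (S n)).
    { intros u. rewrite Csum_Sn. ring. }
    split.
    + intros u Hu. eapply Ccont_ext_loc; [apply Cnear_forall, E|].
      apply Ccont_plus; [now apply IH1|]. apply Ccont_mult; [apply Ccont_const|now apply Hc].
    + rewrite <- (circle_int_ext _ _ _ (fun u _ => E u)).
      rewrite circle_int_plus; [|exact IH1|].
      * rewrite circle_int_Cmult by apply Hc.
        rewrite taylor_coef_circle, IH2, Csum_Sn by assumption. ring.
      * intros u Hu. apply Ccont_mult; [apply Ccont_const|now apply Hc].
Qed.

Lemma taylor_coef_0 : taylor_coef 0 = f 0.
Proof.
  assert (H := taylor_coef_circle 0 (-1) ltac:(lra)).
  rewrite (circle_int_ext _ f) in H by (intros; cbn; ring).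
  rewrite (circle_int_center f 0 (-1)) in H.
  - replace (taylor_coef 0) with (/ RtoC (2 * PI) * (RtoC (2 * PI) * taylor_coef 0))
      by (field; apply two_PI_neq_0).
    rewrite <- H. field. apply two_PI_neq_0.
  - intros u Hu. apply f_diff. rewrite exp_0 in Hu. lra.
  - apply disc_cont. rewrite Cmod_0. lra.
  - lra.
Qed.

(** On a circle of radius [r] between [|v|] and 1, the remainder of the expanded kernel is of order
    [(|v| / r)^(n + 1)]. *)
Theorem taylor_converges (v : C) : Cmod v < 1 -> forall eps, 0 < eps ->
  exists n0, forall n, (n0 <= n)%nat ->
    Cmod (sum_n (fun i => taylor_coef i * v ^ i) n - f v) < eps.
Proof.
  intros Hv1 eps He. assert (HP := PI_RGT_0).
  (* The center is treated apart, since Cauchy's formula is stated with [ln (Cmod v)]. *)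
  destruct (Ceq_dec v 0) as [->|Hv0].
  { exists O. intros n _.
    assert (E : sum_n (fun i => taylor_coef i * 0 ^ i) n = f 0).
    { induction n as [|n IH].
      - rewrite sum_O, taylor_coef_0. cbn. ring.
      - rewrite Csum_Sn, IH. cbn. ring. }
    rewrite E. replace (f 0 - f 0) with (RtoC 0) by ring. now rewrite Cmod_0. }
  apply Cmod_gt_0 in Hv0. set (m := Cmod v) in *.
  assert (Em : exp (ln m) = m) by now apply exp_ln.
  assert (Hlm : ln m < 0) by (rewrite <- ln_1; apply ln_increasing; lra).
  (* Halfway between [|v|] and 1 on the logarithmic scale: the radius is the square root of
     [|v|]. *)
  set (x := (ln m / 2)%R). assert (Hx : ln m < x < 0) by (unfold x; lra).
  assert (Hx1 := exp_lt_1 x ltac:(lra)). assert (Hmx : m < exp x) by (rewrite <- Em; apply exp_increasing; lra).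
  set (r := exp x) in *.
  destruct (Rcont_bounded (fun t => f (Cexp (x, t))) 0 (2 * PI) ltac:(lra)) as [M HM].
  { intros t _. apply Rcont_circle, disc_cont. rewrite Cmod_Cexp. exact Hx1. }
  assert (HM0 : 0 <= M) by (eapply Rle_trans; [apply Cmod_ge_0|apply (HM 0%R); lra]).
  (* Bound of [f u * (u / (u - v))] on the circle. It may be 0, hence [K + 1] in the denominators
     below. *)
  set (K := (M * (r / (r - m)))%R).
  assert (HK : 0 <= K).
  { apply Rmult_le_pos; [assumption|]. left. apply Rdiv_lt_0_compat; lra. }
  assert (Hq : 0 < m / r < 1).
  { split; [apply Rdiv_lt_0_compat; lra|]. apply (Rmult_lt_reg_r r); [lra|].
    unfold Rdiv. rewrite Rmult_assoc, Rinv_l; lra. }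
  destruct (pow_lt_1_zero (m / r) ltac:(rewrite Rabs_pos_eq; lra) (eps / (K + 1))%R) as [n0 Hn0].
  { apply Rdiv_lt_0_compat; lra. }
  exists n0. intros n Hn. specialize (Hn0 (S n) ltac:(lia)).
  rewrite Rabs_pos_eq in Hn0 by (apply pow_le; lra).
  set (S1 := sum_n (fun i => taylor_coef i * v ^ i) n).
  assert (Hker : forall u, Cmod u = r -> Ccont (fun u => u / (u - v)) u).
  { intros u Hu. destruct (Cdiff_kernel v u) as [l Hl]; [apply neq_of_Cmod_lt; fold m; lra|].
    now apply Cdiff_cont in Hl. }
  assert (C1 : forall u, Cmod u = r -> Ccont (fun u => f u * (u / (u - v))) u).
  { intros u Hu. apply Ccont_mult; [apply disc_cont; lra|now apply Hker]. }
  assert (C2 : forall u, Cmod u = r -> Ccont (fun u => f u * sum_n (fun i => v ^ i * (/ u) ^ i) n) u).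
  { intros u Hu. apply Ccont_mult; [apply disc_cont; lra|]. clear S1 Hn0.
    assert (Hi : forall i, Ccont (fun u => v ^ i * (/ u) ^ i) u).
    { intros i. apply Ccont_mult; [apply Ccont_const|].
      destruct (Cdiff_pow_inv i u) as [l Hl]; [apply Cmod_gt_0; lra|]. now apply Cdiff_cont in Hl. }
    clear Hn. induction n as [|n IH].
    - eapply Ccont_ext_loc; [|apply (Hi O)]. apply Cnear_forall. intros w. now rewrite sum_O.
    - eapply Ccont_ext_loc; [|apply (Ccont_plus _ _ _ IH (Hi (S n)))].
      apply Cnear_forall. intros w. now rewrite sum_Sn. }
  assert (B : Cmod (RtoC (2 * PI) * S1 - RtoC (2 * PI) * f v) <= K * (m / r) ^ S n * (2 * PI)).
  { unfold S1. rewrite <- (circle_int_taylor_sum v x) by lra.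
    rewrite <- (Cauchy_formula v x) by (fold m; lra).
    replace (2 * PI)%R with (2 * PI - 0)%R at 1 by ring.
    apply is_CInt_bound with (fun t => f (Cexp (x, t)) * sum_n (fun i => v ^ i * (/ Cexp (x, t)) ^ i) n
      - f (Cexp (x, t)) * (Cexp (x, t) / (Cexp (x, t) - v))); [lra| |].
    - intros t Ht. specialize (HM t Ht). cbn beta in HM.
      assert (Hu : Cmod (Cexp (x, t)) = r) by now rewrite Cmod_Cexp.
      set (u := Cexp (x, t)) in *.
      assert (Hu0 : u <> 0) by (apply Cmod_gt_0; lra).
      assert (Huv : u <> v) by (apply neq_of_Cmod_lt; fold m; lra).
      rewrite (kernel_expansion u v n) at 1 by assumption.
      match goal with |- Cmod ?X <= _ =>
        replace X with (- (f u * ((v * / u) ^ S n * (u / (u - v))))) by ring end.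
      assert (Huv' : u - v <> 0) by (intros E; apply Huv; now apply Ceq_minus).
      unfold Cdiv. rewrite Cmod_opp, !Cmod_mult, Cmod_pow, Cmod_mult, Cmod_inv, Cmod_inv, Hu by assumption.
      fold m. unfold K. fold (m / r)%R.
      assert (Hd := Cmod_triangle_rev u v). fold m in Hd. rewrite Hu in Hd.
      assert (Hp : 0 <= (m / r) ^ S n) by (apply pow_le; lra).
      replace (M * (r / (r - m)) * (m / r) ^ S n)%R with (M * ((m / r) ^ S n * (r * / (r - m))))%R
        by (unfold Rdiv; ring).
      apply Rmult_le_compat; [apply Cmod_ge_0| |assumption|].
      + apply Rmult_le_pos; [assumption|]. apply Rmult_le_pos; [lra|]. left. apply Rinv_0_lt_compat. lra.
      + apply Rmult_le_compat_l; [assumption|]. apply Rmult_le_compat_l; [lra|].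
        apply Rinv_le_contravar; lra.
    - apply is_CInt_minus.
      + exact (is_CInt_circle (fun u => f u * sum_n (fun i => v ^ i * (/ u) ^ i) n) x C2).
      + exact (is_CInt_circle (fun u => f u * (u / (u - v))) x C1). }
  replace (RtoC (2 * PI) * S1 - RtoC (2 * PI) * f v) with (RtoC (2 * PI) * (S1 - f v)) in B by ring.
  rewrite Cmod_mult, Cmod_R, (Rabs_pos_eq (2 * PI)) in B by lra.
  assert (B' : Cmod (S1 - f v) <= K * (m / r) ^ S n).
  { apply (Rmult_le_reg_l (2 * PI)); [lra|]. lra. }
  eapply Rle_lt_trans; [exact B'|].
  apply Rle_lt_trans with ((K + 1) * (m / r) ^ S n)%R.
  - assert (0 <= (m / r) ^ S n) by (apply pow_le; lra). nra.
  - apply (Rmult_lt_compat_l (K + 1)) in Hn0; [|lra].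
    replace ((K + 1) * (eps / (K + 1)))%R with eps in Hn0 by (field; lra). exact Hn0.
Qed.

End Cauchy.

(** * Derivatives along the real line *)

(** Componentwise, so that [auto_derive], real power series and the real fundamental theorem of
    calculus apply directly. *)
Definition Rder (f : R -> C) (x : R) (l : C) : Prop :=
  is_derive (fun t => Re (f t)) x (Re l) /\ is_derive (fun t => Im (f t)) x (Im l).

Lemma Rder_eq (f : R -> C) (x : R) (l m : C) : Rder f x l -> l = m -> Rder f x m.
Proof. intros H E; now subst. Qed.

Lemma Rder_cont (f : R -> C) (x : R) (l : C) : Rder f x l -> Rcont f x.
Proof.
  intros [H1 H2]. apply Rcont_components. split;
    apply (ex_derive_continuous (V := R_NormedModule)); eexists; eassumption.
Qed.

Lemma Rder_const (c : C) (x : R) : Rder (fun _ => c) x 0.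
Proof. split; apply (is_derive_const (V := R_NormedModule)). Qed.

Lemma Rder_plus (f g : R -> C) (x : R) (l m : C) :
  Rder f x l -> Rder g x m -> Rder (fun t => f t + g t) x (l + m).
Proof.
  intros [F1 F2] [G1 G2]. split.
  - apply (is_derive_plus (V := R_NormedModule) _ _ _ _ _ F1 G1).
  - apply (is_derive_plus (V := R_NormedModule) _ _ _ _ _ F2 G2).
Qed.

Lemma Rder_mult (f g : R -> C) (x : R) (l m : C) :
  Rder f x l -> Rder g x m -> Rder (fun t => f t * g t) x (l * g x + f x * m).
Proof.
  intros [F1 F2] [G1 G2].
  assert (A11 := is_derive_mult (K := R_AbsRing) _ _ _ _ _ F1 G1 Rmult_comm).
  assert (A22 := is_derive_mult (K := R_AbsRing) _ _ _ _ _ F2 G2 Rmult_comm).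
  assert (A12 := is_derive_mult (K := R_AbsRing) _ _ _ _ _ F1 G2 Rmult_comm).
  assert (A21 := is_derive_mult (K := R_AbsRing) _ _ _ _ _ F2 G1 Rmult_comm).
  split.
  - assert (A := is_derive_minus (V := R_NormedModule) _ _ _ _ _ A11 A22).
    match type of A with is_derive _ _ ?v => replace (Re (l * g x + f x * m)) with v end.
    + exact A.
    + unfold minus, plus, opp, mult; cbn. unfold Re, Im. ring.
  - assert (A := is_derive_plus (V := R_NormedModule) _ _ _ _ _ A12 A21).
    match type of A with is_derive _ _ ?v => replace (Im (l * g x + f x * m)) with v end.
    + exact A.
    + unfold minus, plus, opp, mult; cbn. unfold Re, Im. ring.
Qed.

Lemma Rder_RtoC (g : R -> R) (x dg : R) : is_derive g x dg -> Rder (fun t => RtoC (g t)) x (RtoC dg).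
Proof. intros H. split; [exact H|exact (is_derive_const (K := R_AbsRing) (V := R_NormedModule) 0%R x)]. Qed.

Lemma Rder_comp (f : R -> C) (g : R -> R) (x dg : R) (l : C) :
  Rder f (g x) l -> is_derive g x dg -> Rder (fun t => f (g t)) x (RtoC dg * l).
Proof.
  intros [F1 F2] G. split.
  - assert (A := is_derive_comp (K := R_AbsRing) (V := R_NormedModule) _ _ _ _ _ F1 G).
    replace (Re (RtoC dg * l)) with (scal (V := R_NormedModule) dg (Re l)); [exact A|].
    unfold scal; cbn; unfold mult; cbn; unfold Re, Im; ring.
  - assert (A := is_derive_comp (K := R_AbsRing) (V := R_NormedModule) _ _ _ _ _ F2 G).
    replace (Im (RtoC dg * l)) with (scal (V := R_NormedModule) dg (Im l)); [exact A|].
    unfold scal; cbn; unfold mult; cbn; unfold Re, Im; ring.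
Qed.

Lemma Rder_Cexp (c : C) (x : R) : Rder (fun t => Cexp (c * RtoC t)) x (c * Cexp (c * RtoC x)).
Proof.
  destruct c as [a b]. split; unfold Cexp, Cmult, RtoC, Re, Im; cbn; auto_derive; trivial; unfold Rminus; ring.
Qed.

Lemma Rder_sum_n (f df : nat -> R -> C) (x : R) (n : nat) :
  (forall k, (k <= n)%nat -> Rder (f k) x (df k x)) ->
  Rder (fun t => sum_n (G := C_AbelianMonoid) (fun k => f k t) n) x
    (sum_n (G := C_AbelianMonoid) (fun k => df k x) n).
Proof.
  induction n as [|n IH]; intros H.
  - rewrite sum_O. specialize (H O (le_n _)). destruct H as [H1 H2]. split.
    + apply (is_derive_ext (fun t => Re (f O t))); [|exact H1]. intros t. now rewrite sum_O.
    + apply (is_derive_ext (fun t => Im (f O t))); [|exact H2]. intros t. now rewrite sum_O.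
  - rewrite Csum_Sn.
    destruct (Rder_plus _ _ _ _ _ (IH (fun k Hk => H k (le_S _ _ Hk))) (H (S n) (le_n _))) as [H1 H2].
    split.
    + eapply is_derive_ext; [|exact H1]. intros t. cbn beta. now rewrite Csum_Sn.
    + eapply is_derive_ext; [|exact H2]. intros t. cbn beta. now rewrite Csum_Sn.
Qed.

Lemma is_CInt_Rder (f df : R -> C) (a b : R) : a <= b ->
  (forall x, a <= x <= b -> Rder f x (df x)) -> (forall x, a <= x <= b -> Rcont df x) ->
  is_CInt df a b (f b - f a).
Proof.
  intros Hab Hd Hc. apply is_CInt_components. split.
  - apply (is_RInt_derive (V := R_CompleteNormedModule) (fun t => Re (f t)) (fun t => Re (df t)));
      intros x; rewrite Rmin_left, Rmax_right by assumption; intros Hx.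
    + now apply Hd.
    + apply (Rcont_components df x). now apply Hc.
  - apply (is_RInt_derive (V := R_CompleteNormedModule) (fun t => Im (f t)) (fun t => Im (df t)));
      intros x; rewrite Rmin_left, Rmax_right by assumption; intros Hx.
    + now apply Hd.
    + apply (Rcont_components df x). now apply Hc.
Qed.

(** All derivatives are carried as one family, so that two expansions of the same function can be
    identified order by order. *)
Definition deriv_seq (g : nat -> R -> C) (a b : R) : Prop :=
  forall n x, a < x < b -> Rder (g n) x (g (S n) x).

Lemma locally_interval (a b x : R) (P : R -> Prop) :
  a < x < b -> (forall y, a < y < b -> P y) -> locally x P.
Proof.
  intros Hx HP. apply (locally_open (fun y => a < y < b)); [|exact HP|exact Hx].
  apply (open_and (fun y => a < y) (fun y => y < b)); [apply open_gt|apply open_lt].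
Qed.

Lemma Rder_unique_on (f g : R -> C) (a b x : R) (l m : C) : a < x < b ->
  (forall y, a < y < b -> f y = g y) -> Rder f x l -> Rder g x m -> l = m.
Proof.
  intros Hx E [F1 F2] [G1 G2].
  assert (E1 : locally x (fun y => Re (f y) = Re (g y)))
    by (apply (locally_interval a b); [assumption|]; intros y Hy; now rewrite E).
  assert (E2 : locally x (fun y => Im (f y) = Im (g y)))
    by (apply (locally_interval a b); [assumption|]; intros y Hy; now rewrite E).
  apply (is_derive_ext_loc _ _ _ _ E1) in F1. apply (is_derive_ext_loc _ _ _ _ E2) in F2.
  apply is_derive_unique in F1, F2, G1, G2.
  apply injective_projections; [exact (eq_trans (eq_sym F1) G1)|exact (eq_trans (eq_sym F2) G2)].
Qed.

Lemma deriv_seq_unique (g k : nat -> R -> C) (a b : R) :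
  deriv_seq g a b -> deriv_seq k a b -> (forall x, a < x < b -> g O x = k O x) ->
  forall n x, a < x < b -> g n x = k n x.
Proof.
  intros Hg Hk H0. induction n as [|n IH]; [exact H0|]. intros x Hx.
  apply (Rder_unique_on (g n) (k n) a b x); auto.
Qed.

(** Were the radius below the midpoint [y] of [|x|] and [r], the terms at [y] would not tend to 0,
    although the series converges there. *)
Lemma CV_radius_le (a : nat -> R) (l : R -> R) (r : R) :
  (forall x, Rabs x < r -> is_pseries a x (l x)) ->
  forall x, Rabs x < r -> Rbar_lt (Rabs x) (CV_radius a).
Proof.
  intros H x Hx. set (y := ((Rabs x + r) / 2)%R).
  assert (H0 := Rabs_pos x). assert (Hy : Rabs y = y) by (apply Rabs_pos_eq; unfold y; lra).
  apply Rbar_lt_le_trans with (Finite (Rabs y)); [cbn; rewrite Hy; unfold y; lra|].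
  apply Rbar_not_lt_le. intros Hlt. apply (CV_disk_outside _ _ Hlt).
  apply ex_series_lim_0. exists (l y). apply is_pseries_R, H. rewrite Hy. unfold y. lra.
Qed.

Lemma iter_PS_derive_0 (a : nat -> R) (n : nat) :
  Nat.iter n PS_derive a O = (INR (Factorial.fact n) * a n)%R.
Proof.
  (* The induction shifts the index, so all [k] are needed; multiplying by [k!] avoids a quotient of
     factorials. *)
  assert (K : forall n k, (Nat.iter n PS_derive a k * INR (Factorial.fact k)
    = INR (Factorial.fact (n + k)) * a (n + k)%nat)%R).
  { clear n. induction n as [|n IH]; intros k.
    - cbn. ring.
    - change (Nat.iter (S n) PS_derive a k) with (INR (S k) * Nat.iter n PS_derive a (S k))%R.
      transitivity (Nat.iter n PS_derive a (S k) * INR (Factorial.fact (S k)))%R.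
      + change (Factorial.fact (S k)) with (S k * Factorial.fact k)%nat. rewrite mult_INR. ring.
      + rewrite IH. now replace (n + S k)%nat with (S n + k)%nat by lia. }
  specialize (K n O). rewrite Nat.add_0_r in K. cbn [Factorial.fact INR] in K. lra.
Qed.

Lemma Re_sum_n (a : nat -> C) (n : nat) :
  Re (sum_n (G := C_AbelianMonoid) a n) = sum_n (G := R_AbelianMonoid) (fun i => Re (a i)) n.
Proof.
  induction n as [|n IH]; [now rewrite !sum_O|]. rewrite Csum_Sn, sum_Sn, <- IH. reflexivity.
Qed.

Lemma Im_sum_n (a : nat -> C) (n : nat) :
  Im (sum_n (G := C_AbelianMonoid) a n) = sum_n (G := R_AbelianMonoid) (fun i => Im (a i)) n.
Proof.
  induction n as [|n IH]; [now rewrite !sum_O|]. rewrite Csum_Sn, sum_Sn, <- IH. reflexivity.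
Qed.

Lemma RtoC_pow (x : R) (n : nat) : RtoC x ^ n = RtoC (x ^ n).
Proof. induction n as [|n IH]; cbn; [reflexivity|]. rewrite IH. now rewrite RtoC_mult. Qed.

(** Convergence on the real interval alone bounds both real radii from below, and real power series
    are differentiated termwise. It serves the Taylor series on the unit disc as well as the Borel
    series near 0. *)
Lemma deriv_seq_of_pseries (c : nat -> C) (f : R -> C) (r : R) : 0 < r ->
  (forall x, Rabs x < r -> forall eps, 0 < eps -> exists n0, forall n, (n0 <= n)%nat ->
     Cmod (sum_n (G := C_AbelianMonoid) (fun i => c i * RtoC x ^ i) n - f x) < eps) ->
  exists g : nat -> R -> C, deriv_seq g (- r) r /\ (forall x, Rabs x < r -> g O x = f x) /\
    forall n, g n 0%R = RtoC (INR (Factorial.fact n)) * c n.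
Proof.
  intros Hr H.
  assert (P1 : forall x, Rabs x < r -> is_pseries (fun i => Re (c i)) x (Re (f x))).
  { intros x Hx. apply is_pseries_R. apply (is_lim_seq_spec _ (Finite _)). intros eps.
    destruct (H x Hx eps (cond_pos eps)) as [n0 Hn]. exists n0. intros n Hnn.
    eapply Rle_lt_trans; [|apply (Hn n Hnn)]. eapply Rle_trans; [|apply re_le_Cmod].
    right. f_equal. unfold Cminus. change (Re (?a + - ?b)) with (Re a - Re b)%R.
    rewrite Re_sum_n. f_equal. apply sum_n_ext. intros i. rewrite RtoC_pow. cbn. unfold Re. ring. }
  assert (P2 : forall x, Rabs x < r -> is_pseries (fun i => Im (c i)) x (Im (f x))).
  { intros x Hx. apply is_pseries_R. apply (is_lim_seq_spec _ (Finite _)). intros eps.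
    destruct (H x Hx eps (cond_pos eps)) as [n0 Hn]. exists n0. intros n Hnn.
    eapply Rle_lt_trans; [|apply (Hn n Hnn)]. eapply Rle_trans; [|apply Rabs_Im_le_Cmod].
    right. f_equal. unfold Cminus. change (Im (?a + - ?b)) with (Im a - Im b)%R.
    rewrite Im_sum_n. f_equal. apply sum_n_ext. intros i. rewrite RtoC_pow. cbn. unfold Im. ring. }
  assert (R1 := CV_radius_le _ (fun x => Re (f x)) r P1).
  assert (R2 := CV_radius_le _ (fun x => Im (f x)) r P2).
  assert (RI : forall a n, CV_radius (Nat.iter n PS_derive a) = CV_radius a).
  { intros a n. induction n as [|n IH]; [reflexivity|]. rewrite <- IH. apply (CV_radius_derive (Nat.iter n PS_derive a)). }
  exists (fun n x => (PSeries (Nat.iter n PS_derive (fun i => Re (c i))) x,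
                      PSeries (Nat.iter n PS_derive (fun i => Im (c i))) x)).
  split; [|split].
  - intros n x Hx. assert (Hxr : Rabs x < r) by (apply Rabs_def1; lra).
    split; apply is_derive_PSeries; rewrite RI; auto.
  - intros x Hx. cbn [Nat.iter]. rewrite (surjective_pairing (f x)). f_equal;
      apply is_pseries_unique; [now apply P1|now apply P2].
  - intros n. rewrite !PSeries_0, !iter_PS_derive_0. unfold RtoC, Cmult, Re, Im; cbn. f_equal; ring.
Qed.

(** * Stirling numbers *)

Module StirlingRecurrence.
Import all_boot all_algebra Rstruct.
Import GRing.Theory.
Local Open Scope ring_scope.

Lemma stirling1R_0 (k : nat) : stirling1R 0 k = (k == 0%N)%:R.
Proof. by rewrite /stirling1R /stirling1 big_ord0 coef1; case: k. Qed.

Lemma stirling1R_S0 (n : nat) : stirling1R n.+1 0 = - (n%:R * stirling1R n 0).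
Proof.
rewrite /stirling1R /stirling1 big_ord_recr /= mulrBr coefB coefMX coefMC /= sub0r.
by rewrite rmorphN rmorphM /= mulrC.
Qed.

(** The last factor [X - n] of the falling factorial shifts the coefficients by one place and
    multiplies them by [- n]. *)
Lemma stirling1R_SS (n k : nat) :
  stirling1R n.+1 k.+1 = stirling1R n k - n%:R * stirling1R n k.+1.
Proof.
rewrite /stirling1R /stirling1 big_ord_recr /= mulrBr coefB coefMX coefMC /=.
by rewrite rmorphB rmorphM /= [X in _ - X]mulrC.
Qed.

Lemma natr_INR (n : nat) : (n%:R : R) = INR n.
Proof. by rewrite INRE. Qed.
End StirlingRecurrence.

Lemma stirling1R_00 : stirling1R 0 0 = 1%R.
Proof. exact (StirlingRecurrence.stirling1R_0 0). Qed.

Lemma stirling1R_0S (k : nat) : stirling1R 0 (S k) = 0%R.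
Proof. exact (StirlingRecurrence.stirling1R_0 (S k)). Qed.

Lemma stirling1R_S0 (n : nat) : stirling1R (S n) 0 = (- (INR n * stirling1R n 0))%R.
Proof. rewrite <- StirlingRecurrence.natr_INR. exact (StirlingRecurrence.stirling1R_S0 n). Qed.

Lemma stirling1R_SS (n k : nat) :
  stirling1R (S n) (S k) = (stirling1R n k - INR n * stirling1R n (S k))%R.
Proof. rewrite <- StirlingRecurrence.natr_INR. exact (StirlingRecurrence.stirling1R_SS n k). Qed.

Lemma stirling1R_gt (n k : nat) : (n < k)%nat -> stirling1R n k = 0%R.
Proof.
  revert k. induction n as [|n IH]; intros [|k] H; try lia.
  - apply stirling1R_0S.
  - rewrite stirling1R_SS, !IH by lia. ring.
Qed.

(** The unsigned Stirling numbers, coefficients of the rising factorial. For [k > n] the exponent is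
    truncated, but [stirling1R n k] vanishes. *)
Definition ustirling1R (n k : nat) : R := ((-1) ^ (n - k) * stirling1R n k)%R.

Lemma ustirling1R_S0 (n : nat) : ustirling1R (S n) 0 = (INR n * ustirling1R n 0)%R.
Proof. unfold ustirling1R. rewrite stirling1R_S0, !Nat.sub_0_r. cbn [pow]. ring. Qed.

Lemma ustirling1R_SS (n k : nat) : (k <= n)%nat ->
  ustirling1R (S n) (S k) = (ustirling1R n k + INR n * ustirling1R n (S k))%R.
Proof.
  intros H. unfold ustirling1R. rewrite stirling1R_SS. cbn [Nat.sub].
  (* At [k = n] the truncated exponent [n - S n] does not flip the sign, but its coefficient is
     0. *)
  destruct (Nat.eq_dec k n) as [->|E].
  - rewrite (stirling1R_gt n (S n)) by lia. ring.
  - replace (n - k)%nat with (S (n - S k)) by lia. cbn [pow]. ring.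
Qed.

(** The rising factorial [D (D + 1) ... (D + n - 1)] with [p k] in place of [D^k]. *)
Definition stirling_sum (n : nat) (p : nat -> C) : C :=
  sum_n (G := C_AbelianMonoid) (fun k => RtoC (ustirling1R n k) * p k) n.

Lemma Csum_n_Sn_m (a : nat -> C) (n : nat) :
  sum_n (G := C_AbelianMonoid) a (S n) = a O + sum_n (G := C_AbelianMonoid) (fun k => a (S k)) n :> C.
Proof.
  induction n as [|n IH].
  - rewrite Csum_Sn, !sum_O. reflexivity.
  - rewrite Csum_Sn, IH, Csum_Sn. ring.
Qed.

Lemma Csum_lin (a b : nat -> C) (x y : C) (n : nat) :
  sum_n (G := C_AbelianMonoid) (fun k => x * a k + y * b k) n
  = x * sum_n (G := C_AbelianMonoid) a n + y * sum_n (G := C_AbelianMonoid) b n :> C.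
Proof.
  induction n as [|n IH].
  - now rewrite !sum_O.
  - rewrite !Csum_Sn, IH. ring.
Qed.

(** Multiplication by the next factor [D + n], where [D] acts as the shift of [p]. *)
Lemma stirling_sum_S (n : nat) (p : nat -> C) :
  stirling_sum (S n) p = RtoC (INR n) * stirling_sum n p + stirling_sum n (fun k => p (S k)).
Proof.
  unfold stirling_sum. rewrite Csum_n_Sn_m, ustirling1R_S0.
  rewrite (sum_n_ext_loc (G := C_AbelianMonoid) _ (fun k => 1 * (RtoC (ustirling1R n k) * p (S k))
    + RtoC (INR n) * (RtoC (ustirling1R n (S k)) * p (S k)))).
  - rewrite Csum_lin.
    assert (E := Csum_n_Sn_m (fun k => RtoC (ustirling1R n k) * p k) n). rewrite Csum_Sn in E.
    assert (Z : ustirling1R n (S n) = 0%R) by (unfold ustirling1R; rewrite stirling1R_gt by lia; ring).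
    rewrite Z in E.
    replace (sum_n (G := C_AbelianMonoid) (fun k => RtoC (ustirling1R n k) * p k) n)
      with (RtoC (ustirling1R n 0) * p O
        + sum_n (G := C_AbelianMonoid) (fun k => RtoC (ustirling1R n (S k)) * p (S k)) n).
    + rewrite RtoC_mult. ring.
    + rewrite <- E. ring.
  - intros k Hk. rewrite ustirling1R_SS by assumption. rewrite RtoC_plus, RtoC_mult.
    match goal with |- @eq _ ?x ?y => change (@eq C x y) end. ring.
Qed.

(** With [k = j + 1] the sign [(-1)^(n - k + 1)] becomes [(-1)^(n - j)], which makes the Stirling
    numbers unsigned. *)
Lemma bcoef_stirling_sum (a : nat -> C) (n : nat) :
  bcoef a n = / RtoC (INR (Factorial.fact n)) * stirling_sum n (fun k => a (S k)).
Proof.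
  unfold bcoef, stirling_sum. f_equal. rewrite Nat.add_1_r.
  rewrite <- (sum_n_m_S (G := C_AbelianMonoid)). apply sum_n_m_ext. intros k.
  unfold ustirling1R. change (ssrnat.subn (S n) (S k)) with (n - k)%nat.
  change (ssrnat.subn (S k) 1) with (k - 0)%nat. now rewrite Nat.sub_0_r.
Qed.

(* [(1 - x)^-n S_n (- ln (1 - x))] with [S_n = (D + n - 1) ... (D + 1) D]: the chain rule for
   [x |-> - ln (1 - x)] turns iterated derivatives into rising factorials of the derivation. *)
Lemma deriv_seq_comp_log (p : nat -> R -> C) (r : R) : deriv_seq p (- r) r ->
  forall a b, b <= 1 -> (forall x, a < x < b -> - r < - ln (1 - x) < r) ->
  deriv_seq (fun n x => RtoC ((/ (1 - x)) ^ n) * stirling_sum n (fun k => p k (- ln (1 - x))%R)) a b.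
Proof.
  intros Hp a b Hb Hab n x Hx. specialize (Hab x Hx).
  assert (Hx1 : (1 - x > 0)%R) by lra.
  assert (D1 : is_derive (fun t => (/ (1 - t)) ^ n)%R x (INR n * (/ (1 - x)) ^ S n)%R).
  { auto_derive; [lra|]. destruct n as [|n]; [cbn; ring|].
    cbn [Init.Nat.pred Nat.pred pow]. unfold Rminus. generalize ((/ (1 + - x)) ^ n)%R. intros u. field. lra. }
  assert (D2 : is_derive (fun t => - ln (1 - t))%R x (/ (1 - x))%R).
  { auto_derive; [lra|]. field. lra. }
  eapply Rder_eq.
  - apply Rder_mult; [exact (Rder_RtoC _ _ _ D1)|].
    apply (Rder_comp (fun t => stirling_sum n (fun k => p k t)) (fun t => - ln (1 - t))%R x (/ (1 - x))%R
      (stirling_sum n (fun k => p (S k) (- ln (1 - x))%R))); [|exact D2].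
    apply (Rder_sum_n (fun k t => RtoC (ustirling1R n k) * p k t)
      (fun k t => RtoC (ustirling1R n k) * p (S k) t)).
    intros k _. eapply Rder_eq; [apply (Rder_mult (fun _ => RtoC (ustirling1R n k)));
      [apply Rder_const|apply Hp; exact Hab]|ring].
  - rewrite (stirling_sum_S n (fun k => p k (- ln (1 - x))%R)). cbn [pow]. rewrite !RtoC_mult. ring.
Qed.

(** * Improper integrals *)

Definition is_CInt_inf (f : R -> C) (l : C) : Prop :=
  is_RInt_gen (V := C_R_NormedModule) f (at_right 0) (Rbar_locally p_infty) l.

Lemma filter_prod_0_inf (P : R * R -> Prop) (a0 b0 : R) : 0 < a0 ->
  (forall a b, 0 < a < a0 -> b0 < b -> P (a, b)) ->
  filter_prod (at_right 0) (Rbar_locally p_infty) P.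
Proof.
  intros Ha H. apply (Filter_prod _ _ _ (fun a => 0 < a < a0) (fun b => b0 < b)).
  - exists (mkposreal _ Ha). intros a Hb Ha'.
    change (Rabs (a - 0) < a0)%R in Hb. rewrite Rminus_0_r in Hb. apply Rabs_def2 in Hb. lra.
  - now exists b0.
  - intros a b. apply H.
Qed.

Lemma filter_prod_0_inf_elim (P : R * R -> Prop) :
  filter_prod (at_right 0) (Rbar_locally p_infty) P ->
  exists a0 b0, 0 < a0 /\ forall a b, 0 < a < a0 -> b0 < b -> P (a, b).
Proof.
  intros [Q1 Q2 [d Hd] [b0 Hb] HP]. exists d, b0. split; [apply cond_pos|].
  intros a b Ha Hb'. apply HP; [|now apply Hb]. apply Hd; [|lra].
  change (Rabs (a - 0) < d)%R. rewrite Rminus_0_r, Rabs_pos_eq; lra.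
Qed.

Lemma is_CInt_inf_eps (f : R -> C) (l : C) :
  is_CInt_inf f l <-> forall eps, 0 < eps -> exists a0 b0, 0 < a0 /\
    forall a b, 0 < a < a0 -> b0 < b -> exists J, is_CInt f a b J /\ Cmod (J - l) < eps.
Proof.
  split.
  - intros H eps He. assert (He2 : (0 < eps / 2)%R) by lra.
    assert (Hb : locally (T := C_UniformSpace) l (fun w => Cmod (w - l) < eps)).
    (* A product ball of radius [eps / 2] only lies in the modulus ball of radius
       [sqrt 2 * (eps / 2)]. *)
    { exists (mkposreal _ He2). intros w Hw.
      apply (C_NormedModule_mixin_compat2 l w (mkposreal _ He2)) in Hw.
      eapply Rlt_le_trans; [exact Hw|]. cbn.
      assert (Hs : sqrt 2 <= 2).
      { rewrite <- (sqrt_pow2 2) at 2 by lra. apply sqrt_le_1_alt. lra. }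
      assert (H0 := sqrt_pos 2). nra. }
    apply H in Hb. apply filter_prod_0_inf_elim in Hb. exact Hb.
  - intros H P [d Hd]. destruct (H d (cond_pos d)) as (a0 & b0 & Ha & Hab).
    apply filter_prod_0_inf with a0 b0; [assumption|]. intros a b Ha' Hb'.
    destruct (Hab a b Ha' Hb') as (J & HJ & HC). exists J. split; [exact HJ|].
    apply Hd. apply C_NormedModule_mixin_compat1. exact HC.
Qed.

Lemma is_CInt_inf_unique (f : R -> C) (l m : C) : is_CInt_inf f l -> is_CInt_inf f m -> l = m.
Proof.
  intros H1 H2. apply Ceq_of_Cmod_le with 2%R. intros eps He.
  destruct (proj1 (is_CInt_inf_eps f l) H1 eps He) as (a1 & b1 & Ha1 & K1).
  destruct (proj1 (is_CInt_inf_eps f m) H2 eps He) as (a2 & b2 & Ha2 & K2).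
  set (a := (Rmin a1 a2 / 2)%R). set (b := (Rmax b1 b2 + 1)%R).
  assert (A0 : 0 < Rmin a1 a2) by now apply Rmin_glb_lt.
  assert (A1 := Rmin_l a1 a2). assert (A2 := Rmin_r a1 a2).
  assert (B1 := Rmax_l b1 b2). assert (B2 := Rmax_r b1 b2).
  destruct (K1 a b ltac:(unfold a; lra) ltac:(unfold b; lra)) as (J1 & I1 & C1).
  destruct (K2 a b ltac:(unfold a; lra) ltac:(unfold b; lra)) as (J2 & I2 & C2).
  apply is_CInt_unique in I1, I2. rewrite <- I1 in C1. rewrite <- I2 in C2.
  replace (l - m) with ((CInt f a b - m) - (CInt f a b - l)) by ring.
  eapply Rle_trans; [apply Cmod_triangle|]. rewrite Cmod_opp. lra.
Qed.

(** The chosen value is the integral once some limit is known to exist, by uniqueness. *)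
Lemma CInt_0_inf_eq (f : R -> C) (l : C) : is_CInt_inf f l -> CInt_0_inf f = l.
Proof.
  intros H. apply (is_CInt_inf_unique f); [|assumption].
  unfold CInt_0_inf. apply epsilon_spec. now exists l.
Qed.

Lemma is_CInt_inf_plus (f g : R -> C) (l m : C) :
  is_CInt_inf f l -> is_CInt_inf g m -> is_CInt_inf (fun t => f t + g t) (l + m).
Proof.
  exact (is_RInt_gen_plus (V := C_R_NormedModule) (Fa := at_right 0) (Fb := Rbar_locally p_infty)
    f g l m).
Qed.

Lemma is_CInt_inf_minus (f g : R -> C) (l m : C) :
  is_CInt_inf f l -> is_CInt_inf g m -> is_CInt_inf (fun t => f t - g t) (l - m).
Proof.
  exact (is_RInt_gen_minus (V := C_R_NormedModule) (Fa := at_right 0) (Fb := Rbar_locally p_infty)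
    f g l m).
Qed.

Lemma is_CInt_inf_Cmult (c : C) (f : R -> C) (l : C) :
  is_CInt_inf f l -> is_CInt_inf (fun t => c * f t) (c * l).
Proof.
  intros H. apply is_CInt_inf_eps. intros eps He.
  assert (Hc := Cmod_ge_0 c).
  destruct (proj1 (is_CInt_inf_eps f l) H (eps / (Cmod c + 1))%R) as (a0 & b0 & Ha & Hab).
  { apply Rdiv_lt_0_compat; lra. }
  exists a0, b0. split; [assumption|]. intros a b Ha' Hb'.
  destruct (Hab a b Ha' Hb') as (J & HJ & HC). exists (c * J). split; [now apply is_CInt_Cmult|].
  replace (c * J - c * l) with (c * (J - l)) by ring. rewrite Cmod_mult.
  apply Rle_lt_trans with ((Cmod c + 1) * Cmod (J - l))%R.
  - assert (H0 := Cmod_ge_0 (J - l)). nra.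
  - apply (Rmult_lt_compat_l (Cmod c + 1)) in HC; [|lra].
    replace ((Cmod c + 1) * (eps / (Cmod c + 1)))%R with eps in HC by (field; lra). exact HC.
Qed.

Lemma is_CInt_inf_ext (f g : R -> C) (l : C) :
  (forall t, 0 < t -> f t = g t) -> is_CInt_inf f l -> is_CInt_inf g l.
Proof.
  intros E H. apply is_CInt_inf_eps. intros eps He.
  destruct (proj1 (is_CInt_inf_eps f l) H eps He) as (a0 & b0 & Ha & Hab).
  exists a0, (Rmax b0 a0). split; [assumption|]. intros a b Ha' Hb'.
  assert (M1 := Rmax_l b0 a0). assert (M2 := Rmax_r b0 a0).
  destruct (Hab a b Ha' ltac:(lra)) as (J & HJ & HC). exists J. split; [|assumption].
  apply is_CInt_ext with f; [lra| |assumption]. intros t Ht. apply E. lra.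
Qed.

(** Both integrations by parts, for Gamma and for the Laplace transforms, are read off a primitive
    with limits at the two ends. *)
Lemma is_CInt_inf_Rder (f df : R -> C) (l0 l1 : C) :
  (forall t, 0 < t -> Rder f t (df t)) -> (forall t, 0 < t -> Rcont df t) ->
  (forall eps, 0 < eps -> exists a0, 0 < a0 /\ forall a, 0 < a < a0 -> Cmod (f a - l0) < eps) ->
  (forall eps, 0 < eps -> exists b0, forall b, b0 < b -> Cmod (f b - l1) < eps) ->
  is_CInt_inf df (l1 - l0).
Proof.
  intros Hd Hc H0 H1. apply is_CInt_inf_eps. intros eps He.
  destruct (H0 (eps / 2)%R ltac:(lra)) as (a0 & Ha & Ha').
  destruct (H1 (eps / 2)%R ltac:(lra)) as (b0 & Hb').
  exists a0, (Rmax b0 a0). split; [assumption|]. intros a b Ra Rb.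
  assert (M1 := Rmax_l b0 a0). assert (M2 := Rmax_r b0 a0).
  exists (f b - f a). split.
  - apply is_CInt_Rder; [lra| |]; intros t Ht; [apply Hd|apply Hc]; lra.
  - replace (f b - f a - (l1 - l0)) with ((f b - l1) - (f a - l0)) by ring.
    eapply Rle_lt_trans; [apply Cmod_triangle|]. rewrite Cmod_opp.
    specialize (Ha' a Ra). specialize (Hb' b ltac:(lra)). lra.
Qed.

Lemma is_CInt_dominated (f : R -> C) (P dP : R -> R) (a b : R) : 0 < a -> a <= b ->
  (forall t, 0 < t -> Rcont f t) -> (forall t, 0 < t -> is_derive P t (dP t)) ->
  (forall t, 0 < t -> continuous dP t) -> (forall t, 0 < t -> Cmod (f t) <= dP t) ->
  is_CInt f a b (CInt f a b) /\ Cmod (CInt f a b) <= P b - P a.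
Proof.
  intros Ha Hab Hf HP HdP Hle.
  assert (H : is_CInt f a b (CInt f a b)) by (apply CInt_correct; [assumption|]; intros t Ht; apply Hf; lra).
  split; [assumption|]. rewrite <- Cmod_C_R_norm.
  apply (norm_RInt_le (V := C_R_NormedModule) f dP a b); [assumption| |exact H|].
  - intros t Ht. rewrite Cmod_C_R_norm. apply Hle. lra.
  - apply (is_RInt_derive (V := R_CompleteNormedModule) P dP); intros t;
      rewrite Rmin_left, Rmax_right by assumption; intros Ht; [apply HP|apply HdP]; lra.
Qed.

(* [P] is monotone and bounded, so its increments near 0 and near infinity are small: this is the
   Cauchy criterion for the integral. *)
Lemma is_CInt_inf_dominated (f : R -> C) (P dP : R -> R) (m M : R) :
  (forall t, 0 < t -> Rcont f t) -> (forall t, 0 < t -> is_derive P t (dP t)) ->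
  (forall t, 0 < t -> continuous dP t) -> (forall t, 0 < t -> Cmod (f t) <= dP t) ->
  (forall t, 0 < t -> m <= P t <= M) ->
  exists l, is_CInt_inf f l /\ Cmod l <= M - m.
Proof.
  intros Hf HP HdP Hle Hm.
  assert (B : forall a b, 0 < a -> a <= b ->
    is_CInt f a b (CInt f a b) /\ Cmod (CInt f a b) <= P b - P a)
    by (intros; now apply is_CInt_dominated with dP).
  assert (Mono : forall a b, 0 < a -> a <= b -> P a <= P b).
  { intros a b Ha Hab. destruct (B a b Ha Hab) as [_ H]. assert (H0 := Cmod_ge_0 (CInt f a b)). lra. }
  destruct (completeness (fun x => exists t, 0 < t /\ x = P t)) as [S1 [S1u S1l]].
  { exists M. intros x (t & Ht & ->). now apply Hm. }
  { exists (P 1%R), 1%R. split; [lra|reflexivity]. }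
  (* The infimum of [P] is obtained as minus the supremum of [- P]. *)
  destruct (completeness (fun x => exists t, 0 < t /\ x = (- P t)%R)) as [S0 [S0u S0l]].
  { exists (- m)%R. intros x (t & Ht & ->). assert (H := Hm t Ht). lra. }
  { exists (- P 1)%R, 1%R. split; [lra|reflexivity]. }
  assert (T1 : forall eps, 0 < eps -> exists b0, 0 < b0 /\ S1 - eps < P b0).
  { intros eps He. apply NNPP. intros Hn. assert (S1 <= S1 - eps)%R; [|lra].
    apply S1l. intros x (t & Ht & ->). apply Rnot_lt_le. intros Hlt. apply Hn. now exists t. }
  assert (T0 : forall eps, 0 < eps -> exists a0, 0 < a0 /\ S0 - eps < - P a0).
  { intros eps He. apply NNPP. intros Hn. assert (S0 <= S0 - eps)%R; [|lra].
    apply S0l. intros x (t & Ht & ->). apply Rnot_lt_le. intros Hlt. apply Hn. now exists t. }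
  destruct (proj1 (filterlim_locally_cauchy (U := C_R_CompleteNormedModule)
    (F := filter_prod (at_right 0) (Rbar_locally p_infty))
    (fun ab => CInt f (fst ab) (snd ab)))) as [l Hl].
  - intros eps. destruct (T1 (eps / 2)%R) as (b0 & Hb0 & Hb1); [destruct eps; cbn; lra|].
    destruct (T0 (eps / 2)%R) as (a0 & Ha0 & Ha1); [destruct eps; cbn; lra|].
    set (a1 := Rmin a0 b0). assert (A1 : a1 <= a0) by apply Rmin_l.
    assert (A2 : a1 <= b0) by apply Rmin_r. assert (A3 : 0 < a1) by now apply Rmin_glb_lt.
    exists (fun ab => 0 < fst ab < a1 /\ b0 < snd ab). split.
    + apply filter_prod_0_inf with a1 b0; [assumption|]. intros a b Ha Hb. now split.
    (* Two integrals differ by two end pieces, each bounded by an increment of [P]; the order of [a]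
       and [a'] is fixed by symmetry. *)
    + assert (K : forall a b a' b', 0 < a -> a <= a' -> a' < a1 -> b0 < b -> b0 < b' ->
        Cmod (CInt f a' b' - CInt f a b) < eps).
      { intros a b a' b' H1 H2 H3 H4 H5.
        assert (Pa : 0 < a') by lra. assert (Pb : 0 < b) by lra. assert (Pb' : 0 < b') by lra.
        assert (Q1 := Mono a a1 H1 ltac:(lra)). assert (Q2 := Mono a1 a0 A3 A1).
        assert (Q3 := S0u (- P a)%R (ex_intro _ a (conj H1 eq_refl))).
        assert (Q3' := S0u (- P a')%R (ex_intro _ a' (conj Pa eq_refl))).
        assert (Q8 := Mono a' a1 ltac:(lra) ltac:(lra)).
        assert (Q4 := Mono b0 b Hb0 ltac:(lra)). assert (Q5 := Mono b0 b' Hb0 ltac:(lra)).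
        assert (Q6 := S1u (P b) (ex_intro _ b (conj Pb eq_refl))).
        assert (Q7 := S1u (P b') (ex_intro _ b' (conj Pb' eq_refl))).
        assert (L1 := B a a' H1 H2). destruct L1 as [I1 N1].
        destruct (Rle_dec b b') as [Hbb|Hbb].
        - destruct (B a' b ltac:(lra) ltac:(lra)) as [I2 _].
          destruct (B b b' ltac:(lra) Hbb) as [I3 N3].
          rewrite (is_CInt_unique _ _ _ _ (is_CInt_Chasles _ _ _ _ _ _ I2 I3)).
          rewrite (is_CInt_unique _ _ _ _ (is_CInt_Chasles _ _ _ _ _ _ I1 I2)).
          replace (CInt f a' b + CInt f b b' - (CInt f a a' + CInt f a' b))
            with (CInt f b b' - CInt f a a') by ring.
          eapply Rle_lt_trans; [apply Cmod_triangle|]. rewrite Cmod_opp. lra.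
        - destruct (B a' b' ltac:(lra) ltac:(lra)) as [I2 _].
          destruct (B b' b ltac:(lra) ltac:(lra)) as [I3 N3].
          rewrite (is_CInt_unique _ _ _ _ (is_CInt_Chasles _ _ _ _ _ _ I1
            (is_CInt_Chasles _ _ _ _ _ _ I2 I3))).
          replace (CInt f a' b' - (CInt f a a' + (CInt f a' b' + CInt f b' b)))
            with (- (CInt f a a' + CInt f b' b)) by ring.
          rewrite Cmod_opp. eapply Rle_lt_trans; [apply Cmod_triangle|]. lra. }
      intros [a b] [a' b'] [[H1 H2] H3] [[H4 H5] H6]. cbn [fst snd] in *.
      apply C_NormedModule_mixin_compat1. change (Cmod (CInt f a' b' - CInt f a b) < eps).
      destruct (Rle_dec a a') as [H|H]; [now apply K|]. rewrite Cmod_sym. apply K; lra.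
  - assert (Hinf : is_CInt_inf f l).
    { intros Q HQ. apply Hl in HQ. apply filter_prod_0_inf_elim in HQ.
      destruct HQ as (a0 & b0 & Ha & H). cbn [fst snd] in H.
      apply filter_prod_0_inf with a0 (Rmax b0 a0); [assumption|]. intros a b Ra Rb.
      assert (M1 := Rmax_l b0 a0). assert (M2 := Rmax_r b0 a0).
      exists (CInt f a b). split; [apply (B a b); lra|]. apply H; lra. }
    exists l. split; [exact Hinf|]. apply Rnot_lt_le. intros Hlt.
    destruct (proj1 (is_CInt_inf_eps f l) Hinf (Cmod l - (M - m))%R) as (a0 & b0 & Ha & Hab); [lra|].
    set (b := (Rmax a0 b0 + 1)%R). assert (M1 := Rmax_l a0 b0). assert (M2 := Rmax_r a0 b0).
    destruct (Hab (a0 / 2)%R b ltac:(lra) ltac:(unfold b; lra)) as (J & HJ & HC).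
    destruct (B (a0 / 2)%R b ltac:(lra) ltac:(unfold b; lra)) as [_ HN].
    rewrite (is_CInt_unique _ _ _ _ HJ) in HN.
    assert (N1 := Hm (a0 / 2)%R ltac:(lra)). assert (N2 := Hm b ltac:(unfold b; lra)).
    assert (N3 := Cmod_triangle_rev l J). rewrite Cmod_sym in N3. lra.
Qed.

(** A larger interval only adds nonnegative real parts. A lower bound by one finite piece preserves
    strict positivity in the limit. *)
Lemma Re_is_CInt_inf_ge (f : R -> C) (l : C) (a1 b1 : R) : 0 < a1 < b1 ->
  (forall t, 0 < t -> 0 <= Re (f t)) -> (forall t, 0 < t -> Rcont f t) -> is_CInt_inf f l ->
  Re (CInt f a1 b1) <= Re l.
Proof.
  intros Hab Hf Hc Hl. apply Rnot_lt_le. intros Hlt.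
  destruct (proj1 (is_CInt_inf_eps f l) Hl (Re (CInt f a1 b1) - Re l)%R) as (a0 & b0 & Ha & H); [lra|].
  set (a := (Rmin a0 a1 / 2)%R). set (b := (Rmax b0 b1 + 1)%R).
  assert (A0 : 0 < Rmin a0 a1) by (apply Rmin_glb_lt; lra).
  assert (A1 := Rmin_l a0 a1). assert (A2 := Rmin_r a0 a1).
  assert (B1 := Rmax_l b0 b1). assert (B2 := Rmax_r b0 b1).
  destruct (H a b ltac:(unfold a; lra) ltac:(unfold b; lra)) as (J & HJ & HC).
  assert (I : forall u v, 0 < u -> u <= v -> is_CInt f u v (CInt f u v))
    by (intros u v Hu Huv; apply CInt_correct; [assumption|]; intros t Ht; apply Hc; lra).
  assert (N : forall u v, 0 < u -> u <= v -> 0 <= Re (CInt f u v)).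
  { intros u v Hu Huv. assert (Huv' := I u v Hu Huv). apply is_CInt_components in Huv'.
    apply (is_RInt_ge_0 (fun t => Re (f t)) u v); [assumption|apply Huv'|].
    intros t Ht. apply Hf. lra. }
  assert (E := is_CInt_Chasles _ _ _ _ _ _ (I a a1 ltac:(unfold a; lra) ltac:(unfold a; lra))
    (is_CInt_Chasles _ _ _ _ _ _ (I a1 b1 ltac:(lra) ltac:(lra)) (I b1 b ltac:(lra) ltac:(unfold b; lra)))).
  assert (EJ : J = CInt f a a1 + (CInt f a1 b1 + CInt f b1 b))
    by (rewrite <- (is_CInt_unique _ _ _ _ HJ); now apply is_CInt_unique).
  assert (N1 := N a a1 ltac:(unfold a; lra) ltac:(unfold a; lra)).
  assert (N2 := N b1 b ltac:(lra) ltac:(unfold b; lra)).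
  assert (R1 := re_le_Cmod (J - l)). assert (R2 := Rle_abs (Re (J - l))).
  assert (RJ : Re J = (Re (CInt f a a1) + (Re (CInt f a1 b1) + Re (CInt f b1 b)))%R) by (rewrite EJ; reflexivity).
  change (Re (J - l)) with (Re J - Re l)%R in *. lra.
Qed.

Lemma Re_is_CInt_inf_nonneg (f : R -> C) (l : C) :
  (forall t, 0 < t -> 0 <= Re (f t)) -> (forall t, 0 < t -> Rcont f t) -> is_CInt_inf f l -> 0 <= Re l.
Proof.
  intros Hf Hc Hl. eapply Rle_trans; [|apply (Re_is_CInt_inf_ge f l 1 2); auto; lra].
  assert (H : is_CInt f 1 2 (CInt f 1 2)) by (apply CInt_correct; [lra|]; intros t Ht; apply Hc; lra).
  apply is_CInt_components in H.
  apply (is_RInt_ge_0 (fun t => Re (f t)) 1 2); [lra|apply H|]. intros t Ht. apply Hf. lra.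
Qed.

(** * The Gamma function *)

Definition gamma_integrand (z : C) (t : R) : C := Cexp ((z - 1) * RtoC (ln t)) * RtoC (exp (- t)).

Lemma Rder_Cexp_ln (z : C) (t : R) : 0 < t ->
  Rder (fun t => Cexp (z * RtoC (ln t))) t (z * Cexp ((z - 1) * RtoC (ln t))).
Proof.
  intros Ht. eapply Rder_eq.
  - apply (Rder_comp (fun u => Cexp (z * RtoC u)) ln t (/ t)%R); [apply Rder_Cexp|].
    auto_derive; [assumption|]. field. lra.
  - replace (z * RtoC (ln t)) with ((z - 1) * RtoC (ln t) + RtoC (ln t)) by ring.
    rewrite Cexp_plus, Cexp_RtoC, exp_ln, RtoC_inv by lra. field.
    intros E. injection E. lra.
Qed.

Lemma Rder_gamma_primitive (z : C) (t : R) : 0 < t ->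
  Rder (fun t => Cexp (z * RtoC (ln t)) * RtoC (exp (- t))) t
    (z * gamma_integrand z t - gamma_integrand (z + 1) t).
Proof.
  intros Ht. eapply Rder_eq.
  - apply Rder_mult; [now apply Rder_Cexp_ln|].
    apply (Rder_RtoC (fun t => exp (- t)) t (- exp (- t))%R). auto_derive; [trivial|ring].
  - unfold gamma_integrand. replace (z + 1 - 1) with z by ring. rewrite RtoC_opp. ring.
Qed.

Lemma gamma_integrand_cont (z : C) (t : R) : 0 < t -> Rcont (gamma_integrand z) t.
Proof.
  (* The primitive for the exponent [z - 1] is the integrand for [z]. *)
  intros Ht. assert (H := Rder_gamma_primitive (z - 1) t Ht). exact (Rder_cont _ _ _ H).
Qed.

Lemma Cmod_gamma_integrand (z : C) (t : R) :
  Cmod (gamma_integrand z t) = exp ((Re z - 1) * ln t - t).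
Proof.
  unfold gamma_integrand. rewrite Cmod_mult, Cmod_Cexp, Cmod_R, Rabs_pos_eq by (left; apply exp_pos).
  rewrite <- exp_plus. f_equal. destruct z; cbn. ring.
Qed.

Lemma ln_le_sub1 (x : R) : 0 < x -> ln x <= x - 1.
Proof. intros H. assert (E := exp_ineq1_le (ln x)). rewrite exp_ln in E by assumption. lra. Qed.

Lemma exp_monotone (x y : R) : x <= y -> exp x <= exp y.
Proof. intros [H|H]; [left; now apply exp_increasing|rewrite H; lra]. Qed.

(* The maximum of [(1 + t)^p e^-t]. *)
Lemma exp_opp_le_power (p t : R) : 0 < p -> 0 < t ->
  - t <= (p * ln p - p + 1) - p * ln (1 + t).
Proof.
  intros Hp Ht. assert (H := ln_le_sub1 ((1 + t) / p)%R ltac:(apply Rdiv_lt_0_compat; lra)).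
  rewrite ln_div in H by lra. apply (Rmult_le_compat_l p) in H; [|lra].
  replace (p * ((1 + t) / p - 1))%R with (1 + t - p)%R in H by (field; lra). lra.
Qed.

Lemma is_CInt_inf_gamma (z : C) : 0 < Re z -> is_CInt_inf (gamma_integrand z) (CGamma z).
Proof.
  intros Hz. set (s := Re z) in *. set (p := (s + 1)%R).
  set (K := exp (p * ln p - p + 1)). assert (HK : 0 < K) by apply exp_pos.
  (* Since [e^-t <= K (1 + t)^-(s + 1)], the integrand is dominated by [K t^(s-1) (1 + t)^-(s+1)],
     whose primitive [(K / s) (t / (1 + t))^s] is explicit and stays between 0 and [K / s]. *)
  destruct (is_CInt_inf_dominated (gamma_integrand z)
    (fun t => K / s * exp (s * (ln t - ln (1 + t))))%R
    (fun t => K * exp ((s - 1) * ln t - p * ln (1 + t)))%R 0 (K / s)) as [l [Hl _]].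
  - intros t Ht. now apply gamma_integrand_cont.
  - intros t Ht. auto_derive; [lra|].
    replace ((s - 1) * ln t - p * ln (1 + t))%R
      with (s * (ln t + - ln (1 + t)) + - ln t + - ln (1 + t))%R by (unfold p; ring).
    rewrite !exp_plus, !exp_Ropp, !exp_ln by lra. field. lra.
  - intros t Ht. apply (ex_derive_continuous (V := R_NormedModule)). auto_derive. lra.
  - intros t Ht. rewrite Cmod_gamma_integrand. fold s. unfold K. rewrite <- exp_plus. apply exp_monotone.
    assert (H := exp_opp_le_power p t ltac:(unfold p; lra) Ht). lra.
  - intros t Ht. assert (HKs : 0 < K / s) by now apply Rdiv_lt_0_compat.
    assert (H1 := exp_pos (s * (ln t - ln (1 + t)))).
    assert (H2 : exp (s * (ln t - ln (1 + t))) <= 1).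
    { apply Rle_trans with (exp 0); [apply exp_monotone|rewrite exp_0; lra].
      assert (ln t < ln (1 + t)) by (apply ln_increasing; lra). nra. }
    split; nra.
  - replace (CGamma z) with l; [assumption|]. symmetry. now apply CInt_0_inf_eq.
Qed.

Lemma gamma_primitive_vanishes_0 (z : C) : 0 < Re z -> forall eps, 0 < eps -> exists a0, 0 < a0 /\
  forall a, 0 < a < a0 -> Cmod (Cexp (z * RtoC (ln a)) * RtoC (exp (- a)) - 0) < eps.
Proof.
  intros Hz eps He. exists (exp (ln eps / Re z)). split; [apply exp_pos|]. intros a Ha.
  replace (Cexp (z * RtoC (ln a)) * RtoC (exp (- a)) - 0) with (gamma_integrand (z + 1) a)
    by (unfold gamma_integrand; replace (z + 1 - 1) with z by ring; ring).
  rewrite Cmod_gamma_integrand. rewrite <- (exp_ln eps) by assumption. apply exp_increasing.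
  replace (Re (z + 1) - 1)%R with (Re z) by (destruct z; cbn; ring).
  assert (H : ln a < ln eps / Re z).
  { rewrite <- (ln_exp (ln eps / Re z)). apply ln_increasing; lra. }
  apply (Rmult_lt_compat_l (Re z)) in H; [|assumption].
  replace (Re z * (ln eps / Re z))%R with (ln eps) in H by (field; lra). lra.
Qed.

Lemma gamma_primitive_vanishes_inf (z : C) : 0 < Re z -> forall eps, 0 < eps -> exists b0,
  forall b, b0 < b -> Cmod (Cexp (z * RtoC (ln b)) * RtoC (exp (- b)) - 0) < eps.
Proof.
  intros Hz eps He. set (p := (Re z + 1)%R). set (K := (p * ln p - p + 1)%R).
  (* The modulus is at most [e^K b^s (1 + b)^-(s + 1)], where [s = Re z], hence below [e^K / b]. *)
  exists (exp (K - ln eps)). intros b Hb. assert (Hb0 := exp_pos (K - ln eps)).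
  replace (Cexp (z * RtoC (ln b)) * RtoC (exp (- b)) - 0) with (gamma_integrand (z + 1) b)
    by (unfold gamma_integrand; replace (z + 1 - 1) with z by ring; ring).
  rewrite Cmod_gamma_integrand. rewrite <- (exp_ln eps) by assumption. apply exp_increasing.
  replace (Re (z + 1) - 1)%R with (Re z) by (destruct z; cbn; ring).
  assert (H := exp_opp_le_power p b ltac:(unfold p; lra) ltac:(lra)). fold K in H.
  assert (H1 : K - ln eps < ln b) by (rewrite <- (ln_exp (K - ln eps)); apply ln_increasing; lra).
  assert (H2 : ln b < ln (1 + b)) by (apply ln_increasing; lra).
  unfold p in *. nra.
Qed.

(** Integration by parts: the primitive [t^z e^-t] vanishes at both ends. *)
Theorem CGamma_plus_1 (z : C) : 0 < Re z -> CGamma (z + 1) = z * CGamma z.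
Proof.
  intros Hz.
  assert (H1 := is_CInt_inf_gamma z Hz).
  assert (H2 := is_CInt_inf_gamma (z + 1) ltac:(destruct z; cbn in *; lra)).
  assert (H3 := is_CInt_inf_minus _ _ _ _ (is_CInt_inf_Cmult z _ _ H1) H2).
  assert (H4 : is_CInt_inf (fun t => z * gamma_integrand z t - gamma_integrand (z + 1) t) (0 - 0)).
  { apply (is_CInt_inf_Rder (fun t => Cexp (z * RtoC (ln t)) * RtoC (exp (- t)))).
    - intros t Ht. now apply Rder_gamma_primitive.
    - intros t Ht. apply Rcont_minus; [|now apply gamma_integrand_cont].
      apply (Rcont_mult (fun _ => z)); [apply Rcont_const|now apply gamma_integrand_cont].
    - now apply gamma_primitive_vanishes_0.
    - now apply gamma_primitive_vanishes_inf. }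
  assert (E := is_CInt_inf_unique _ _ _ H3 H4).
  replace (z * CGamma z) with (z * CGamma z - CGamma (z + 1) + CGamma (z + 1)) by ring.
  rewrite E. ring.
Qed.

Lemma CGamma_1 : CGamma 1 = 1.
Proof.
  apply CInt_0_inf_eq. apply is_CInt_inf_ext with (fun t => RtoC (exp (- t))).
  - intros t Ht. replace ((1 - 1) * RtoC (ln t)) with (RtoC 0) by ring. rewrite Cexp_0. ring.
  - replace (RtoC 1) with (0 - - (1)) by ring.
    apply (is_CInt_inf_Rder (fun t => RtoC (- exp (- t)))).
    + intros t Ht. apply Rder_RtoC. auto_derive; [trivial|ring].
    + intros t Ht. eapply Rder_cont. apply (Rder_RtoC (fun t => exp (- t))). auto_derive; [trivial|reflexivity].
    + intros eps He. destruct (is_derive_eps exp 0 1 ltac:(auto_derive; [trivial|rewrite exp_0; ring]) 1 ltac:(lra))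
        as [d [Hd H]].
      exists (Rmin d (eps / 2)). split; [apply Rmin_glb_lt; lra|]. intros a Ha.
      assert (A1 := Rmin_l d (eps / 2)). assert (A2 := Rmin_r d (eps / 2)).
      replace (RtoC (- exp (- a)) - - (1)) with (RtoC (1 - exp (- a))) by (rewrite RtoC_minus, RtoC_opp; ring).
      assert (E1 := exp_ineq1_le (- a)). assert (E2 : exp (- a) <= 1) by (rewrite <- exp_0; apply exp_monotone; lra).
      rewrite Cmod_R, Rabs_pos_eq by lra. lra.
    + intros eps He. exists (- ln eps)%R. intros b Hb.
      replace (RtoC (- exp (- b)) - 0) with (RtoC (- exp (- b))) by ring.
      rewrite Cmod_R, Rabs_Ropp, Rabs_pos_eq by (left; apply exp_pos).
      rewrite <- (exp_ln eps) by assumption. apply exp_increasing. lra.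
Qed.

(** * Rising factorials and the zeros of Gamma *)

Fixpoint rising (z : C) (n : nat) : C :=
  match n with O => 1 | S n => rising z n * (z + RtoC (INR n)) end.

Lemma rising_neq_0 (z : C) (n : nat) : 0 < Re z -> rising z n <> 0.
Proof.
  intros Hz. induction n as [|n IH]; cbn [rising].
  - intros E. injection E. lra.
  - apply Cmult_neq_0; [assumption|]. intros E. apply (f_equal Re) in E.
    assert (H := pos_INR n). destruct z; cbn in *; lra.
Qed.

Lemma CGamma_plus_nat (z : C) (n : nat) : 0 < Re z ->
  CGamma (z + RtoC (INR n)) = rising z n * CGamma z.
Proof.
  intros Hz. induction n as [|n IH].
  - cbn [rising INR]. replace (z + 0) with z by ring. ring.
  - rewrite S_INR, RtoC_plus. replace (z + (RtoC (INR n) + 1)) with (z + RtoC (INR n) + 1) by ring.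
    rewrite CGamma_plus_1, IH; [cbn [rising]; ring|].
    assert (H := pos_INR n). destruct z; cbn in *; lra.
Qed.

Lemma CGamma_fact (n : nat) : CGamma (RtoC (INR n + 1)) = RtoC (INR (Factorial.fact n)).
Proof.
  rewrite Rplus_comm, RtoC_plus, CGamma_plus_nat, CGamma_1 by (cbn; lra).
  induction n as [|n IH]; [cbn; ring|].
  change (Factorial.fact (S n)) with (S n * Factorial.fact n)%nat. rewrite mult_INR, RtoC_mult.
  replace (RtoC (INR (Factorial.fact n))) with (rising 1 n * 1) by exact IH.
  cbn [rising]. rewrite S_INR, RtoC_plus. ring.
Qed.

(** From [1 - cos v = 2 sin^2 (v / 2)] and [|sin x| <= |x|]. *)
Lemma cos_ge_quadratic (v : R) : 1 - v * v / 2 <= cos v.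
Proof.
  assert (S1 : forall x, 0 <= x -> sin x * sin x <= x * x).
  { intros x Hx. destruct (Rle_dec x 1) as [H|H].
    - assert (A1 : sin x <= x) by (destruct Hx as [Hx|<-]; [left; now apply sin_lt_x|rewrite sin_0; lra]).
      assert (A2 : 0 <= sin x) by (apply sin_ge_0; [assumption|assert (P := PI_RGT_0); assert (P2 := PI2_1); lra]).
      nra.
    - assert (A := SIN_bound x). nra. }
  replace v with (2 * (v / 2))%R at 3 by field. rewrite cos_2a_sin.
  destruct (Rle_dec 0 v) as [H|H].
  - assert (A := S1 (v / 2)%R ltac:(lra)). lra.
  - assert (A := S1 (- (v / 2))%R ltac:(lra)). rewrite sin_neg in A. lra.
Qed.

(** The right side is [4 sinh^2 (u / 2)], and [sinh v >= v] for [v >= 0] because [cosh >= 1]. *)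
Lemma sqr_le_exp_plus_exp_opp (u : R) : u * u <= exp u + exp (- u) - 2.
Proof.
  assert (S1 : forall v, 0 <= v -> 2 * v <= exp v - exp (- v)).
  { intros v Hv. destruct (MVT_gen (fun v => exp v - exp (- v) - 2 * v)%R 0 v
      (fun v => exp v + exp (- v) - 2)%R) as (c & _ & E).
    - intros x _. auto_derive; [trivial|ring].
    - intros x _. apply continuity_pt_filterlim. apply (ex_derive_continuous (V := R_NormedModule) (fun v => exp v - exp (- v) - 2 * v)%R).
      auto_derive. trivial.
    - rewrite Ropp_0, exp_0 in E.
      assert (0 <= exp c + exp (- c) - 2).
      { assert (A := exp_pos c). assert (B := exp_pos (- c)).
        assert (C1 : (exp c * exp (- c) = 1)%R) by (rewrite <- exp_plus, Rplus_opp_r; apply exp_0).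
        assert (D := Rle_0_sqr (exp c - exp (- c))). unfold Rsqr in D. nra. }
      nra. }
  assert (S2 : forall w, 0 <= w -> w * w <= exp w + exp (- w) - 2).
  { intros w Hw. assert (A := S1 (w / 2)%R ltac:(lra)).
    replace (exp w) with (exp (w / 2) * exp (w / 2))%R by (rewrite <- exp_plus; f_equal; field).
    replace (exp (- w)) with (exp (- (w / 2)) * exp (- (w / 2)))%R by (rewrite <- exp_plus; f_equal; field).
    assert (C1 : (exp (w / 2) * exp (- (w / 2)) = 1)%R) by (rewrite <- exp_plus, Rplus_opp_r; apply exp_0).
    nra. }
  destruct (Rle_dec 0 u) as [H|H]; [now apply S2|].
  assert (A := S2 (- u)%R ltac:(lra)). rewrite Ropp_involutive in A. lra.
Qed.

Lemma gamma_integrand_real (s t : R) :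
  gamma_integrand (RtoC s) t = RtoC (exp ((s - 1) * ln t - t)).
Proof.
  unfold gamma_integrand. rewrite <- RtoC_minus, <- RtoC_mult, Cexp_RtoC, <- RtoC_mult, <- exp_plus.
  reflexivity.
Qed.

Lemma Re_CGamma_pos (s : R) : 0 < s -> 0 < Re (CGamma (RtoC s)).
Proof.
  intros Hs. assert (H := is_CInt_inf_gamma (RtoC s) Hs).
  assert (Hp : forall t, 0 < Re (gamma_integrand (RtoC s) t))
    by (intros t; rewrite gamma_integrand_real; apply exp_pos).
  assert (Hc : forall t, 0 < t -> Rcont (gamma_integrand (RtoC s)) t)
    by (intros t Ht; now apply gamma_integrand_cont).
  eapply Rlt_le_trans; [|apply (Re_is_CInt_inf_ge _ _ 1 2 ltac:(lra) (fun t _ => Rlt_le _ _ (Hp t)) Hc H)].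
  assert (I : is_CInt (gamma_integrand (RtoC s)) 1 2 (CInt (gamma_integrand (RtoC s)) 1 2))
    by (apply CInt_correct; [lra|]; intros t Ht; apply Hc; lra).
  apply is_CInt_components in I. destruct I as [I _]. apply (is_RInt_unique (V := R_CompleteNormedModule)) in I.
  change (0 < Re (CInt (gamma_integrand s) 1 2))%R. rewrite <- I.
  apply RInt_gt_0; [lra|intros t _; apply Hp|].
  intros t Ht. apply (Rcont_components (gamma_integrand (RtoC s)) t). apply Hc. lra.
Qed.

(* With [w t = t^(s-1) e^-t], [Re (Gamma (s + i u) s^(-i u))] is the integral of
   [cos (u ln (t/s)) w t >= (1 - u^2 (t/s + s/t - 2) / 2) w t], whose integral is explicit. *)
Lemma CGamma_neq_0_large (s u : R) : 1 < s -> u * u < 2 * (s - 1) -> CGamma (s, u) <> 0.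
Proof.
  intros Hs Hu E. set (z := (s, u) : C).
  assert (Hg := Re_CGamma_pos s ltac:(lra)).
  assert (I0 := is_CInt_inf_gamma z ltac:(cbn; lra)). unfold z in I0. rewrite E in I0. fold z in I0.
  assert (I1 := is_CInt_inf_gamma (RtoC s) ltac:(cbn; lra)).
  assert (I2 := is_CInt_inf_gamma (RtoC s + 1) ltac:(cbn; lra)).
  assert (I3 := is_CInt_inf_gamma (RtoC s - 1) ltac:(cbn; lra)).
  assert (E2 := CGamma_plus_1 (RtoC s) ltac:(cbn; lra)).
  assert (E3 := CGamma_plus_1 (RtoC s - 1) ltac:(cbn; lra)).
  replace (RtoC s - 1 + 1) with (RtoC s) in E3 by ring.
  set (G := CGamma (RtoC s)) in *.
  pose (c := Cexp (0, - (u * ln s))%R).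
  set (k := (u * u / 2)%R).
  (* If [CGamma z] were 0, this combination would integrate to [(k / (s - 1) - 1) * G], of negative
     real part because [k < s - 1]; yet its integrand has nonnegative real part, by the two
     inequalities just proved. *)
  assert (I := is_CInt_inf_plus _ _ _ _ (is_CInt_inf_minus _ _ _ _
      (is_CInt_inf_Cmult c _ _ I0) (is_CInt_inf_Cmult (RtoC (1 + 2 * k)) _ _ I1))
    (is_CInt_inf_plus _ _ _ _ (is_CInt_inf_Cmult (RtoC (k / s)) _ _ I2)
      (is_CInt_inf_Cmult (RtoC (k * s)) _ _ I3))).
  apply Re_is_CInt_inf_nonneg in I.
  - assert (HG : CGamma (RtoC s - 1) = RtoC (/ (s - 1)) * G).
    { rewrite E3, <- RtoC_minus, Cmult_assoc, <- RtoC_mult, Rinv_l by lra. ring. }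
    rewrite HG, E2 in I.
    assert (EI : c * 0 - RtoC (1 + 2 * k) * G + (RtoC (k / s) * (RtoC s * G)
      + RtoC (k * s) * (RtoC (/ (s - 1)) * G)) = RtoC (- 1 + k / (s - 1)) * G).
    { replace (- 1 + k / (s - 1))%R with (- (1 + 2 * k) + (k / s * s + k * s * / (s - 1)))%R by (field; lra).
      rewrite !RtoC_plus, !RtoC_mult, RtoC_opp, !RtoC_plus, !RtoC_mult. ring. }
    rewrite EI in I.
    assert (HR : Re (RtoC (- 1 + k / (s - 1)) * G) = ((- 1 + k / (s - 1)) * Re G)%R) by (cbn; unfold Re; ring).
    rewrite HR in I.
    assert (Hk : k / (s - 1) < 1).
    { apply (Rmult_lt_reg_r (s - 1)); [lra|]. unfold Rdiv at 1. rewrite Rmult_assoc, Rinv_l by lra.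
      unfold k. lra. }
    nra.
  - intros t Ht. replace (RtoC s + 1) with (RtoC (s + 1)) by (rewrite RtoC_plus; ring).
    replace (RtoC s - 1) with (RtoC (s - 1)) by (rewrite RtoC_minus; ring).
    rewrite !gamma_integrand_real.
    set (w := exp ((s - 1) * ln t - t)).
    assert (Hw : 0 < w) by apply exp_pos.
    assert (Ew1 : exp ((s + 1 - 1) * ln t - t) = (w * t)%R).
    { replace ((s + 1 - 1) * ln t - t)%R with (((s - 1) * ln t - t) + ln t)%R by ring.
      now rewrite exp_plus, (exp_ln t). }
    assert (Ew2 : exp ((s - 1 - 1) * ln t - t) = (w * / t)%R).
    { replace ((s - 1 - 1) * ln t - t)%R with (((s - 1) * ln t - t) + - ln t)%R by ring.
      now rewrite exp_plus, exp_Ropp, (exp_ln t). }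
    rewrite Ew1, Ew2.
    assert (Ez : c * gamma_integrand z t = Cexp (0, u * (ln t - ln s))%R * RtoC w).
    { unfold gamma_integrand, c, w.
      replace (RtoC (exp (- t))) with (Cexp (RtoC (- t))) by apply Cexp_RtoC.
      replace (RtoC (exp ((s - 1) * ln t - t))) with (Cexp (RtoC ((s - 1) * ln t - t))) by apply Cexp_RtoC.
      rewrite <- !Cexp_plus. f_equal. unfold z, Cplus, Cmult, Cminus, Copp, RtoC; cbn. f_equal; ring. }
    rewrite Ez. clearbody w. unfold Cexp, Cmult, Cplus, Cminus, Copp, RtoC, Re, Im; cbn.
    rewrite exp_0. set (v := (u * (ln t - ln s))%R).
    assert (A1 := cos_ge_quadratic v).
    assert (A2 := sqr_le_exp_plus_exp_opp (ln t - ln s)).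
    rewrite Ropp_minus_distr in A2. 
    assert (Ed : forall x y, 0 < x -> 0 < y -> exp (ln x - ln y) = (x * / y)%R)
      by (intros x y Hx Hy; unfold Rminus; now rewrite exp_plus, exp_Ropp, !exp_ln).
    rewrite !Ed in A2 by lra.
    assert (A3 : v * v / 2 <= k * (t * / s + s * / t - 2)).
    { replace (v * v / 2)%R with (k * ((ln t - ln s) * (ln t - ln s)))%R by (unfold v, k; field).
      apply Rmult_le_compat_l; [unfold k; nra|]. lra. }
    apply Rle_trans with (w * (cos v - (1 + 2 * k) + k * (t * / s + s * / t)))%R; [nra|].
    right. field. lra.
  - assert (Rc : forall a y t, 0 < t -> Rcont (fun t => a * gamma_integrand y t) t)
      by (intros a y t Ht; apply (Rcont_mult (fun _ => a)); [apply Rcont_const|now apply gamma_integrand_cont]).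
    intros t Ht. apply Rcont_plus; [apply Rcont_minus|apply Rcont_plus]; now apply Rc.
Qed.

(** A zero at [z] would propagate to [z + n] by the functional equation, and for large [n] the
    imaginary part is small enough compared with the real part. *)
Theorem CGamma_neq_0 (z : C) : 0 < Re z -> CGamma z <> 0.
Proof.
  intros Hz E. destruct (INR_unbounded (1 + Im z * Im z)) as [n Hn].
  assert (H := CGamma_plus_nat z n Hz). rewrite E in H.
  apply (CGamma_neq_0_large (Re z + INR n) (Im z)); [|nra|].
  - assert (0 <= Im z * Im z) by nra. lra.
  - replace ((Re z + INR n)%R, Im z) with (z + RtoC (INR n)).
    + rewrite H. ring.
    + destruct z; unfold Cplus, RtoC; cbn. f_equal; ring.
Qed.

(** * The pullback to the unit disc *)

Lemma Re_one_minus_pos (u : C) : Cmod u < 1 -> 0 < Re (1 - u).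
Proof.
  intros H. assert (H1 := re_le_Cmod u). assert (H2 := Rle_abs (Re u)). destruct u; cbn in *. lra.
Qed.

(** Meant for [1 - (c + (1 - c) v) = (1 - c) (1 - v)]: a positive real factor leaves the argument
    unchanged. *)
Lemma Clog_scale (k : R) (s : C) : 0 < k -> 0 < Re s -> Clog (RtoC k * s) = RtoC (ln k) + Clog s.
Proof.
  intros Hk Hs.
  assert (Hs0 : 0 < Cmod s).
  { eapply Rlt_le_trans; [exact Hs|]. eapply Rle_trans; [apply Rle_abs|apply re_le_Cmod]. }
  assert (Er : Re (RtoC k * s) = (k * Re s)%R) by (destruct s; cbn; ring).
  assert (Ei : Im (RtoC k * s) = (k * Im s)%R) by (destruct s; cbn; ring).
  unfold Clog. rewrite !Carg_pos by (rewrite ?Er; nra). rewrite Er, Ei.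
  rewrite Cmod_mult, Cmod_R, Rabs_pos_eq, ln_mult by lra.
  unfold Cplus, RtoC; cbn. f_equal. rewrite Rplus_0_l. f_equal. unfold Re, Im in *. field. lra.
Qed.

Lemma Clog_real (x : R) : 0 < x -> Clog (RtoC x) = RtoC (ln x).
Proof.
  intros Hx. replace (RtoC x) with (RtoC x * 1) by ring. rewrite Clog_scale by (cbn; lra).
  unfold Clog at 1. rewrite Carg_pos, Cmod_1, ln_1 by (cbn; lra). cbn.
  replace (0 / 1)%R with 0%R by field. rewrite atan_0. unfold Cplus, RtoC; cbn. f_equal; ring.
Qed.

(* Integrate [d/dr Clog (1 - r u) = - u / (1 - r u)] along the radius. *)
Lemma Cmod_Clog_le (u : C) : Cmod u < 1 -> Cmod (Clog (1 - u)) <= - ln (1 - Cmod u).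
Proof.
  intros Hu. set (rho := Cmod u) in *. assert (Hr0 : 0 <= rho) by apply Cmod_ge_0.
  assert (Hru : forall r, 0 <= r <= 1 -> Cmod (RtoC r * u) < 1).
  { intros r Hr. rewrite Cmod_mult, Cmod_R, Rabs_pos_eq by lra. fold rho. nra. }
  assert (Hne : forall r, 0 <= r <= 1 -> 1 - RtoC r * u <> 0).
  { intros r Hr E. assert (H := Re_one_minus_pos _ (Hru r Hr)). rewrite E in H. cbn in H. lra. }
  pose (dg := fun r : R => - u / (1 - RtoC r * u)).
  assert (I : is_CInt dg 0 1 (Clog (1 - u))).
  (* [Clog (1 - r u)] in coordinates, explicit enough in [r] for [auto_derive]. *)
  { pose (g := fun r : R => ((/ 2 * ln ((1 - r * Re u) * (1 - r * Re u) + (r * Im u) * (r * Im u)))%R,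
                              atan (- (r * Im u) / (1 - r * Re u))) : C).
    replace (Clog (1 - u)) with (g 1%R - g 0%R).
    - apply is_CInt_Rder; [lra| |].
      + intros r Hr. assert (H := Re_one_minus_pos _ (Hru r Hr)).
        unfold g, dg. destruct u as [a b]. cbn in H.
        assert (H' : (0 < 1 - r * a)%R) by lra.
        assert (H2 : (0 < (1 - r * a) * (1 - r * a) + r * b * (r * b))%R) by nra.
        split; unfold Re, Im; cbn.
        * auto_derive; [lra|]. field. nra.
        * auto_derive; [lra|]. unfold Rsqr. field. split; nra.
      + intros r Hr.
        apply (Rcont_of_Ccont (fun w => - u / (1 - w * u)) RtoC).
        * intros y. rewrite <- RtoC_minus, Cmod_R. lra.
        * apply Ccont_mult; [apply Ccont_const|].
          apply (Ccont_comp (fun w => 1 - w * u) Cinv); [|apply Ccont_inv, Hne; lra].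
          apply (Ccont_ext_loc (fun w => 1 + w * - u)); [apply Cnear_forall; intros w; ring|].
          apply Ccont_plus; [apply Ccont_const|]. apply Ccont_mult; [apply Ccont_id|apply Ccont_const].
    - unfold Clog. rewrite Carg_pos by now apply Re_one_minus_pos.
      assert (H := Re_one_minus_pos u Hu). unfold g, Cmod. destruct u as [a b]. cbn in *.
      rewrite <- Rpower_sqrt by nra. unfold Rpower. rewrite ln_exp.
      unfold Cminus, Cplus, Copp; cbn. f_equal.
      + replace ((1 - 0 * a) * (1 - 0 * a) + 0 * b * (0 * b))%R with 1%R by ring. rewrite ln_1.
        rewrite Rmult_0_r, Ropp_0, Rplus_0_r. f_equal. f_equal. ring.
      + replace (- (0 * b) / (1 - 0 * a))%R with 0%R by (field; lra). rewrite atan_0, Ropp_0, Rplus_0_r.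
        f_equal. field. lra. }
  rewrite <- Cmod_C_R_norm.
  apply (norm_RInt_le (V := C_R_NormedModule) dg (fun r => rho / (1 - r * rho))%R 0 1); [lra| |exact I|].
  - intros r Hr. rewrite Cmod_C_R_norm. unfold dg. rewrite Cmod_div, Cmod_opp by now apply Hne.
    fold rho. assert (H := Cmod_triangle_rev 1 (RtoC r * u)).
    rewrite Cmod_1, Cmod_mult, Cmod_R, Rabs_pos_eq in H by lra. fold rho in H.
    apply Rmult_le_compat_l; [assumption|]. apply Rinv_le_contravar; [nra|assumption].
  - replace (- ln (1 - rho))%R with (minus (- ln (1 - 1 * rho)) (- ln (1 - 0 * rho)))%R.
    + apply (is_RInt_derive (V := R_CompleteNormedModule) (fun r => - ln (1 - r * rho))%R);
        intros r; rewrite Rmin_left, Rmax_right by lra; intros Hr; assert (0 < 1 - r * rho)%R by nra.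
      * auto_derive; [lra|]. field. lra.
      * apply (ex_derive_continuous (V := R_NormedModule)). auto_derive. lra.
    + unfold minus, plus, opp; cbn. rewrite Rmult_0_l, Rminus_0_r, ln_1, Rmult_1_l. ring.
Qed.

Lemma RtoC_neq_0_fact (n : nat) : RtoC (INR (Factorial.fact n)) <> 0.
Proof. intros E. injection E. apply INR_fact_neq_0. Qed.

(** * Derivatives of the pullback: growth, and values at 0 *)

Section Remainder.

Variables (F : C -> C) (A B : R).
Hypothesis F_diff : forall zeta : C, DeltaDom zeta ->
  ex_derive (K := C_AbsRing) (V := C_NormedModule) F zeta.
Hypothesis A_pos : 0 < A.
Hypothesis B_pos : 0 < B.
Hypothesis F_bound : forall zeta : C, DeltaDom zeta -> Cmod (F zeta) <= A * exp (B * Cmod zeta).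

Definition disc_fun (u : C) : C := F (- Clog (1 - u)).

Lemma DeltaDom_disc (u : C) : Cmod u < 1 -> DeltaDom (- Clog (1 - u)).
Proof.
  intros Hu. exists (1 - u). split; [|reflexivity].
  replace (1 - u - 1) with (- u) by ring. now rewrite Cmod_opp.
Qed.

Lemma Cdiff_disc_fun (u : C) : Cmod u < 1 -> exists l, Cdiff disc_fun u l.
Proof.
  intros Hu. destruct (Cdiff_ex_derive F _ (F_diff _ (DeltaDom_disc u Hu))) as [l Hl].
  eexists. apply (Cdiff_comp (fun u => - Clog (1 - u)) F); [|exact Hl].
  apply Cdiff_ext_loc with (fun u => - (1) * Clog (1 + - (1) * u)).
  - apply Cnear_forall. intros w. replace (1 + - (1) * w) with (1 - w) by ring. ring.
  - apply (Cdiff_mult (fun _ => - (1))); [apply Cdiff_const|].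
    apply (Cdiff_comp (fun w => 1 + - (1) * w) Clog).
    + apply (Cdiff_plus (fun _ => RtoC 1)); [apply Cdiff_const|].
      apply (Cdiff_mult (fun _ => - (1))); [apply Cdiff_const|apply Cdiff_id].
    + apply Cdiff_Clog. replace (1 + - (1) * u) with (1 - u) by ring. now apply Re_one_minus_pos.
Qed.

Lemma Cmod_subdisc (c : R) (v : C) : 0 <= c < 1 -> Cmod v < 1 -> Cmod (RtoC c + RtoC (1 - c) * v) < 1.
Proof.
  intros Hc Hv. eapply Rle_lt_trans; [apply Cmod_triangle|].
  rewrite Cmod_mult, !Cmod_R, !Rabs_pos_eq by lra. nra.
Qed.

Lemma disc_fun_bound (c : R) (v : C) : 0 <= c < 1 -> Cmod v < 1 ->
  Cmod (disc_fun (RtoC c + RtoC (1 - c) * v)) <= A * exp (B * (- ln (1 - c) - ln (1 - Cmod v))).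
Proof.
  intros Hc Hv. unfold disc_fun.
  eapply Rle_trans; [apply F_bound, DeltaDom_disc, Cmod_subdisc; assumption|].
  apply Rmult_le_compat_l; [lra|]. apply exp_monotone. apply Rmult_le_compat_l; [lra|].
  rewrite Cmod_opp.
  replace (1 - (RtoC c + RtoC (1 - c) * v)) with (RtoC (1 - c) * (1 - v)) by (rewrite RtoC_minus; ring).
  rewrite Clog_scale by (try lra; now apply Re_one_minus_pos).
  eapply Rle_trans; [apply Cmod_triangle|]. rewrite Cmod_R.
  assert (Hl : ln (1 - c) <= 0).
  { assert (H := ln_le_sub1 (1 - c) ltac:(lra)). lra. }
  rewrite Rabs_left1 by assumption. assert (H := Cmod_Clog_le v Hv). lra.
Qed.

Lemma disc_fun_deriv_seq : exists g : nat -> R -> C,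
  deriv_seq g (-1) 1 /\ (forall x, Rabs x < 1 -> g O x = disc_fun (RtoC x)).
Proof.
  destruct (deriv_seq_of_pseries (taylor_coef disc_fun) (fun x => disc_fun (RtoC x)) 1) as (g & H1 & H2 & _).
  - lra.
  - intros x Hx eps He. apply (taylor_converges disc_fun Cdiff_disc_fun (RtoC x)); [|assumption].
    now rewrite Cmod_R.
  - exists g. split; [|assumption]. intros n x Hx. apply H1. lra.
Qed.

Variable g : nat -> R -> C.
Hypothesis g_deriv : deriv_seq g (-1) 1.
Hypothesis g_0 : forall x, Rabs x < 1 -> g O x = disc_fun (RtoC x).

Lemma disc_deriv_bound (n : nat) (c r : R) : 0 <= c < 1 -> 0 < r < 1 ->
  Cmod (g n c) * (1 - c) ^ n * r ^ n
  <= INR (Factorial.fact n) * (A * exp (B * (- ln (1 - c) - ln (1 - r)))).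
Proof.
  intros Hc Hr.
  pose (fc := fun v => disc_fun (RtoC c + RtoC (1 - c) * v)).
  assert (Hfc : forall v, Cmod v < 1 -> exists l, Cdiff fc v l).
  { intros v Hv. destruct (Cdiff_disc_fun _ (Cmod_subdisc c v Hc Hv)) as [l Hl].
    eexists. apply (Cdiff_comp (fun v => RtoC c + RtoC (1 - c) * v) disc_fun); [|exact Hl].
    apply (Cdiff_plus (fun _ => RtoC c)); [apply Cdiff_const|].
    apply (Cdiff_mult (fun _ => RtoC (1 - c))); [apply Cdiff_const|apply Cdiff_id]. }
  destruct (deriv_seq_of_pseries (taylor_coef fc) (fun x => fc (RtoC x)) 1) as (k & K1 & K2 & K3).
  { lra. }
  { intros x Hx eps He. apply (taylor_converges fc Hfc (RtoC x)); [|assumption]. now rewrite Cmod_R. }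
  (* The rescaled sequence and the one given by the Taylor series of [fc] start from the same
     function on [(-1, 1)], so they agree at 0. Cauchy's estimate for [fc] thus reaches [g n c]. *)
  assert (E : RtoC ((1 - c) ^ n) * g n (c + (1 - c) * 0)%R = k n 0%R).
  { apply (deriv_seq_unique (fun n y => RtoC ((1 - c) ^ n) * g n (c + (1 - c) * y)%R) k (-1) 1); [| | |lra].
    - intros m y Hy. eapply Rder_eq.
      + apply (Rder_mult (fun _ => RtoC ((1 - c) ^ m))); [apply Rder_const|].
        apply (Rder_comp (g m) (fun y => c + (1 - c) * y)%R y (1 - c)%R).
        * apply g_deriv. nra.
        * auto_derive; [trivial|ring].
      + cbn [pow]. rewrite RtoC_mult. ring.
    - intros m y Hy. apply K1. lra.
    - intros y Hy. rewrite K2 by (apply Rabs_def1; lra). cbn [pow]. unfold fc.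
      rewrite g_0 by (apply Rabs_def1; nra). rewrite RtoC_plus, RtoC_mult. ring. }
  replace (c + (1 - c) * 0)%R with c in E by ring.
  assert (H := Cauchy_estimate fc Hfc n r (A * exp (B * (- ln (1 - c) - ln (1 - r)))) Hr).
  specialize (H ltac:(intros u Hu; rewrite <- Hu; apply disc_fun_bound; lra)).
  rewrite K3 in E. apply (f_equal Cmod) in E. rewrite !Cmod_mult, !Cmod_R in E.
  rewrite !Rabs_pos_eq in E by (try apply pos_INR; apply pow_le; lra).
  apply (Rmult_le_compat_l (INR (Factorial.fact n))) in H; [|apply pos_INR].
  replace (Cmod (g n c) * (1 - c) ^ n * r ^ n)%R with ((1 - c) ^ n * Cmod (g n c) * r ^ n)%R by ring.
  rewrite E. lra.
Qed.

(** Near 0 the pullback is the Borel series composed with [- ln (1 - x)]; the explicit derivatives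
    of that composition must coincide with [g]. *)
Lemma disc_deriv_at_0 (a : nat -> C) (r : R) (n : nat) : 0 < r ->
  (forall zeta : C, Cmod zeta < r ->
    is_pseries (K := C_AbsRing) (V := C_NormedModule) (borel_coef a) zeta (F zeta)) ->
  g n 0%R = RtoC (INR (Factorial.fact n)) * bcoef a n.
Proof.
  intros Hr HF.
  destruct (deriv_seq_of_pseries (borel_coef a) (fun x => F (RtoC x)) r Hr) as (p & P1 & P2 & P3).
  { intros x Hx eps He. assert (He2 : (0 < eps / 2)%R) by lra.
    specialize (HF (RtoC x) ltac:(now rewrite Cmod_R)).
    assert (Hb : locally (T := C_UniformSpace) (F (RtoC x)) (fun w => Cmod (w - F (RtoC x)) < eps)).
    { apply locally_C. apply (Cnear_intro _ eps); auto. }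
    destruct (HF _ Hb) as [n0 Hn0]. exists n0. intros m Hm. specialize (Hn0 m Hm).
    rewrite (sum_n_ext (G := C_AbelianMonoid) _ (fun k => scal (V := C_NormedModule) (pow_n (RtoC x) k) (borel_coef a k))).
    - exact Hn0.
    - intros k. replace (pow_n (RtoC x) k) with (RtoC x ^ k).
      + match goal with |- @eq _ ?u ?v => change (@eq C u v) end. apply Cmult_comm.
      + induction k as [|k IH]; cbn; [reflexivity|]. now rewrite IH. }
  (* The interval where [|ln (1 - x)| < r], cut at -1 to stay in the domain of [g]. *)
  set (lo := Rmax (-1) (1 - exp r)). set (hi := (1 - exp (- r))%R).
  assert (E1 := exp_pos (- r)). assert (E2 : exp (- r) < 1) by (apply exp_lt_1; lra).
  assert (E3 : 1 < exp r) by (rewrite <- exp_0; apply exp_increasing; lra).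
  assert (L1 : -1 <= lo) by apply Rmax_l. assert (L2 : 1 - exp r <= lo) by apply Rmax_r.
  assert (L3 : lo < 0) by (apply Rmax_lub_lt; lra).
  assert (Hlog : forall x, lo < x < hi -> - r < - ln (1 - x) < r).
  { intros x Hx. unfold hi in Hx. split.
    - apply Ropp_lt_contravar. rewrite <- (ln_exp r). apply ln_increasing; lra.
    - rewrite <- (Ropp_involutive r), <- (ln_exp (- r)). apply Ropp_lt_contravar.
      apply ln_increasing; lra. }
  assert (D := deriv_seq_comp_log p r P1 lo hi ltac:(unfold hi; lra) Hlog).
  rewrite (deriv_seq_unique g _ lo hi) with (2 := D); [| | |unfold hi; lra].
  (* At 0 the [k]-th derivative of the Borel series is [k! * (a (S k) / k!) = a (S k)]. *)
  - rewrite Rminus_0_r, Rinv_1, pow1, ln_1, Ropp_0, Cmult_1_l. rewrite bcoef_stirling_sum.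
    rewrite Cmult_assoc, Cinv_r, Cmult_1_l by (apply RtoC_neq_0_fact).
    unfold stirling_sum. apply sum_n_ext. intros k. f_equal. rewrite P3. unfold borel_coef.
    field. apply RtoC_neq_0_fact.
  - intros m x Hx. apply g_deriv. unfold hi in Hx. lra.
  - intros x Hx. rewrite g_0 by (unfold hi in Hx; apply Rabs_def1; lra).
    unfold stirling_sum. rewrite sum_O. unfold ustirling1R. rewrite stirling1R_00. cbn [pow Nat.sub].
    rewrite P2 by (specialize (Hlog x Hx); apply Rabs_def1; lra).
    unfold disc_fun. rewrite <- RtoC_minus, Clog_real by (unfold hi in Hx; lra).
    rewrite RtoC_opp, Rmult_1_l. ring.
Qed.

End Remainder.

(** * The factorial series *)

Section FactorialSeries.

Variables (g : nat -> R -> C) (K : nat -> R) (B : R) (z : C).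
Hypothesis g_deriv : deriv_seq g (-1) 1.
Hypothesis g_le : forall n c, 0 <= c < 1 -> Cmod (g n c) * (1 - c) ^ n <= K n * exp (- B * ln (1 - c)).
Hypothesis B_pos : 0 < B.
Hypothesis z_gt : B < Re z.

(* [s^n] times the [n]-th derivative, at [s = e^-t]. *)
Definition euler_seq (n : nat) (t : R) : C := RtoC (exp (- INR n * t)) * g n (1 - exp (- t))%R.

Lemma Rder_euler_seq (n : nat) (t : R) : 0 <= t ->
  Rder (euler_seq n) t (euler_seq (S n) t - RtoC (INR n) * euler_seq n t).
Proof.
  intros Ht. eapply Rder_eq.
  - apply Rder_mult.
    + apply (Rder_RtoC (fun t => exp (- INR n * t)) t (- INR n * exp (- INR n * t))%R).
      auto_derive; [trivial|ring].
    + apply (Rder_comp (g n) (fun t => 1 - exp (- t))%R t (exp (- t))).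
      * apply g_deriv. assert (H1 := exp_pos (- t)).
        assert (H2 : exp (- t) <= exp 0) by (apply exp_monotone; lra). rewrite exp_0 in H2. lra.
      * auto_derive; [trivial|ring].
  - unfold euler_seq. replace (- INR (S n) * t)%R with (- INR n * t + - t)%R by (rewrite S_INR; ring).
    rewrite exp_plus, !RtoC_mult, RtoC_opp. ring.
Qed.

Lemma euler_seq_0 (n : nat) : euler_seq n 0 = g n 0%R.
Proof.
  unfold euler_seq. rewrite Rmult_0_r, Ropp_0, exp_0, Rminus_diag. ring.
Qed.

Lemma euler_seq_le (n : nat) (t : R) : 0 <= t -> Cmod (euler_seq n t) <= K n * exp (B * t).
Proof.
  intros Ht. assert (H1 := exp_pos (- t)).
  assert (H2 : exp (- t) <= exp 0) by (apply exp_monotone; lra). rewrite exp_0 in H2.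
  assert (H := g_le n (1 - exp (- t))%R ltac:(lra)).
  replace (1 - (1 - exp (- t)))%R with (exp (- t)) in H by ring.
  rewrite ln_exp in H. replace (- B * - t)%R with (B * t)%R in H by ring.
  unfold euler_seq. rewrite Cmod_mult, Cmod_R, Rabs_pos_eq by (left; apply exp_pos).
  replace (exp (- INR n * t)) with (exp (- t) ^ n)%R; [lra|].
  rewrite <- Rpower_pow by assumption. unfold Rpower. rewrite ln_exp. f_equal. ring.
Qed.

Definition laplace_integrand (n : nat) (t : R) : C := euler_seq n t * Cexp (- z * RtoC t).

Lemma Rder_laplace_integrand (n : nat) (t : R) : 0 <= t ->
  Rder (laplace_integrand n) t
    (laplace_integrand (S n) t - (z + RtoC (INR n)) * laplace_integrand n t).
Proof.
  intros Ht. eapply Rder_eq.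
  - apply Rder_mult; [now apply Rder_euler_seq|apply Rder_Cexp].
  - unfold laplace_integrand. ring.
Qed.

Lemma laplace_integrand_cont (n : nat) (t : R) : 0 <= t -> Rcont (laplace_integrand n) t.
Proof. intros Ht. eapply Rder_cont. now apply Rder_laplace_integrand. Qed.

Lemma laplace_integrand_le (n : nat) (t : R) : 0 <= t ->
  Cmod (laplace_integrand n t) <= K n * exp (- (Re z - B) * t).
Proof.
  intros Ht. unfold laplace_integrand. rewrite Cmod_mult, Cmod_Cexp.
  replace (Re (- z * RtoC t)) with (- Re z * t)%R by (destruct z; cbn; ring).
  replace (- (Re z - B) * t)%R with (B * t + - Re z * t)%R by ring.
  rewrite exp_plus, <- Rmult_assoc. apply Rmult_le_compat_r; [left; apply exp_pos|].
  now apply euler_seq_le.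
Qed.

Lemma bound_nonneg (n : nat) : 0 <= K n.
Proof.
  assert (H := euler_seq_le n 0 ltac:(lra)). rewrite Rmult_0_r, exp_0, Rmult_1_r in H.
  eapply Rle_trans; [apply Cmod_ge_0|exact H].
Qed.

Lemma laplace_exists (n : nat) : exists J,
  is_CInt_inf (laplace_integrand n) J /\ Cmod J <= K n / (Re z - B).
Proof.
  set (d := (Re z - B)%R). assert (Hd : 0 < d) by (unfold d; lra). assert (HK := bound_nonneg n).
  (* The primitive of the dominating exponential increases from [- (K n / d)] to 0, which gives the
     exact constant. *)
  destruct (is_CInt_inf_dominated (laplace_integrand n) (fun t => - (K n / d) * exp (- d * t))%R
    (fun t => K n * exp (- d * t))%R (- (K n / d)) 0) as (J & H1 & H2).
  - intros t Ht. apply laplace_integrand_cont. lra.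
  - intros t Ht. auto_derive; [trivial|]. field. lra.
  - intros t Ht. apply (ex_derive_continuous (V := R_NormedModule)). auto_derive. trivial.
  - intros t Ht. apply laplace_integrand_le. lra.
  - intros t Ht. assert (E1 := exp_pos (- d * t)).
    assert (E2 : exp (- d * t) <= exp 0) by (apply exp_monotone; nra). rewrite exp_0 in E2.
    assert (0 <= K n / d) by (apply Rmult_le_pos; [assumption|left; now apply Rinv_0_lt_compat]).
    split; nra.
  - exists J. split; [assumption|lra].
Qed.

Lemma laplace_recurrence (n : nat) (J J' : C) :
  is_CInt_inf (laplace_integrand n) J -> is_CInt_inf (laplace_integrand (S n)) J' ->
  (z + RtoC (INR n)) * J = g n 0%R + J'.
Proof.
  intros H H'. assert (HK := bound_nonneg n). assert (Hd : 0 < Re z - B) by lra.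
  assert (I1 := is_CInt_inf_minus _ _ _ _ H' (is_CInt_inf_Cmult (z + RtoC (INR n)) _ _ H)).
  assert (I2 : is_CInt_inf
    (fun t => laplace_integrand (S n) t - (z + RtoC (INR n)) * laplace_integrand n t) (0 - g n 0%R)).
  { apply (is_CInt_inf_Rder (laplace_integrand n)).
    - intros t Ht. apply Rder_laplace_integrand. lra.
    - intros t Ht. apply Rcont_minus; [apply laplace_integrand_cont; lra|].
      apply (Rcont_mult (fun _ => z + RtoC (INR n))); [apply Rcont_const|].
      apply laplace_integrand_cont; lra.
    - intros eps He.
      destruct (Rcont_elim _ _ (laplace_integrand_cont n 0 ltac:(lra)) eps He) as [d [Hd' Hy]].
      exists d. split; [assumption|]. intros a Ha. specialize (Hy a).
      unfold laplace_integrand at 2 in Hy. rewrite euler_seq_0 in Hy.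
      replace (- z * 0) with (RtoC 0) in Hy by ring. rewrite Cexp_0, Cmult_1_r in Hy.
      apply Hy. rewrite Rminus_0_r, Rabs_pos_eq; lra.
    (* Beyond this point [(K n + 1) * exp (- (Re z - B) * b) < eps]; the added 1 covers
       [K n = 0]. *)
    - intros eps He. exists (Rmax 0 (ln ((K n + 1) / eps) / (Re z - B))). intros b Hb.
      assert (M1 := Rmax_l 0 (ln ((K n + 1) / eps) / (Re z - B))).
      assert (M2 := Rmax_r 0 (ln ((K n + 1) / eps) / (Re z - B))).
      replace (laplace_integrand n b - 0) with (laplace_integrand n b) by ring.
      eapply Rle_lt_trans; [apply laplace_integrand_le; lra|].
      assert (Hq : 0 < (K n + 1) / eps) by (apply Rdiv_lt_0_compat; lra).
      assert (E : exp (- (Re z - B) * b) < eps / (K n + 1)).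
      { replace (eps / (K n + 1))%R with (exp (- ln ((K n + 1) / eps))).
        - apply exp_increasing.
          assert (Hb' : ln ((K n + 1) / eps) / (Re z - B) < b) by lra.
          apply (Rmult_lt_compat_l (Re z - B)) in Hb'; [|assumption].
          replace ((Re z - B) * (ln ((K n + 1) / eps) / (Re z - B)))%R
            with (ln ((K n + 1) / eps)) in Hb' by (field; lra). lra.
        - rewrite exp_Ropp, exp_ln by assumption. field. lra. }
      assert (E0 := exp_pos (- (Re z - B) * b)).
      apply Rle_lt_trans with ((K n + 1) * exp (- (Re z - B) * b))%R; [nra|].
      apply (Rmult_lt_compat_l (K n + 1)) in E; [|lra].
      replace ((K n + 1) * (eps / (K n + 1)))%R with eps in E by (field; lra). exact E. }
  assert (E := is_CInt_inf_unique _ _ _ I1 I2).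
  replace ((z + RtoC (INR n)) * J) with (J' - (J' - (z + RtoC (INR n)) * J)) by ring.
  rewrite E. ring.
Qed.

(** Dividing the recurrence by [rising z (S n) = rising z n * (z + n)] makes it telescope. *)
Lemma laplace_telescope (J : nat -> C) : (forall n, is_CInt_inf (laplace_integrand n) (J n)) ->
  forall N, J O = sum_n (G := C_AbelianMonoid) (fun n => g n 0%R / rising z (S n)) N
                  + J (S N) / rising z (S N) :> C.
Proof.
  intros HJ. assert (Hz : 0 < Re z) by lra.
  assert (R : forall n, J n / rising z n = g n 0%R / rising z (S n) + J (S n) / rising z (S n)).
  { intros n. assert (E := laplace_recurrence n _ _ (HJ n) (HJ (S n))).
    assert (N1 := rising_neq_0 z n Hz). assert (N2 := rising_neq_0 z (S n) Hz).
    assert (N3 : z + RtoC (INR n) <> 0).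
    { intros E0. apply N2. cbn [rising]. rewrite E0. ring. }
    replace (J (S n)) with ((z + RtoC (INR n)) * J n - g n 0%R) by (rewrite E; ring).
    cbn [rising]. field. auto. }
  induction N as [|N IH].
  - rewrite sum_O. rewrite <- R. cbn [rising]. field.
  - rewrite Csum_Sn, IH, R. ring.
Qed.

End FactorialSeries.

(** With [X = N + 1 + B] and [r = (N + 1) / X], the factors [(1 - r)^-B = X^B / B^B] and
    [r^-(N+1) = X^(N+1) / (N + 1)^(N+1)] combine into [X^X]. One factor [N + 1] of [(N + 1)!]
    cancels, which leaves the power [(N + 1)^N] and [N! = Gamma (N + 1)]. *)
Lemma R1_bound_eq (A B : R) (N : nat) (z : C) : 0 < A -> 0 < B -> B < Re z ->
  R1_bound A B N z =
  (INR (Factorial.fact (S N)) * (A * exp (- B * ln (1 - (INR N + 1) / (INR N + 1 + B))))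
     / ((INR N + 1) / (INR N + 1 + B)) ^ S N / (Re z - B) / Cmod (rising z (S N)))%R.
Proof.
  intros HA HB Hz. assert (HN := pos_INR N). assert (Hz0 : 0 < Re z) by lra.
  assert (Hr := rising_neq_0 z (S N) Hz0). assert (HG := CGamma_neq_0 z Hz0).
  unfold R1_bound. rewrite CGamma_fact.
  replace (RtoC (INR N + 1)) with (RtoC (INR (S N))) by now rewrite S_INR.
  rewrite CGamma_plus_nat by assumption.
  assert (Hd : RtoC (Re z - B) <> 0) by (intros E; injection E; lra).
  replace (CGamma z * RtoC (INR (Factorial.fact N)) / (rising z (S N) * CGamma z * RtoC (Re z - B)))
    with (RtoC (INR (Factorial.fact N)) / (rising z (S N) * RtoC (Re z - B))) by (field; auto).
  rewrite Cmod_div, Cmod_mult, !Cmod_R, !Rabs_pos_eq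
    by (try lra; try apply pos_INR; now apply Cmult_neq_0).
  apply Cmod_gt_0 in Hr.
  set (X := (INR N + 1 + B)%R). assert (HX : 0 < X) by (unfold X; lra).
  replace (INR N + B + 1)%R with X by (unfold X; ring).
  replace (1 - (INR N + 1) / X)%R with (B / X)%R by (unfold X; field; lra).
  rewrite ln_div by lra.
  replace (exp (- B * (ln B - ln X))) with (Rpower X B / Rpower B B)%R.
  2:{ unfold Rpower. replace (- B * (ln B - ln X))%R with (B * ln X + - (B * ln B))%R by ring.
      rewrite exp_plus, exp_Ropp. reflexivity. }
  assert (EX : Rpower X X = (X ^ S N * Rpower X B)%R).
  { rewrite <- Rpower_pow, <- Rpower_plus by assumption. f_equal. rewrite S_INR. unfold X. ring. }
  rewrite EX.
  assert (HB' : 0 < Rpower B B) by apply exp_pos.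
  change (Factorial.fact (S N)) with (S N * Factorial.fact N)%nat. rewrite mult_INR, S_INR.
  replace (((INR N + 1) / X) ^ S N)%R with ((INR N + 1) ^ S N / X ^ S N)%R
    by (unfold Rdiv; now rewrite Rpow_mult_distr, pow_inv).
  cbn [pow].
  assert (P1 : ((INR N + 1) ^ N <> 0)%R) by (apply pow_nonzero; lra).
  assert (P2 : (X ^ N <> 0)%R) by (apply pow_nonzero; lra).
  field. repeat split; try assumption; lra.
Qed.

Theorem proposition3p1 (a : nat -> C) (F : C -> C) (A B : R) :
  gevrey1 a ->
  (* F is holomorphic on DeltaDom *)
  (forall zeta : C, DeltaDom zeta -> ex_derive (K := C_AbsRing) (V := C_NormedModule) F zeta) ->
  (* F extends the Borel transform (the convergent power series near 0) *)
  (exists r : R, 0 < r /\ forall zeta : C, Cmod zeta < r ->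
      is_pseries (K := C_AbsRing) (V := C_NormedModule) (borel_coef a) zeta (F zeta)) ->
  0 < A -> 0 < B ->
  (forall zeta : C, DeltaDom zeta -> Cmod (F zeta) <= A * exp (B * Cmod zeta)) ->
  forall (N : nat) (z : C), B < Re z ->
    Cmod (borel_sum a F z -
          (a 0%nat + sum_n (G := C_AbelianMonoid)
             (fun n : nat => CGamma z * CGamma (RtoC (INR n + 1)) * bcoef a n
                             / CGamma (z + RtoC (INR n + 1))) N))
    <= R1_bound A B N z.
Proof.
  intros _ F_diff [rad [Hrad HF]] HA HB F_bound N z Hz.
  assert (Hz0 : 0 < Re z) by lra. assert (HN := pos_INR N).
  destruct (disc_fun_deriv_seq F F_diff) as (g & g_deriv & g_0).
  (* One radius serves all orders; it is tuned to order [N + 1], the only one whose bound enters the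
     remainder. *)
  set (r := ((INR N + 1) / (INR N + 1 + B))%R).
  assert (Hr : 0 < r < 1).
  { unfold r. split; [apply Rdiv_lt_0_compat; lra|].
    apply (Rmult_lt_reg_r (INR N + 1 + B)); [lra|]. unfold Rdiv. rewrite Rmult_assoc, Rinv_l; lra. }
  pose (K := fun n => (INR (Factorial.fact n) * (A * exp (- B * ln (1 - r))) / r ^ n)%R).
  assert (g_le : forall n c, 0 <= c < 1 ->
    Cmod (g n c) * (1 - c) ^ n <= K n * exp (- B * ln (1 - c))).
  { intros n c Hc. assert (H := disc_deriv_bound F A B F_diff HA HB F_bound g g_deriv g_0 n c r Hc Hr).
    assert (Hrn : 0 < r ^ n) by (apply pow_lt; lra).
    apply (Rmult_le_reg_r (r ^ n)); [assumption|]. eapply Rle_trans; [exact H|]. right. unfold K.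
    replace (B * (- ln (1 - c) - ln (1 - r)))%R with (- B * ln (1 - r) + - B * ln (1 - c))%R by ring.
    rewrite exp_plus. field. lra. }
  destruct (ClassicalEpsilon.choice _ (laplace_exists g K B z g_deriv g_le Hz)) as [J HJ].
  assert (E0 : borel_sum a F z = a O + J O).
  (* For [c = 1 - e^-t] the pullback is evaluated at [- ln (e^-t) = t], so the Borel integrand is
     the one of order 0. *)
  { unfold borel_sum. f_equal. apply CInt_0_inf_eq.
    apply is_CInt_inf_ext with (laplace_integrand g z 0); [|apply HJ].
    intros t Ht. unfold laplace_integrand, euler_seq. f_equal.
    assert (P1 := exp_pos (- t)). assert (P2 := exp_lt_1 (- t) ltac:(lra)).
    rewrite g_0 by (apply Rabs_def1; lra). cbn [INR]. rewrite Ropp_0, Rmult_0_l, exp_0, Cmult_1_l.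
    unfold disc_fun. rewrite <- RtoC_minus.
    replace (1 - (1 - exp (- t)))%R with (exp (- t)) by ring.
    rewrite Clog_real, ln_exp by assumption. rewrite RtoC_opp. f_equal. ring. }
  assert (E1 := laplace_telescope g K B z g_deriv g_le HB Hz J (fun n => proj1 (HJ n)) N).
  rewrite E0, E1.
  rewrite (sum_n_ext (G := C_AbelianMonoid)
    (fun n => CGamma z * CGamma (RtoC (INR n + 1)) * bcoef a n / CGamma (z + RtoC (INR n + 1)))
    (fun n => g n 0%R / rising z (S n))).
  - match goal with |- Cmod ?X <= _ => replace X with (J (S N) / rising z (S N)) by ring end.
    assert (Hrn := rising_neq_0 z (S N) Hz0).
    rewrite R1_bound_eq, Cmod_div by assumption. fold r. apply Cmod_gt_0 in Hrn.
    apply Rmult_le_compat_r; [left; now apply Rinv_0_lt_compat|]. apply (HJ (S N)).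
  - intros n. rewrite (disc_deriv_at_0 F g g_deriv g_0 a rad n Hrad HF), CGamma_fact.
    replace (RtoC (INR n + 1)) with (RtoC (INR (S n))) by now rewrite S_INR.
    rewrite CGamma_plus_nat by assumption.
    match goal with |- @eq _ ?u ?v => change (@eq C u v) end.
    field. split; [now apply rising_neq_0|now apply CGamma_neq_0].
Qed.
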